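(* Let $d\ge 1$, let $\|\cdot\|$ be a norm on $\mathbb{R}^d$, and let $r>0$. Let $\mathbf{X}$ be a $d$-dimensional real-valued random vector whose distribution has a probability density function $f_{\mathbf{X}}$ (with respect to Lebesgue measure) such that $\mathbf{x}\mapsto f_{\mathbf{X}}(\mathbf{x})\log f_{\mathbf{X}}(\mathbf{x})$ is integrable, so that the differential entropy $h(\mathbf{X})=-\int f_{\mathbf{X}}(\mathbf{x})\log f_{\mathbf{X}}(\mathbf{x})\,d\mathbf{x}$ is finite. For $D>0$ let $$R(D)=\inf_{P_{\hat{\mathbf{X}}|\mathbf{X}}\colon \mathbb{E}[\|\mathbf{X}-\hat{\mathbf{X}}\|^r]\le D} I(\mathbf{X};\hat{\mathbf{X}}),$$ the infimum being over all conditional distributions of a $d$-dimensional random vector $\hat{\mathbf{X}}$ given $\mathbf{X}$ satisfying $\mathbb{E}[\|\mathbf{X}-\hat{\mathbf{X}}\|^r]\le D$ (expectation under $P_{\mathbf{X}}P_{\hat{\mathbf{X}}|\mathbf{X}}$), and let $$R_{\mathrm{SLB}}(D)=h(\mathbf{X})+\frac{d}{r}\log\frac{1}{D}-\frac{d}{r}\log\left(\frac{r}{d}\bigl(V_d\,\Gamma(1+d/r)\bigr)^{r/d}e\right),$$ where $V_d$ is the Lebesgue volume of the unit ball $\{\mathbf{x}\in\mathbb{R}^d:\|\mathbf{x}\|\le 1\}$. Then: (a) if $H(\lfloor\mathbf{X}\rfloor)<\infty$, then $\lim_{D\downarrow 0}\{R(D)-R_{\mathrm{SLB}}(D)\}=0$;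 (b) if $H(\lfloor\mathbf{X}\rfloor)=\infty$, then $R(D)=\infty$ for every $D>0$.
   Context: $\log$ denotes the natural logarithm and $\Gamma$ the Gamma function. For $\mathbf{a}=(a_1,\dots,a_d)\in\mathbb{R}^d$, $\lfloor\mathbf{a}\rfloor$ denotes the vector $(\lfloor a_1\rfloor,\dots,\lfloor a_d\rfloor)\in\mathbb{Z}^d$, where $\lfloor a\rfloor$ is the largest integer not larger than $a$. $H(\cdot)$ denotes the (Shannon) entropy of a discrete random vector, which may be $+\infty$; $I(\cdot;\cdot)$ denotes mutual information. *)

(* Defs.v *)
From HB Require Import structures.
From mathcomp Require Import all_boot all_order all_algebra.
From mathcomp Require Import all_classical all_reals all_analysis.
Set Implicit Arguments. Unset Strict Implicit. Unset Printing Implicit Defensive.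
Import Order.TTheory GRing.Theory Num.Theory.
Import numFieldNormedType.Exports.
Local Open Scope classical_set_scope.
Local Open Scope ring_scope.

Section RateDistortion.
Variables (R : realType) (d : nat).
Local Notation T := (d.-tuple R).

Definition tzero : T := [tuple (0:R) | i < d].
Definition tadd (x y : T) : T := [tuple tnth x i + tnth y i | i < d].
Definition tsub (x y : T) : T := [tuple tnth x i - tnth y i | i < d].
Definition tscale (c : R) (x : T) : T := [tuple c * tnth x i | i < d].

Definition is_norm (N : T -> R) : Prop :=
  [/\ forall x, 0 <= N x,
      forall x, N x = 0 -> x = tzero,
      forall c x, N (tscale c x) = `|c| * N x
    & forall x y, N (tadd x y) <= N x + N y].

Definition box (a b : T) : set T :=
  [set x | forall i, tnth a i < tnth x i <= tnth b i].

(* lam is Lebesgue measure on the Borel sets of R^d (characterised by its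
   values on boxes, which determine it uniquely) *)
Definition is_lebesgue (lam : {measure set T -> \bar R}) : Prop :=
  forall a b : T, (forall i, tnth a i <= tnth b i) ->
    lam (box a b) = (\prod_(i < d) (tnth b i - tnth a i))%:E.

Variable lam : {measure set T -> \bar R}.
Variable f : T -> R.

Definition PX (A : set T) : \bar R := (\int[lam]_(x in A) (f x)%:E)%E.

Definition diff_entropy : R := - Rintegral lam setT (fun x => f x * ln (f x)).

Definition floor_cell (k : d.-tuple int) : set T :=
  [set x | forall i, Num.floor (tnth x i) = tnth k i].
Definition floor_prob (k : d.-tuple int) : R := fine (PX (floor_cell k)).
Definition entropy_floor : \bar R :=
  (\esum_(k in [set: d.-tuple int]) (- (floor_prob k * ln (floor_prob k)))%:E)%E.

Definition joint (k : R.-pker T ~> T) (A B : set T) : \bar R :=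
  (\int[lam]_(x in A) ((f x)%:E * k x B))%E.

Definition is_partition n (A : 'I_n -> set T) : Prop :=
  [/\ forall i, measurable (A i),
      forall i j, i != j -> A i `&` A j = set0
    & forall x, exists i, A i x].
Definition mi_term (p a b : R) : R := if p == 0 then 0 else p * ln (p / (a * b)).
Definition mutual_info (k : R.-pker T ~> T) : \bar R :=
  ereal_sup [set z | exists m n (A : 'I_m -> set T) (B : 'I_n -> set T),
    [/\ is_partition A, is_partition B &
      z = (\sum_(i < m) \sum_(j < n)
             mi_term (fine (joint k (A i) (B j))) (fine (PX (A i)))
                     (fine (joint k setT (B j))))%:E]].

Variables (N : T -> R) (r : R).

Definition distortion (k : R.-pker T ~> T) : \bar R :=
  (\int[lam]_x ((f x)%:E * \int[k x]_y ((N (tsub x y)) `^ r)%:E))%E.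

Definition RD (D : R) : \bar R :=
  ereal_inf [set z | exists k : R.-pker T ~> T,
                 (distortion k <= D%:E)%E /\ z = mutual_info k].

Definition Gamma (s : R) : R :=
  Rintegral lebesgue_measure `]0%R, +oo[%classic (fun t => t `^ (s - 1) * expR (- t)).

Definition unit_ball_vol : R := fine (lam [set x | N x <= 1]).

Definition RSLB (D : R) : R :=
  diff_entropy + (d%:R / r) * ln (1 / D)
  - (d%:R / r) * ln ((r / d%:R) * (unit_ball_vol * Gamma (1 + d%:R / r)) `^ (r / d%:R)
                     * expR 1).

End RateDistortion.

(* Main.v *)
(* Put p = d/r and let Z be the integral of exp (- N x ^ r), so that
   Z = V_d Gamma(1 + p) and RSLB D = h - p - ln Z + p ln (p / D).

   Lower bounds. Cut the space into cells A_i of small diameter with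
   P(A_i) <= exp (gam_i) lam(A_i). In Gibbs' inequality
   p ln (p / ab) >= p ln c + p - c ab take c proportional to
   exp (- gam_i - la * dist ^ r): every channel of distortion at most D has
   information at least - sum_i P(A_i) gam_i - la D - ln int exp (- la N ^ r),
   up to small errors. Cells on which ln f is almost constant, with la = p / D,
   give RSLB D <= R(D). The integer cells with gam_i = ln P(A_i) + constant give
   a bound H(floor X) - constant, hence R(D) = +oo when H(floor X) = +oo.

   Upper bound. The channel X + s W, with W of density exp (- N z ^ r) / Z, has
   distortion s ^ r p. For every sub-probability density q its information is at
   most E[ln of the noise density] - d ln s - E[ln q(X + s W)], again by Gibbs.
   Take for q a mixture of a step function close to f, spread over open
   neighbourhoods of finitely many cells, and of a small multiple of the density g
   of X + W. As s -> 0 the point X + s W enters the neighbourhood of the cell of X,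
   and - ln g(X + s W) is dominated by a constant plus 2 ^ r N(W) ^ r
   - ln P(integer cell of X), which is integrable exactly when H(floor X) is
   finite. Dominated convergence turns the bound into h - p - ln Z - d ln s + o(1),
   which is RSLB D + o(1) for s ^ r p = D. *)
Require Import Defs.
From HB Require Import structures.
From mathcomp Require Import all_boot all_order all_algebra.
From mathcomp Require Import all_classical all_reals all_analysis.
From mathcomp Require Import measurable_realfun ring lra zify.
Set Implicit Arguments. Unset Strict Implicit. Unset Printing Implicit Defensive.
Import Order.TTheory GRing.Theory Num.Theory.
Import numFieldNormedType.Exports.
Local Open Scope classical_set_scope.
Local Open Scope ring_scope.

(** * Lebesgue measure on tuples *)


(** [mutual_info] is a supremum of finite sums over pairs of partitions, so the joint law is never
    given a density: the lower bound exhibits partitions, and the upper bound uses domination on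
    rectangles. The price is truncation. A finite partition has a remainder cell on the input side
    and on the output side. The output remainder is made small after the input cells are fixed,
    because its cost depends on the values [gam] attached to them. [N x ^ r] has no triangle
    inequality when [1 < r]; a factor [1 - th] and an additive error are given up instead
    ([powR_approx]). The choice [la = p / D] maximises [p * ln la - la * D]. Neither part of the
    mixture would do alone. The step function vanishes outside finitely many neighbourhoods, so it
    gives no bound on minus the logarithm there, while the logarithm of [g] has nothing to do with
    [ln f]. The neighbourhoods are open so that, for a fixed input and a fixed noise value, the
    output lies in the right one for all small [s]. Since [ln 0 = 0] by convention, the zeros of [f]
    are kept in cells of their own, or discarded as a null set. *)

Section Coordinates.
Variables (R : realType) (d : nat).
Local Notation T := (d.-tuple R).

Lemma measurable_forall_ord disp (X : measurableType disp) n
    (F : 'I_n -> set X) :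
  (forall i, measurable (F i)) -> measurable [set x | forall i, F i x].
Proof.
move=> mF; have -> : [set x | forall i, F i x] = \bigcap_(i in [set: 'I_n]) F i.
  by apply/seteqP; split=> x /= h i => [_|]; exact: h.
exact: fin_bigcap_measurable.
Qed.

(** Openness for the sup distance, phrased through coordinates only; all the topology on tuples used
    in the regularity argument goes through this condition. *)
Definition sup_open (U : set T) := forall x, U x ->
  exists2 e : R, 0 < e & forall y, (forall i, `|tnth y i - tnth x i| < e) -> U y.

Definition cube (c : T) (e : R) : set T :=
  [set y | forall i, `|tnth y i - tnth c i| < e].

Lemma measurable_cube c e : measurable (cube c e).
Proof.
apply: (@measurable_forall_ord _ _ d (fun i => [set y : T | `|tnth y i - tnth c i| < e])).
move=> i; rewrite (_ : [set y : T | _] =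
   (fun y : T => tnth y i) @^-1` `]tnth c i - e, tnth c i + e[%classic).
  rewrite -[X in measurable X]setTI; apply: measurable_tnth => //.
by apply/seteqP; split=> y /=; rewrite in_itv/= ltr_distl.
Qed.

(** [U] is the union of the countably many cubes with rational centre and radius [1 / (n + 1)] that
    it contains. *)
Lemma sup_open_measurable U : sup_open U -> measurable U.
Proof.
move=> oU.
pose C (p : d.-tuple rat * nat) := cube [tuple ratr (tnth p.1 i) | i < d] (p.2.+1%:R^-1).
pose F p := if `[< C p `<=` U >] then C p else set0.
have -> : U = \bigcup_p F p.
  apply/seteqP; split => [x Ux|x [p _]]; last first.
    by rewrite /F; case: asboolP => [|//]; exact.
  have [e e0 he] := oU _ Ux.
  (* The radius is spent twice: from [x] to the rational centre, and from the centre to a point of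
     the cube. *)
  have [n hn] : exists n, n.+1%:R^-1 < e / 2 :> R.
    by exists (Num.truncn (e/2)^-1); rewrite invf_plt ?posrE ?divr_gt0//  truncnS_gt.
  have hq i : {q : rat | `|tnth x i - ratr q| < n.+1%:R^-1}.
    apply: cid.
    have [|q] := @rat_in_itvoo R (tnth x i - n.+1%:R^-1) (tnth x i + n.+1%:R^-1).
      by rewrite ltrBlDr -addrA ltrDl addr_gt0.
    by rewrite in_itv/= => hq; exists q; rewrite distrC ltr_distl.
  exists ([tuple sval (hq i) | i < d], n) => //.
  have hC : C ([tuple sval (hq i) | i < d], n) `<=` U.
    move=> y hy; apply: he => i.
    have := hy i; have := svalP (hq i); rewrite !tnth_mktuple /= => h1 h2.
    rewrite -(subrKA (ratr (sval (hq i)))); apply: le_lt_trans (ler_normD _ _) _.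
    rewrite (distrC _ (tnth x i)) (splitr e).
    by apply: ltrD; apply: lt_trans hn.
  rewrite /F asboolT// => i; rewrite !tnth_mktuple; exact: (svalP (hq i)).
apply: countable_bigcupT_measurable => // p; rewrite /F; case: ifP => // _.
exact: measurable_cube.
Qed.

End Coordinates.

Section Lebesgue.
Variables (R : realType) (d : nat).
Local Notation T := (d.-tuple R).

Lemma measurable_box (a b : T) : measurable (box a b).
Proof.
rewrite /box.
apply: (@measurable_forall_ord _ _ d (fun i => [set y : T | tnth a i < tnth y i <= tnth b i])).
move=> i; rewrite (_ : [set y : T | _] =
   (fun y : T => tnth y i) @^-1` `]tnth a i, tnth b i]%classic).
  rewrite -[X in measurable X]setTI; apply: measurable_tnth => //.
by apply/seteqP; split=> y /=; rewrite in_itv/=.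
Qed.

Definition boxes : set (set T) := [set box p.1 p.2 | p in [set: T * T]].

Definition big_box (n : nat) : set T :=
  box [tuple - (n%:R : R) | i < d] [tuple (n%:R : R) | i < d].

Lemma bigcup_big_box : \bigcup_n big_box n = setT.
Proof.
apply/seteqP; split => // x _.
exists (\max_(i < d) Num.truncn `|tnth x i|).+1 => //= i; rewrite !tnth_mktuple.
have : `|tnth x i| < (\max_(i < d) Num.truncn `|tnth x i|).+1%:R.
  apply: lt_le_trans (truncnS_gt _) _; rewrite ler_nat ltnS.
  exact: (@leq_bigmax _ (fun i => Num.truncn `|tnth x i|)).
by rewrite ltr_norml => /andP[-> /ltW].
Qed.

Lemma setI_closed_boxes : setI_closed boxes.
Proof.
move=> _ _ [[a b] _ <-] [[a' b'] _ <-] /=.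
exists ([tuple Num.max (tnth a i) (tnth a' i) | i < d],
        [tuple Num.min (tnth b i) (tnth b' i) | i < d]) => //=.
apply/seteqP; split => [x h|x [h h'] i].
  split=> i; have := h i; rewrite !tnth_mktuple/= gt_max le_min;
    by move=> /andP[/andP[h1 h2] /andP[h3 h4]]; apply/andP.
have /andP[h1 h2] := h i; have /andP[h3 h4] := h' i.
by rewrite !tnth_mktuple/= gt_max le_min h1 h2 h3 h4.
Qed.

(** Measurability into tuples is tested on coordinates, so only the half-spaces [x < tnth y i] need
    be generated: each is the union over [n] of boxes with lower bound [x] in direction [i] and
    [- n] in the others. *)
Lemma measurable_boxesE : (measurable : set (set T)) = <<s boxes >>.
Proof.
apply/seteqP; split; last first.
  apply: smallest_sub; first exact: sigma_algebra_measurable.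
  by move=> _ [[a b] _ <-]; exact: measurable_box.
suff mid : measurable_fun [set: g_sigma_algebraType boxes] (id : g_sigma_algebraType boxes -> T).
  by move=> A mA; have := mid measurableT A mA; rewrite setTI.
apply/measurable_fun_tnthP => i /=.
apply: (measurability (@RGenOInfty.G R)); first exact: RGenOInfty.measurableE.
move=> _ [_ [x ->] <-]; rewrite setTI.
pose B n := box [tuple if j == i then x else - (n%:R : R) | j < d] [tuple n%:R : R | j < d].
rewrite (_ : _ @^-1` _ = \bigcup_n (B n)).
  apply: bigcupT_measurable => n; apply: sub_sigma_algebra.
  by exists ([tuple if j == i then x else - (n%:R : R) | j < d], [tuple n%:R : R | j < d]).
apply/seteqP; split => y /=; rewrite in_itv/= andbT.
  move=> xy; have [n _ hn] : (\bigcup_n big_box n) y by rewrite bigcup_big_box.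
  exists n => // j; have := hn j; rewrite !tnth_mktuple; case: eqP => [->|//].
  by rewrite xy => /andP[].
by move=> [n _ /(_ i)]; rewrite !tnth_mktuple eqxx => /andP[].
Qed.

Lemma lebesgue_big_box_lty (lam : {measure set T -> \bar R}) n :
  is_lebesgue lam -> (lam (big_box n) < +oo)%E.
Proof.
move=> h; rewrite h ?ltry// => i; rewrite !tnth_mktuple.
by rewrite (@le_trans _ _ 0)// oppr_le0.
Qed.

Lemma lebesgue_unique (m1 m2 : {measure set T -> \bar R}) :
  is_lebesgue m1 -> is_lebesgue m2 -> forall A, measurable A -> m1 A = m2 A.
Proof.
move=> h1 h2; apply: (measure_unique boxes big_box).
- exact: measurable_boxesE.
- exact: setI_closed_boxes.
- by move=> n; exists ([tuple - (n%:R : R) | i < d], [tuple (n%:R : R) | i < d]).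
- exact: bigcup_big_box.
- move=> _ [[a b] _ <-] /=.
  have [ab|/existsNP[i /negP]] := pselect (forall i, tnth a i <= tnth b i).
    by rewrite h1 ?h2.
  (* [is_lebesgue] says nothing when some side is reversed, but the box is then empty. *)
  rewrite -ltNge => ba; suff -> : box a b = set0 by rewrite !measure0.
  apply/seteqP; split => // x /(_ i) /andP[ax xb].
  by have := lt_le_trans ax xb; rewrite ltNge ltW.
- by move=> n; exact: lebesgue_big_box_lty.
Qed.

End Lebesgue.

Definition push_measure d1 d2 (R : realType) (X : measurableType d1)
    (Y : measurableType d2) (m : {measure set X -> \bar R}) (f : X -> Y)
    (mf : measurable_fun setT f) : {measure set Y -> \bar R}.
Proof.
by unshelve refine (pushforward m f : {measure set Y -> \bar R}); exact: mf.
Defined.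

Section SigmaFinite.
Context disp (X : measurableType disp) (R : realType).
Variable mu : {measure set X -> \bar R}.

(* An alias carrying the proof of sigma-finiteness, so that Fubini's theorem applies. *)
Definition as_sigma_finite of sigma_finite setT mu : set X -> \bar R := mu.

HB.instance Definition _ h := Measure.on (as_sigma_finite h).

HB.instance Definition _ h :=
  Measure_isSigmaFinite.Build _ _ _ (as_sigma_finite h) h.

End SigmaFinite.

Section Affine.
Variables (R : realType) (d : nat).
Local Notation T := (d.-tuple R).

Definition affine (x : T) (s : R) (z : T) : T := tadd x (tscale s z).

Lemma measurable_tadd disp (X : measurableType disp) (f g : X -> T) :
  measurable_fun setT f -> measurable_fun setT g ->
  measurable_fun setT (fun x => tadd (f x) (g x)).
Proof.
move=> /measurable_fun_tnthP mf /measurable_fun_tnthP mg.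
apply/measurable_fun_tnthP => i.
rewrite (_ : _ \o _ = (fun x => tnth (f x) i + tnth (g x) i)).
  exact: measurable_funD (mf i) (mg i).
by apply/funext => x /=; rewrite tnth_mktuple.
Qed.

Lemma measurable_tsub disp (X : measurableType disp) (f g : X -> T) :
  measurable_fun setT f -> measurable_fun setT g ->
  measurable_fun setT (fun x => tsub (f x) (g x)).
Proof.
move=> /measurable_fun_tnthP mf /measurable_fun_tnthP mg.
apply/measurable_fun_tnthP => i.
rewrite (_ : _ \o _ = (fun x => tnth (f x) i - tnth (g x) i)).
  exact: measurable_funB (mf i) (mg i).
by apply/funext => x /=; rewrite tnth_mktuple.
Qed.

Lemma measurable_tscale disp (X : measurableType disp) s (f : X -> T) :
  measurable_fun setT f -> measurable_fun setT (fun x => tscale s (f x)).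
Proof.
move=> /measurable_fun_tnthP mf; apply/measurable_fun_tnthP => i.
rewrite (_ : _ \o _ = (fun x => s * tnth (f x) i)).
  by apply: measurable_funM => //; exact: (mf i).
by apply/funext => x /=; rewrite tnth_mktuple.
Qed.

Lemma measurable_affine x s : measurable_fun setT (affine x s).
Proof.
apply: measurable_tadd => //; exact: measurable_tscale.
Qed.

Lemma measurable_affine2 s :
  measurable_fun setT (fun p : T * T => affine p.1 s p.2).
Proof.
apply: measurable_tadd => //; apply: measurable_tscale => //.
Qed.

Variable lam : {measure set T -> \bar R}.
Hypothesis hlam : is_lebesgue lam.

(** The rescaled pushforward [mu] gives boxes their volume, so uniqueness identifies it with [lam];
    this contains translation invariance and homogeneity at once. *)
Lemma lebesgue_affine x s : 0 < s -> forall A, measurable A ->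
  ((s ^+ d)%:E * lam (affine x s @^-1` A))%E = lam A.
Proof.
move=> s0 A mA.
have sd0 : 0 <= s ^+ d by rewrite exprn_ge0// ltW.
pose mu := mscale (NngNum sd0) (push_measure lam (measurable_affine x s)).
apply: (@lebesgue_unique _ _ mu) => //.
move=> a b ab.
rewrite /mscale/= /mscale/= /push_measure/= /pushforward/=.
have -> : affine x s @^-1` (box a b) =
  box [tuple (tnth a i - tnth x i) / s | i < d]
      [tuple (tnth b i - tnth x i) / s | i < d].
  apply/seteqP; split => z /= h i; have := h i; rewrite !tnth_mktuple.
    by rewrite ltr_pdivrMr// ler_pdivlMr// ltrBlDl lerBrDl (mulrC _ s).
  by rewrite ltr_pdivrMr// ler_pdivlMr// ltrBlDl lerBrDl (mulrC _ s).
rewrite hlam; last first.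
  by move=> i; rewrite !tnth_mktuple ler_pM2r ?invr_gt0// lerD2r.
rewrite -EFinM; congr (_%:E).
rewrite -[in s ^+ d](card_ord d) -prodr_const -big_split/=.
apply: eq_bigr => i _; rewrite !tnth_mktuple.
by field; rewrite gt_eqF.
Qed.

Lemma integral_affine x s (g : T -> \bar R) : 0 < s ->
  measurable_fun setT g -> (forall y, 0 <= g y)%E ->
  (\int[lam]_y g y = (s ^+ d)%:E * \int[lam]_z g (affine x s z))%E.
Proof.
move=> s0 mg g0.
have sd0 : 0 <= s ^+ d by rewrite exprn_ge0// ltW.
pose mu := push_measure lam (measurable_affine x s).
have -> : (\int[lam]_y g y = \int[mscale (NngNum sd0) mu]_y g y)%E.
  by apply: eq_measure_integral => A mA _; rewrite -(lebesgue_affine x s0 mA).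
rewrite ge0_integral_mscale//; congr (_ * _)%E.
by rewrite (ge0_integral_pushforward (measurable_affine x s)).
Qed.

Lemma integral_shift (y : T) (g : T -> \bar R) :
  measurable_fun setT g -> (forall y, 0 <= g y)%E ->
  (\int[lam]_x g (tsub x y) = \int[lam]_x g x)%E.
Proof.
move=> mg g0; rewrite [RHS](@integral_affine (tscale (-1) y) 1)// expr1n mul1e.
apply: eq_integral => x _; congr g.
by apply: eq_from_tnth => i; rewrite !tnth_mktuple; ring.
Qed.

Lemma lebesgue_sigma_finite : sigma_finite setT lam.
Proof.
exists (@big_box R d); first by rewrite bigcup_big_box.
by move=> n; split; [exact: measurable_box|exact: lebesgue_big_box_lty].
Qed.

Lemma measurable_floor_cell (k : d.-tuple int) : measurable (@floor_cell R d k).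
Proof.
rewrite /floor_cell.
apply: (@measurable_forall_ord _ _ d (fun i => [set y : T | Num.floor (tnth y i) = tnth k i])).
move=> i; rewrite (_ : [set y : T | _] =
   (fun y : T => tnth y i) @^-1` `[(tnth k i)%:~R, (tnth k i + 1)%:~R[%classic).
  rewrite -[X in measurable X]setTI; apply: measurable_tnth => //.
apply/seteqP; split=> y /=; rewrite in_itv/=.
  by move=> <-; exact: floor_itv.
by move=> h; exact: floor_def.
Qed.

(** Integer cells are closed on the left and boxes on the right; a box of side 1/2 fits inside the
    cell in spite of this, and a positive lower bound independent of [k] is all that part (b) asks
    for. *)
Lemma floor_cell_ge (k : d.-tuple int) :
  (((1 / 2) ^+ d)%:E <= lam (floor_cell k))%E.
Proof.
have -> : (((1 / 2) ^+ d)%:E = lam (box [tuple ((tnth k i)%:~R : R) | i < d]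
    [tuple ((tnth k i)%:~R + 1 / 2 : R)%R | i < d]))%E.
  rewrite hlam => [|i]; last by rewrite !tnth_mktuple lerDl.
  rewrite -[in X in X%:E = _](card_ord d) -prodr_const; congr (_%:E).
  by apply: eq_bigr => i _; rewrite !tnth_mktuple; ring.
apply: le_measure; rewrite ?inE; [exact: measurable_box|exact: measurable_floor_cell|].
move=> x h i; have := h i; rewrite !tnth_mktuple => /andP[h1 h2].
apply: floor_def; rewrite (ltW h1)/= rmorphD/=; lra.
Qed.

End Affine.

(** * Norms and the integral of exp (- N x ^ r) *)

Section Norm.
Variables (R : realType) (d : nat).
Local Notation T := (d.-tuple R).
Variables (N : T -> R) (hN : is_norm N).

Lemma norm_ge0 x : 0 <= N x. Proof. by case: hN. Qed.

Lemma norm_triangle x y : N (tadd x y) <= N x + N y. Proof. by case: hN. Qed.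

Lemma norm_scale c x : N (tscale c x) = `|c| * N x. Proof. by case: hN. Qed.

Lemma norm_zero : N (tzero R d) = 0.
Proof.
rewrite (_ : tzero R d = tscale 0 (tzero R d)) ?norm_scale ?normr0 ?mul0r//.
by apply: eq_from_tnth => i; rewrite !tnth_mktuple mul0r.
Qed.

Lemma norm_subC x y : N (tsub x y) = N (tsub y x).
Proof.
rewrite (_ : tsub x y = tscale (-1) (tsub y x)) ?norm_scale ?normrN1 ?mul1r//.
by apply: eq_from_tnth => i; rewrite !tnth_mktuple; ring.
Qed.

Lemma norm_sub_triangle y x z : N (tsub x z) <= N (tsub x y) + N (tsub y z).
Proof.
rewrite (_ : tsub x z = tadd (tsub x y) (tsub y z)) ?norm_triangle//.
by apply: eq_from_tnth => i; rewrite !tnth_mktuple; ring.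
Qed.

(** Induction on the number of coordinates kept: [P k] agrees with [x] on the first [k] and vanishes
    beyond, and each new coordinate costs the norm of one basis vector. *)
Lemma norm_le_coord : exists2 C : R, 0 < C &
  forall x e, 0 <= e -> (forall i, `|tnth x i| <= e) -> N x <= C * e.
Proof.
pose ei (j : nat) : T := [tuple ((i == j :> nat)%:R : R) | i < d].
pose S k := \sum_(0 <= j < k) N (ei j).
have S0 k : 0 <= S k by apply: sumr_ge0 => j _; exact: norm_ge0.
(* The summand 1 makes the constant positive even for an empty sum. *)
exists (S d + 1) => [|x e e0 he]; first by rewrite ltr_wpDl.
pose P k : T := [tuple if (i < k)%N then tnth x i else 0 | i < d].
have hP k : (k <= d)%N -> N (P k) <= S k * e.
  elim: k => [_|k IH kd].
    have -> : P 0%N = tzero R d by apply: eq_from_tnth => i; rewrite !tnth_mktuple.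
    by rewrite norm_zero mulr_ge0.
  rewrite (_ : P k.+1 = tadd (P k) (tscale (tnth x (Ordinal kd)) (ei k))); last first.
    apply: eq_from_tnth => i; rewrite !tnth_mktuple ltnS leq_eqVlt.
    case: eqP => [ik|_] /=.
      by rewrite ik ltnn mulr1 add0r; congr tnth; apply: val_inj.
    by rewrite mulr0 addr0.
  apply: le_trans (norm_triangle _ _) _.
  rewrite /S big_nat_recr//= mulrDl lerD ?IH ?(ltnW kd)// norm_scale mulrC.
  by rewrite ler_wpM2l ?norm_ge0.
rewrite (_ : x = P d); first by rewrite (le_trans (hP d _))// ler_wpM2r// lerDl.
by apply: eq_from_tnth => i; rewrite !tnth_mktuple ltn_ord.
Qed.

Lemma sup_open_norm_lt c t : sup_open [set x | N (tsub x c) < t].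
Proof.
move=> x /= xt; have [C C0 hC] := norm_le_coord.
exists ((t - N (tsub x c)) / (2 * C)); first by rewrite divr_gt0 ?subr_gt0 ?mulr_gt0.
move=> y hy; apply: le_lt_trans (norm_sub_triangle x _ _) _.
rewrite -ltrBrDr.
have : N (tsub y x) <= C * ((t - N (tsub x c)) / (2 * C)).
  apply: hC => [|i]; last by rewrite tnth_mktuple ltW.
  by rewrite divr_ge0 ?mulr_ge0 ?(ltW C0)// subr_ge0 ltW.
move=> /le_lt_trans; apply.
rewrite (_ : C * _ = (t - N (tsub x c)) / 2); last by field; rewrite gt_eqF.
by rewrite ltr_pdivrMr// ltr_pMr ?subr_gt0// ltr1n.
Qed.

Lemma tsub0 (x : T) : tsub x (tzero R d) = x.
Proof. by apply: eq_from_tnth => i; rewrite !tnth_mktuple subr0. Qed.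

Lemma measurable_norm : measurable_fun setT N.
Proof.
apply: (measurability (@RGenCInfty.G R)); first exact: RGenCInfty.measurableE.
move=> _ [_ [x ->] <-]; rewrite setTI -[X in measurable X]setCK.
apply: measurableC; apply: sup_open_measurable.
rewrite (_ : ~` _ = [set y | N (tsub y (tzero R d)) < x]); first exact: sup_open_norm_lt.
apply/seteqP; split => y; rewrite /= in_itv/= andbT tsub0.
  by move/negP; rewrite -ltNge.
by rewrite ltNge => /negP.
Qed.

Lemma coord_le_normrV (v : 'rV[R]_d) i : `|v ord0 i| <= `|v|.
Proof.
rewrite [leRHS]/Num.Def.normr /= mx_normrE; apply/bigmax_geP; right.
by exists (ord0, i).
Qed.

Lemma norm_dist x y : `|N x - N y| <= N (tsub x y).
Proof.
have h u v : N u - N v <= N (tsub u v).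
  by rewrite lerBlDr; have := norm_sub_triangle v u (tzero R d); rewrite !tsub0.
by rewrite ler_norml h lerNl opprB norm_subC h.
Qed.

(** Equivalence of norms: [N] is transported to row vectors, where the unit sphere of the sup norm
    is compact, and [c] is the inverse of its positive minimum there. *)
Lemma coord_le_norm : exists2 c : R, 0 < c & forall x i, `|tnth x i| <= c * N x.
Proof.
(* In dimension 0 the sphere is empty and has no minimum, but there is no coordinate to bound. *)
case: (posnP d) => [d0|d0].
  by exists 1 => // x i; have := ltn_ord i; rewrite {2}d0.
pose tv (v : 'rV[R]_d) : T := [tuple v ord0 i | i < d].
pose A : set 'rV[R]_d := [set v | `|v| = 1].
have [C C0 hC] := norm_le_coord.
have cN : continuous (N \o tv).
  move=> v; apply/(@cvgrPdist_lt _ _ _ (nbhs v) (nbhs_filter v)) => e e0.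
  near=> w.
  have h : N (tsub (tv v) (tv w)) <= C * `|v - w|.
    apply: hC => // i; rewrite !tnth_mktuple.
    by have := coord_le_normrV (v - w) i; rewrite !mxE.
  apply: le_lt_trans (norm_dist _ _) _; apply: le_lt_trans h _.
  rewrite -ltr_pdivlMl//.
  near: w; apply: cvgr_dist_lt; last by rewrite mulr_gt0 ?invr_gt0.
  exact: cvg_id.
have cA : compact A.
  apply: bounded_closed_compact.
    by exists 1; split => // x x1 y /= ->; rewrite ltW.
  rewrite (_ : A = (fun v : 'rV[R]_d => `|v|) @^-1` [set 1])//.
  apply: closed_comp; last exact: closed_eq.
  by move=> x _; exact: norm_continuous.
have A0 : A !=set0.
  exists (const_mx 1) => /=.
  apply/eqP; rewrite eq_le; apply/andP; split.
    rewrite [leLHS]/Num.Def.normr /= mx_normrE; apply/bigmax_leP; split => // i _.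
    by rewrite mxE normr1.
  by have := coord_le_normrV (const_mx 1) (Ordinal d0); rewrite mxE normr1.
have [v Av hv] := EVT_min_rV A0 cA (continuous_subspaceT cN).
have Nv : 0 < N (tv v).
  rewrite lt_neqAle norm_ge0 andbT eq_sym; apply/eqP => N0.
  have [_ /(_ _ N0) tv0 _ _] := hN.
  suff v0 : v = 0 by move: Av; rewrite inE /A/= v0 normr0 => /eqP; rewrite eq_sym oner_eq0.
  apply/rowP => i; rewrite mxE; have := congr1 (fun t => tnth t i) tv0.
  by rewrite !tnth_mktuple.
exists (N (tv v))^-1 => [|x i]; first by rewrite invr_gt0.
pose w : 'rV[R]_d := \row_i tnth x i.
have xw j : `|tnth x j| <= `|w| by have := coord_le_normrV w j; rewrite mxE.
have [w0|w0] := eqVneq w 0.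
  by rewrite (le_trans (xw i))// w0 normr0 mulr_ge0 ?norm_ge0// invr_ge0 ltW.
have nw : 0 < `|w| by rewrite normr_gt0.
rewrite (le_trans (xw i))// -ler_pdivrMl ?invr_gt0// invrK.
have Aw : `|w|^-1 *: w \in A.
  by rewrite inE /A /= normrZ normfV normr_id mulVf// gt_eqF.
have := hv _ Aw; rewrite /= (_ : tv (_ *: _) = tscale `|w|^-1 x); last first.
  by apply: eq_from_tnth => j; rewrite !tnth_mktuple !mxE.
by rewrite norm_scale normfV normr_id ler_pdivlMl// mulrC.
Unshelve. all: by end_near.
Qed.

Lemma measurable_norm_pow (r : R) : measurable_fun setT (fun x => N x `^ r).
Proof.
by apply: (measurableT_comp (measurable_powR r)); exact: measurable_norm.
Qed.

End Norm.

(** With [rho ^ r = 1 - th], either [rho * s <= t] and the first term suffices, or [(1 - rho) * s]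
    is below the error [c * e ^ (1 / r)]; the choice [c = 1 - rho] then bounds [s ^ r] by [e]. The
    point is uniformity in [s] and [t]. *)
Lemma powR_approx (R : realType) (r th : R) : 0 < r -> 0 < th < 1 ->
  exists2 c, 0 < c & forall e s t : R, 0 < e -> 0 <= s -> 0 <= t ->
    s <= t + c * e `^ r^-1 -> (1 - th) * s `^ r <= t `^ r + e.
Proof.
move=> r0 /andP[th0 th1]; pose rho := (1 - th) `^ r^-1.
have rho0 : 0 < rho by rewrite powR_gt0 ?subr_gt0.
have rhor : rho `^ r = 1 - th.
  by rewrite -powRrM mulVf ?gt_eqF// powRr1// subr_ge0 ltW.
have rho1 : rho < 1.
  rewrite ltNge; apply/negP => h.
  have := @ge0_ler_powR R r (ltW r0) 1 rho.
  rewrite !nnegrE ler01 (ltW rho0) => /(_ isT isT h).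
  by rewrite rhor powR1 lerBrDr gerDl leNgt th0.
exists (1 - rho) => [|e s t e0 s0 t0 st]; first by rewrite subr_gt0.
rewrite -rhor -powRM// ?(ltW rho0)//.
have [h|h] := leP (rho * s) t.
  rewrite (@le_trans _ _ (t `^ r))// ?lerDl ?(ltW e0)//.
  by apply: ge0_ler_powR; rewrite ?nnegrE ?mulr_ge0 ?(ltW rho0)// ltW.
rewrite (@le_trans _ _ e)// ?lerDr ?powR_ge0//.
have se : s <= e `^ r^-1.
  rewrite -(ler_pM2l (_ : 0 < 1 - rho)) ?subr_gt0//; lra.
have -> : e = (e `^ r^-1) `^ r by rewrite -powRrM mulVf ?gt_eqF// powRr1// ltW.
apply: ge0_ler_powR; rewrite ?nnegrE ?(ltW r0)// ?powR_ge0// ?mulr_ge0 ?(ltW rho0)//.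
by rewrite (le_trans _ se)// ler_piMl// ltW.
Qed.

Section GammaIntegral.
Variable R : realType.
Local Notation mu := (@lebesgue_measure R).

Lemma integral_expRN_tail (a u : R) : 0 < a ->
  (\int[mu]_(t in `[u, +oo[) (a * expR (- a * t))%:E = (expR (- a * u))%:E)%E.
Proof.
move=> a0.
have cexp : continuous (fun z : R^o => expR (- a * z)).
  move=> z; apply: continuous_comp; last exact: continuous_expR.
  by apply: continuousM => //; exact: cst_continuous.
rewrite (@ge0_continuous_FTC2y _ _ (fun x => - (expR (- a * x))) _ 0)//.
- by rewrite sub0e EFinN oppeK.
- by move=> x _; rewrite mulr_ge0 ?expR_ge0// ltW.
- apply: continuous_subspaceT => z.
  by apply: cvgM; [exact: cvg_cst|exact: cexp].
- rewrite -oppr0; apply: cvgN.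
  rewrite (_ : (fun x => expR (- a * x)) =
               (fun z => expR (- z)) \o (fun z => a * z)); last first.
    by apply: eq_fun => x; rewrite mulNr.
  apply: (@cvg_comp _ _ _ _ _ _ (pinfty_nbhs R)); last exact: cvgr_expR.
  exact: gt0_cvgMry.
- by apply: cvgN; apply/cvg_at_right_filter; exact: cexp.
- move=> z _.
  rewrite derive1_comp// derive1N// derive1_id mulN1r derive1_comp// derive1E.
  have /funeqP -> := @derive_expR R.
  by rewrite derive1Ml// derive1_id mulr1 mulrN opprK mulrC.
Qed.

Lemma powR_le_expR (p : R) : 0 < p ->
  exists2 C, 0 < C & forall t, 0 <= t -> t `^ p <= C * expR (t / 2).
Proof.
move=> p0; pose n := Num.truncn p.
(* The first summand serves [t <= 1]. Beyond 1, [t ^ p] is below an integer power, hence below a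
   multiple of one Taylor term of [expR (t / 2)]. *)
exists (1 + (n.+1)`!%:R * 2 ^+ n.+1) => [|t t0].
  by rewrite ltr_wpDr// mulr_ge0// exprn_ge0.
have [t1|t1] := leP t 1.
  rewrite (@le_trans _ _ 1)//.
    have := @ge0_ler_powR R p (ltW p0) t 1.
    by rewrite !nnegrE t0 ler01 powR1; apply.
  rewrite -[leLHS]mul1r ler_pM//; first by rewrite lerDl mulr_ge0// exprn_ge0.
  by rewrite -expR0 ler_expR divr_ge0.
rewrite (@le_trans _ _ (t ^+ n.+1))//.
  rewrite -powR_mulrn//; apply: ler_powR; first exact: ltW.
  by rewrite ltW// truncnS_gt.
have := @expR_ge1Dxn R (t / 2) n; rewrite divr_ge0// => /(_ isT).
rewrite expr_div_n => h.
rewrite mulrDl ler_wpDl ?mul1r ?expR_ge0//.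
rewrite -ler_pdivrMl ?mulr_gt0 ?exprn_gt0 ?ltr0n ?fact_gt0//.
apply: le_trans h; rewrite ler_wpDl// le_eqVlt; apply/orP; left; apply/eqP.
have f0 : n.+1`!%:R != 0 :> R by rewrite pnatr_eq0 -lt0n fact_gt0.
have h2 : 2 ^+ n.+1 != 0 :> R by rewrite expf_neq0.
by field; rewrite f0 h2.
Qed.

(** [Gamma] is defined by [Rintegral], which represents the integral only once this finiteness is
    known. *)
Lemma Gamma_integral_lty (p : R) : 0 < p ->
  (\int[mu]_(t in `]0%R, +oo[) (t `^ p * expR (- t))%:E < +oo)%E.
Proof.
move=> p0; have [C C0 hC] := powR_le_expR p0.
have mexp (a : R) : measurable_fun [set: R] (fun t => expR (- a * t)).
  by apply: measurableT_comp => //; exact: measurable_funM.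
apply: (@le_lt_trans _ _ (\int[mu]_(t in `[0%R, +oo[)
   ((2 * C)%:E * (2^-1 * expR (- 2^-1 * t))%:E))%E); last first.
  rewrite ge0_integralZl//=.
  - by rewrite integral_expRN_tail// -EFinM ltry.
  - apply/measurable_EFinP; apply: measurable_funM => //.
    by apply: measurable_funTS; exact: mexp.
  - by rewrite lee_fin mulr_ge0// ltW.
apply: (@le_trans _ _ (\int[mu]_(t in `[0%R, +oo[) (t `^ p * expR (- t))%:E)%E).
  apply: ge0_subset_integral => //=.
  - apply/measurable_EFinP; apply: measurable_funTS; apply: measurable_funM.
      exact: measurable_powR.
    by apply: measurableT_comp => //; exact: oppr_measurable.
  - by move=> t _; rewrite lee_fin mulr_ge0 ?powR_ge0 ?expR_ge0.
  - by move=> t /=; rewrite !in_itv/= !andbT => /ltW.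
apply: ge0_le_integral => //=.
- by move=> t _; rewrite lee_fin mulr_ge0 ?powR_ge0 ?expR_ge0.
- apply/measurable_EFinP; apply: measurable_funTS; apply: measurable_funM.
    exact: measurable_powR.
  by apply: measurableT_comp => //; exact: oppr_measurable.
- apply: measurable_funeM; apply/measurable_EFinP; apply: measurable_funTS.
  by apply: measurable_funM => //; exact: mexp.
- move=> t; rewrite in_itv/= andbT => t0; rewrite -EFinM lee_fin.
  apply: (@le_trans _ _ ((C * expR (t / 2)) * expR (- t))).
    by rewrite ler_wpM2r ?expR_ge0 ?hC.
  rewrite -mulrA -expRD le_eqVlt; apply/orP; left; apply/eqP.
  rewrite (_ : t / 2 - t = - 2^-1 * t); last by field.
  by field.
Qed.

End GammaIntegral.

Section ExpNorm.
Variables (R : realType) (d : nat) (hd : (0 < d)%N).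
Local Notation T := (d.-tuple R).
Variables (N : T -> R) (hN : is_norm N) (r : R) (hr : 0 < r).
Variable lam : {measure set T -> \bar R}.
Hypothesis hlam : is_lebesgue lam.

Let unit_ball : set T := [set x | N x <= 1].

Lemma measurable_norm_le (c : R) : measurable [set x | N x <= c].
Proof.
rewrite (_ : [set x | _] = N @^-1` `]-oo, c]%classic).
  by rewrite -[X in measurable X]setTI; exact: measurable_norm.
by apply/seteqP; split => x /=; rewrite in_itv.
Qed.

Lemma norm_ball_scale (s : R) : 0 < s ->
  (lam [set x | (N x <= s)%R] = (s ^+ d)%:E * lam unit_ball)%E.
Proof.
move=> s0.
have <- := lebesgue_affine hlam (tzero R d) s0 (measurable_norm_le s).
congr (_ * lam _)%E.
have aE x : affine (tzero R d) s x = tscale s x.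
  by apply: eq_from_tnth => i; rewrite !tnth_mktuple add0r.
by apply/seteqP; split => x /=; rewrite /unit_ball/= aE norm_scale// gtr0_norm// ger_pMr.
Qed.

Lemma unit_ball_lty : (lam unit_ball < +oo)%E.
Proof.
have [c c0 hc] := coord_le_norm hN.
apply: (@le_lt_trans _ _ (lam (box [tuple (- (c + 1) : R)%R | i < d] [tuple (c + 1)%R | i < d]))).
  apply: le_measure; rewrite ?inE; [exact: measurable_norm_le|exact: measurable_box|].
  move=> x Nx i; rewrite !tnth_mktuple.
  have : `|tnth x i| < c + 1.
    apply: le_lt_trans (hc x i) _; by rewrite ltr_pwDr// ger_pMr.
  by rewrite ltr_norml => /andP[-> /ltW].
rewrite hlam ?ltry// => i; rewrite !tnth_mktuple.
by rewrite ge0_cp// addr_ge0// ltW.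
Qed.

Lemma unit_ball_gt0 : (0 < lam unit_ball)%E.
Proof.
have [C C0 hC] := norm_le_coord hN.
apply: (@lt_le_trans _ _ (lam (box (tzero R d) [tuple (C^-1)%R | i < d]))).
  rewrite hlam; last by move=> i; rewrite !tnth_mktuple invr_ge0 ltW.
  rewrite lte_fin prodr_gt0// => i _; rewrite !tnth_mktuple subr0.
  by rewrite invr_gt0.
apply: le_measure; rewrite ?inE; [exact: measurable_box|exact: measurable_norm_le|].
move=> x h; rewrite /unit_ball/= -(@mulfV _ C) ?gt_eqF//.
apply: hC => [|i]; first by rewrite invr_ge0 ltW.
have := h i; rewrite !tnth_mktuple => /andP[h1 h2].
by rewrite ger0_norm// ltW.
Qed.

Let V := unit_ball_vol lam N.

Lemma unit_ball_volE : lam unit_ball = V%:E.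
Proof. by rewrite /V /unit_ball_vol fineK// ge0_fin_numE// unit_ball_lty. Qed.

Lemma unit_ball_vol_gt0 : 0 < V.
Proof. by rewrite -lte_fin -unit_ball_volE unit_ball_gt0. Qed.

Definition exp_norm (a : R) (x : T) : R := expR (- (a * N x `^ r)).

Lemma exp_norm_gt0 a x : 0 < exp_norm a x. Proof. exact: expR_gt0. Qed.

Lemma measurable_exp_norm a : measurable_fun setT (exp_norm a).
Proof.
apply: measurableT_comp => //; apply: measurableT_comp => //.
by apply: measurable_funM => //; exact: measurable_norm_pow.
Qed.

Definition norm_const : R := V * Gamma (1 + d%:R / r).

Let p := d%:R / r.
Let p0 : 0 < p. Proof. by rewrite divr_gt0// ltr0n. Qed.

(** Layer-cake region: integrating [expR (- t)] over its sections in [t] gives [expR (- N x ^ r)],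
    while its sections in [x] are balls of radius [t ^ (1 / r)]. The condition [0 < t] matches the
    domain of the Gamma integral. *)
Let layer : set (T * R) := [set z | 0 < z.2 /\ N z.1 `^ r <= z.2].

Lemma measurable_layer : measurable layer.
Proof.
rewrite (_ : layer = (snd @^-1` `]0%R, +oo[%classic) `&`
   ([set: T * R] `&` [set z | N z.1 `^ r <= z.2])); last first.
  apply/seteqP; split => -[x t]; rewrite /layer/= in_itv/= andbT.
    by move=> [? ?]; do ! split.
  by move=> [? [_ ?]].
apply: measurableI.
  by rewrite -[X in measurable X]setTI; exact: measurable_snd.
apply: measurable_fun_le => //.
by apply: (measurableT_comp (measurable_norm_pow hN r)).
Qed.

Let F (z : T * R) : \bar R := (expR (- z.2) * \1_layer z)%:E.

Let mF : measurable_fun setT F.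
Proof.
apply/measurable_EFinP; apply: measurable_funM.
  apply: measurableT_comp => //; apply: (measurableT_comp (@oppr_measurable _ _)).
  exact: measurable_snd.
by apply: measurable_indic; exact: measurable_layer.
Qed.

Let F0 z : (0 <= F z)%E. Proof. by rewrite lee_fin mulr_ge0// expR_ge0. Qed.

Lemma exp_norm_layer x :
  (exp_norm 1 x)%:E = (\int[lebesgue_measure]_t F (x, t))%E.
Proof.
transitivity (\int[lebesgue_measure]_(t in `[(N x `^ r)%R, +oo[) (expR (- t))%:E)%E.
  rewrite /exp_norm mul1r; have := @integral_expRN_tail R 1 (N x `^ r) ltr01.
  by rewrite mulN1r => <-; apply: eq_integral => t _; rewrite mul1r mulN1r.
have mE D : measurable_fun D (fun t : R => (expR (- t))%:E).
  apply/measurable_EFinP; apply: measurable_funTS.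
  by apply: measurableT_comp => //; exact: oppr_measurable.
have FE (D : set R) : (forall t, D t <-> 0 < t /\ N x `^ r <= t) ->
  (\int[lebesgue_measure]_(t in D) (expR (- t))%:E = \int[lebesgue_measure]_t F (x, t))%E.
  move=> hD; rewrite integral_mkcond; apply: eq_integral => t _.
  rewrite patchE /F/= indicE; case: ifPn => [|]; rewrite ?inE ?notin_setE.
    by move=> /hD h; rewrite mem_set ?mulr1.
  by move=> h; rewrite memNset ?mulr0//; apply: contra_not h => /hD.
(* At level 0 the closed half-line and the section of [layer] differ by the single point 0, which is
   null. *)
have [Nx0|Nx0] := eqVneq (N x `^ r) 0.
  rewrite Nx0 -integral_itv_obnd_cbnd//; apply: FE => t.
  by rewrite /= in_itv/= andbT Nx0; split => [h|[]//]; split => //; exact: ltW.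
apply: FE => t; rewrite /= in_itv/= andbT; split => [h|[]//]; split => //.
by apply: lt_le_trans h; rewrite lt_neqAle eq_sym Nx0 powR_ge0.
Qed.

Lemma powR_le_iff (s t : R) : 0 <= s -> 0 < t -> (s `^ r <= t) = (s <= t `^ r^-1).
Proof.
move=> s0 t0; apply/idP/idP => h.
  rewrite (_ : s = (s `^ r) `^ r^-1); last first.
    by rewrite -powRrM mulfV ?gt_eqF// powRr1.
  by apply: ge0_ler_powR; rewrite ?nnegrE ?powR_ge0 ?invr_ge0 ?(ltW hr) ?(ltW t0).
rewrite (_ : t = (t `^ r^-1) `^ r); last first.
  by rewrite -powRrM mulVf ?gt_eqF// powRr1// ltW.
by apply: ge0_ler_powR; rewrite ?nnegrE ?powR_ge0// ltW.
Qed.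

Lemma exp_norm_layer_inner t : (\int[lam]_x F (x, t) =
  (if (0 < t)%R then (V * (t `^ p * expR (- t)))%:E else 0))%E.
Proof.
case: ifPn => [t0|]; last first.
  rewrite -leNgt => t0; apply: integral0_eq => x _.
  by rewrite /F indicE memNset ?mulr0// => -[/=]; rewrite ltNge t0.
rewrite (eq_integral (fun x => (expR (- t))%:E * (\1_[set x | (N x <= t `^ r^-1)%R] x)%:E)%E); last first.
  move=> x _; rewrite /F -EFinM !indicE/=; congr (_ * (nat_of_bool _)%:R)%:E.
  apply/idP/idP; rewrite !inE /layer/= -powR_le_iff ?norm_ge0//.
  by case.
rewrite ge0_integralZl//=; last first.
  by apply/measurable_EFinP; apply: measurable_indic; exact: measurable_norm_le.
rewrite integral_indic ?setIT//; last exact: measurable_norm_le.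
rewrite norm_ball_scale ?powR_gt0// unit_ball_volE -!EFinM; congr (_%:E).
rewrite -powR_mulrn ?powR_ge0// -powRrM (mulrC r^-1).
by rewrite /p; ring.
Qed.

Lemma GammaE : (\int[lebesgue_measure]_(t in `]0%R, +oo[) (t `^ p * expR (- t))%:E)%E =
  (Gamma (1 + d%:R / r))%:E.
Proof.
rewrite /Gamma /Rintegral (_ : 1 + d%:R / r - 1 = p); last by rewrite /p; ring.
rewrite fineK// ge0_fin_numE; first exact: Gamma_integral_lty.
by apply: integral_ge0 => t _; rewrite lee_fin mulr_ge0 ?powR_ge0 ?expR_ge0.
Qed.

(** Tonelli on the layer-cake region: the inner integral in [x] is the ball volume [V * t ^ p] times
    [expR (- t)], and what remains is the Gamma integral. *)
Lemma integral_exp_norm1 : (\int[lam]_x (exp_norm 1 x)%:E = norm_const%:E)%E.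
Proof.
under eq_integral do rewrite exp_norm_layer.
have := @fubini_tonelli _ _ _ _ _ (as_sigma_finite (lebesgue_sigma_finite hlam))
  lebesgue_measure F mF F0.
rewrite [X in X = _ -> _](_ : _ = \int[lam]_x \int[lebesgue_measure]_t F (x, t))%E// => ->.
rewrite [LHS](_ : _ = \int[lebesgue_measure]_t \int[lam]_x F (x, t))%E//.
under eq_integral do rewrite exp_norm_layer_inner.
rewrite /norm_const EFinM -GammaE.
rewrite -ge0_integralZl//=; last 3 first.
- apply/measurable_EFinP; apply: measurable_funTS; apply: measurable_funM.
    exact: measurable_powR.
  by apply: measurableT_comp => //; exact: oppr_measurable.
- by move=> t _; rewrite lee_fin mulr_ge0 ?powR_ge0 ?expR_ge0.
- by rewrite lee_fin ltW// unit_ball_vol_gt0.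
rewrite [RHS]integral_mkcond; apply: eq_integral => t _.
by rewrite patchE mem_setE in_itv/= andbT.
Qed.

End ExpNorm.

(** * Scaling and the r-th moment of the exponential of the norm *)

Section Moment.
Variables (R : realType) (d : nat) (hd : (0 < d)%N).
Local Notation T := (d.-tuple R).
Variables (N : T -> R) (hN : is_norm N) (r : R) (hr : 0 < r).
Variable lam : {measure set T -> \bar R}.
Hypothesis hlam : is_lebesgue lam.

Local Notation Z := (norm_const N r lam).
Local Notation expN := (exp_norm N r).
Let p : R := d%:R / r.

Let mexpN a : measurable_fun setT (fun x => (expN a x)%:E).
Proof. by apply/measurable_EFinP; exact: measurable_exp_norm. Qed.

Let expN0 a x : (0 <= (expN a x)%:E)%E.
Proof. by rewrite lee_fin ltW// exp_norm_gt0. Qed.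

Lemma norm_affine0 s x : 0 < s -> N (affine (tzero R d) s x) = s * N x.
Proof.
move=> s0; have -> : affine (tzero R d) s x = tscale s x.
  by apply: eq_from_tnth => i; rewrite !tnth_mktuple add0r.
by rewrite norm_scale// gtr0_norm.
Qed.

Lemma integral_exp_norm (a : R) : 0 < a ->
  (\int[lam]_x (expN a x)%:E = (Z * a `^ (- p))%:E)%E.
Proof.
(* The scale for which [a * (s * N x) ^ r = N x ^ r]. *)
move=> a0; pose s := a `^ (- r^-1).
have s0 : 0 < s by rewrite powR_gt0.
rewrite (integral_affine hlam (tzero R d) s0)//.
have E x : expN a (affine (tzero R d) s x) = expN 1 x.
  rewrite /exp_norm (norm_affine0 _ s0) (powRM _ (ltW s0) (norm_ge0 hN x)) mulrA.
  by rewrite -powRrM mulNr mulVf ?gt_eqF// powRN powRr1 ?(ltW a0)// mulfV ?gt_eqF.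
under eq_integral do rewrite E.
rewrite integral_exp_norm1// -EFinM mulrC; congr ((_ * _)%:E).
rewrite -powR_mulrn ?(ltW s0)// /s -powRrM; congr (_ `^ _).
by rewrite /p mulNr mulrC.
Qed.

Lemma integral_exp_norm_shift (a : R) (y : T) : 0 < a ->
  (\int[lam]_x (expN a (tsub x y))%:E = (Z * a `^ (- p))%:E)%E.
Proof.
move=> a0; rewrite -(integral_exp_norm a0).
exact: (integral_shift hlam y (mexpN a) (expN0 a)).
Qed.

Lemma norm_const_gt0 : 0 < Z.
Proof.
rewrite -lte_fin -integral_exp_norm1//.
apply: (@lt_le_trans _ _ ((expR (-1))%:E * lam [set x | (N x <= 1)%R])%E).
  rewrite mule_gt0 ?lte_fin ?expR_gt0//; exact: unit_ball_gt0.
rewrite -integral_cst; last exact: measurable_norm_le.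
apply: (@le_trans _ _ (\int[lam]_(x in [set x | (N x <= 1)%R]) (expN 1 x)%:E)%E).
  apply: ge0_le_integral => //; first exact: measurable_norm_le.
  - by move=> x _ /=; rewrite lee_fin expR_ge0.
  - exact: measurable_funTS.
  - move=> x /= Nx; rewrite lee_fin ler_expR lerN2 mul1r.
    have := @ge0_ler_powR R r (ltW hr) (N x) 1.
    by rewrite !nnegrE norm_ge0// ler01 powR1; apply.
apply: ge0_subset_integral => //; exact: measurable_norm_le.
Qed.

Let mMom : measurable_fun setT (fun x => (N x `^ r * expN 1 x)%:E).
Proof.
apply/measurable_EFinP; apply: measurable_funM; first exact: measurable_norm_pow.
exact: measurable_exp_norm.
Qed.

Let Mom0 x : (0 <= (N x `^ r * expN 1 x)%:E)%E.
Proof. by rewrite lee_fin mulr_ge0 ?powR_ge0// ltW// exp_norm_gt0. Qed.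

(** [u / 2 <= expR (u / 2)] trades the factor [u = N x ^ r] for half of the exponent. *)
Lemma exp_norm_moment_lty : (\int[lam]_x (N x `^ r * expN 1 x)%:E < +oo)%E.
Proof.
apply: (@le_lt_trans _ _ (\int[lam]_x (2%:E * (expN (2^-1) x)%:E))%E).
  apply: ge0_le_integral => //.
  - exact: measurable_funeM.
  - move=> x _; rewrite -EFinM lee_fin /exp_norm; set u := N x `^ r.
    have u0 : 0 <= u by exact: powR_ge0.
    have h : u / 2 <= expR (2^-1 * u).
      by rewrite mulrC (le_trans _ (expR_ge1Dx _))// lerDr.
    have -> : expR (- (2^-1 * u)) = expR (2^-1 * u) * expR (- (1 * u)).
      by rewrite -expRD; congr expR; field.
    rewrite mulrA ler_wpM2r ?expR_ge0// -ler_pdivrMl//.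
    by move: h; rewrite mulrC.
by rewrite ge0_integralZl//= integral_exp_norm// -EFinM ltry.
Qed.

(* By [1 + x <= expR x] the difference [a `^ (- p) * Z - (Z - (a - 1) * M)], [M] the moment,
   is nonnegative; it vanishes at [a = 1], so its derivative [- p * Z + M] does too. *)
Lemma exp_norm_moment : (\int[lam]_x (N x `^ r * expN 1 x)%:E = (p * Z)%:E)%E.
Proof.
set Me := LHS; have Mfin : Me = (fine Me)%:E.
  by rewrite fineK// ge0_fin_numE ?exp_norm_moment_lty// /Me; apply: integral_ge0.
rewrite Mfin; congr (_%:E); set M := fine Me.
have pt a u : expR (- u) <= expR (- (a * u)) + (a - 1) * (u * expR (- (1 * u))) :> R.
  rewrite mul1r -(ler_pM2r (expR_gt0 u)) mulrDl -!mulrA -!expRD addNr expR0 mulr1.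
  have := expR_ge1Dx (- (a * u) + u); lra.
(* The substitution [a = expR h] keeps [a] positive on the whole line, so that [h = 0] is an
   interior minimum. *)
have key h : Z <= Z * expR (- p * h) + (expR h - 1) * M.
  set a := expR h; have a0 : 0 < a by exact: expR_gt0.
  have <- : a `^ (- p) = expR (- p * h) by rewrite /a -expRM mulrC.
  (* The term [(a - 1) * M] is put on the side where its coefficient is nonnegative, so that only
     nonnegative integrands are added. *)
  have [a1|a1] := leP 1 a.
    have -> : (Z <= Z * a `^ (- p) + (a - 1) * M) =
        (\int[lam]_x (expN 1 x)%:E <= \int[lam]_x (expN a x)%:E + (a - 1)%:E * Me)%E.
      by rewrite integral_exp_norm1// integral_exp_norm// Mfin -EFinM -EFinD lee_fin.
    rewrite /Me -ge0_integralZl//= ?lee_fin ?subr_ge0//.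
    rewrite -ge0_integralD//=; last 2 first.
    - by move=> x _; rewrite mule_ge0// lee_fin subr_ge0.
    - exact: measurable_funeM.
    apply: ge0_le_integral => //=.
    - by apply: emeasurable_funD => //; exact: measurable_funeM.
    - move=> x _; rewrite -EFinM -EFinD lee_fin.
      by rewrite [leLHS]/exp_norm mul1r; exact: pt.
  suff : Z + (1 - a) * M <= Z * a `^ (- p) by lra.
  have -> : (Z + (1 - a) * M <= Z * a `^ (- p)) =
     (\int[lam]_x (expN 1 x)%:E + (1 - a)%:E * Me <= \int[lam]_x (expN a x)%:E)%E.
    by rewrite integral_exp_norm1// integral_exp_norm// Mfin -EFinM -EFinD lee_fin.
  have a1' : 0 <= 1 - a by rewrite subr_ge0 ltW.
  rewrite /Me -ge0_integralZl//=.
  rewrite -ge0_integralD//=; last 2 first.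
  - by move=> x _; rewrite mule_ge0.
  - exact: measurable_funeM.
  apply: ge0_le_integral => //=.
  - by move=> x _; rewrite adde_ge0 ?mule_ge0.
  - by apply: emeasurable_funD => //; exact: measurable_funeM.
  - move=> x _; rewrite -EFinM -EFinD lee_fin.
    have := pt a (N x `^ r); rewrite /exp_norm mul1r; lra.
pose phi (h : R) : R := Z * expR (- p * h) + (expR h - 1) * M.
have dphi (h : R) : is_derive h (1 : R) phi (Z * (expR (- p * h) * (- p)) + expR h * M).
  have h1 : is_derive h (1 : R) (fun h : R => - p * h : R) (- p).
    by apply: is_derive_eq; rewrite /= ?scaler0 ?add0r ?addr0 /GRing.scale/= mulr1.
  have h2 : is_derive h (1 : R) (fun h : R => expR (- p * h) : R) (expR (- p * h) * (- p)).
    exact: (@is_derive1_comp R expR (fun h : R => - p * h : R) h (expR (- p * h)) (- p) (is_derive_expR _) h1).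
  rewrite /phi; apply: is_derive_eq.
  by rewrite scaler0 subr0 add0r; congr (_ + _); rewrite /GRing.scale/= mulrC.
have h0 : is_derive (0 : R) (1 : R) phi 0.
  apply: (@derive1_at_min _ phi (-1) 1 0).
  - lra.
  - by move=> t _; exact: (@ex_derive _ _ _ _ _ _ _ (dphi t)).
  - by rewrite in_itv/=; lra.
  - by move=> t _; rewrite /phi mulr0 expR0 subrr mul0r addr0 mulr1; exact: key.
have := @derive_val _ _ _ _ _ _ _ h0; rewrite (@derive_val _ _ _ _ _ _ _ (dphi 0)).
rewrite mulr0 expR0; lra.
Qed.

End Moment.

(** * Lower bounds on mutual information *)

Section MutualInfoSums.
Variable R : realType.

(* [ln t <= t - 1] at [t = c a b / p] *)
Lemma mi_term_ge (p a b c : R) : 0 <= p -> 0 < c -> 0 <= a -> 0 <= b ->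
  (p != 0 -> 0 < a * b) -> p * ln c + p - c * (a * b) <= mi_term p a b.
Proof.
move=> p0 c0 a0 b0 hab; rewrite /mi_term; case: eqP => [->|/eqP pn0].
  by rewrite mul0r !add0r oppr_le0 !mulr_ge0// ltW.
have pp : 0 < p by rewrite lt_neqAle eq_sym pn0.
have ab := hab pn0.
have cab : 0 < c * (a * b) / p by rewrite divr_gt0// mulr_gt0.
have -> : ln (p / (a * b)) = ln c - ln (c * (a * b) / p).
  rewrite -ln_div ?posrE//; congr (ln _).
  have a0' : a != 0 by apply: contraTneq ab => ->; rewrite mul0r ltxx.
  have b0' : b != 0 by apply: contraTneq ab => ->; rewrite mulr0 ltxx.
  by field; rewrite pn0 a0' b0' gt_eqF.
have h : ln (c * (a * b) / p) <= c * (a * b) / p - 1.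
  by have := expR_ge1Dx (ln (c * (a * b) / p)); rewrite lnK ?posrE//; lra.
have : p * ln (c * (a * b) / p) <= c * (a * b) - p.
  have -> : c * (a * b) - p = p * (c * (a * b) / p - 1) by field.
  by rewrite ler_wpM2l.
lra.
Qed.

(* The last row and the last column collect the cells outside a finite family; there
   [mi_term_ge] is applied with [c = 1], elsewhere with
   [c = expR (- gam i - la * del i j - K)]. *)
Lemma mi_sum_lower m n (p : 'I_m.+1 -> 'I_n.+1 -> R) (a : 'I_m.+1 -> R)
    (b : 'I_n.+1 -> R) (gam : nat -> R) (del : 'I_m.+1 -> 'I_n.+1 -> R)
    (la K D : R) :
  (forall i j, 0 <= p i j) -> (forall i, \sum_j p i j = a i) ->
  (forall j, \sum_i p i j = b j) -> \sum_i a i = 1 -> 0 <= la ->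
  (forall i j, 0 <= del i j) -> \sum_i \sum_j p i j * del i j <= D ->
  (forall j : 'I_n.+1, (j < n)%N -> b j != 0 ->
    \sum_(i < m.+1 | (i < m)%N) a i * expR (- gam i - la * del i j) <= expR K) ->
  - (\sum_(i < m.+1 | (i < m)%N) a i * gam i) - K * (1 - a ord_max) - la * D
    - a ord_max - b ord_max * (\sum_(i < m) `|gam i + K|)
  <= \sum_i \sum_j mi_term (p i j) (a i) (b j).
Proof.
move=> p0 pa pb a1 la0 del0 pD hK.
have a0 i : 0 <= a i by rewrite -pa sumr_ge0.
have b0 j : 0 <= b j by rewrite -pb sumr_ge0.
have b1 : \sum_j b j = 1.
  by rewrite -a1 -(eq_bigr _ (fun j _ => pb j)) exchange_big/=; apply: eq_bigr => i _.
pose inn (i : 'I_m.+1) (j : 'I_n.+1) := (i < m)%N && (j < n)%N.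
pose c i j := if inn i j then expR (- gam i - la * del i j - K) else 1.
have c0 i j : 0 < c i j by rewrite /c; case: ifP => // _; exact: expR_gt0.
apply: (@le_trans _ _ (\sum_i \sum_j (p i j * ln (c i j) + p i j - c i j * (a i * b j)))); last first.
  apply: ler_sum => i _; apply: ler_sum => j _; apply: mi_term_ge => // pn0.
  have pp : 0 < p i j by rewrite lt_neqAle eq_sym pn0 p0.
  rewrite mulr_gt0//.
    apply: lt_le_trans pp _; rewrite -pa (bigD1 j)//= lerDl.
    by apply: sumr_ge0.
  apply: lt_le_trans pp _; rewrite -pb (bigD1 i)//= lerDl.
  by apply: sumr_ge0.
set G := \sum_(i < m) `|gam i + K|.
(* In the last column [ln (c i j) = 0] replaces [- gam i - K]. The discrepancy is at most [G], which
   produces the term [b ord_max * G]. *)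
have lnc (i : 'I_m.+1) (j : 'I_n.+1) : p i j * ln (c i j) >=
   (if (i < m)%N then p i j * (- gam i - K) else 0) - la * (p i j * del i j)
   - (if j == ord_max then p i j * G else 0).
  have lpd : 0 <= la * (p i j * del i j) by rewrite !mulr_ge0.
  have G0 : 0 <= G by apply: sumr_ge0.
  rewrite /c /inn; have [im|im] := boolP (i < m)%N; last first.
    rewrite ln1 mulr0; case: ifP => _; last by lra.
    have pG : 0 <= p i j * G by rewrite mulr_ge0.
    lra.
  have [jn|jn] /= := boolP (j < n)%N.
    rewrite expRK; have -> : (j == ord_max) = false.
      by apply/negbTE/eqP => h; move: jn; rewrite h /= ltnn.
    by rewrite le_eqVlt; apply/orP; left; apply/eqP; ring.
  have -> : j == ord_max.
    by rewrite -val_eqE /= eqn_leq -ltnS ltn_ord/= leqNgt.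
  have gG : `|gam i + K| <= G.
    rewrite /G (bigD1 (Ordinal im))//= lerDl; exact: sumr_ge0.
  rewrite ln1 mulr0.
  have : p i j * (- gam i - K) <= p i j * G.
    by rewrite ler_wpM2l//; move: gG; rewrite ler_norml => /andP[? _]; lra.
  lra.
have cab (i : 'I_m.+1) (j : 'I_n.+1) : c i j * (a i * b j) <=
    (if inn i j then a i * expR (- gam i - la * del i j) * (b j * expR (- K)) else 0)
    + (if i == ord_max then a i * b j else 0)
    + (if j == ord_max then a i * b j else 0).
  have ab0 : 0 <= a i * b j by rewrite mulr_ge0.
  rewrite /c; case: ifP => [_|/negbT].
    rewrite (_ : expR (- gam i - la * del i j - K) =
      expR (- gam i - la * del i j) * expR (- K)); last by rewrite -expRD.
    have h1 : 0 <= (if i == ord_max then a i * b j else 0) by case: ifP.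
    have h2 : 0 <= (if j == ord_max then a i * b j else 0) by case: ifP.
    rewrite (_ : expR _ * _ * _ =
      a i * expR (- gam i - la * del i j) * (b j * expR (- K))); [lra|ring].
  rewrite mul1r add0r negb_and -!leqNgt => /orP[im|jn].
    have -> : i == ord_max by rewrite -val_eqE /= eqn_leq -ltnS ltn_ord.
    by rewrite lerDl; case: ifP.
  have -> : j == ord_max by rewrite -val_eqE /= eqn_leq -ltnS ltn_ord.
  by rewrite lerDr; case: ifP.
(* The inner block contributes at most [1 - b ord_max] by [hK], the last row [a ord_max] and the
   last column [b ord_max]; counting the corner twice is harmless. *)
have Sc : \sum_i \sum_j c i j * (a i * b j) <= 1 + a ord_max.
  apply: (@le_trans _ _ (\sum_i \sum_j ((if inn i j then a i * expR (- gam i - la * del i j) * (b j * expR (- K)) else 0)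
    + (if i == ord_max then a i * b j else 0)
    + (if j == ord_max then a i * b j else 0)))).
    by apply: ler_sum => i _; apply: ler_sum => j _.
  under eq_bigr do rewrite !big_split/=.
  rewrite !big_split/=.
  have -> : \sum_i \sum_j (if i == ord_max then a i * b j else 0) = a ord_max.
    rewrite (bigD1 ord_max)//= eqxx -mulr_sumr b1 mulr1 big1 ?addr0// => i /negbTE ->.
    by rewrite big1.
  have -> : \sum_i \sum_j (if j == ord_max then a i * b j else 0) = b ord_max.
    rewrite exchange_big (bigD1 ord_max)//= eqxx -mulr_suml a1 mul1r big1 ?addr0//.
    by move=> i /negbTE ->; rewrite big1.
  suff : \sum_i \sum_j (if inn i j then a i * expR (- gam i - la * del i j) * (b j * expR (- K)) else 0)
      <= \sum_j b j - b ord_max by rewrite b1; lra.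
  rewrite exchange_big [X in _ <= X - _](bigD1 ord_max)//= addrAC subrr add0r.
  rewrite (bigD1 ord_max)//= [X in X + _]big1 ?add0r => [|i _]; last first.
    by rewrite /inn ltnn andbF.
  apply: ler_sum => j jm.
  have jn : (j < n)%N.
    by have := ltn_ord j; rewrite ltnS leq_eqVlt => /orP[/eqP h|//]; move: jm;
      rewrite -val_eqE /= h eqxx.
  have [bj0|bj0] := eqVneq (b j) 0.
    by rewrite bj0 big1// => i _; rewrite mul0r mulr0; case: ifP.
  rewrite /inn jn; under eq_bigr do rewrite andbT.
  rewrite -big_mkcond/= -mulr_suml mulrCA -[leRHS]mulr1 ler_wpM2l//.
  rewrite -(expRxMexpNx_1 K) ler_wpM2r ?expR_ge0//; exact: hK.
have Sp : \sum_i \sum_j p i j = 1 by rewrite -a1; apply: eq_bigr.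
have Sl : \sum_i \sum_j (p i j * ln (c i j)) >=
   - (\sum_(i < m.+1 | (i < m)%N) a i * gam i) - K * (1 - a ord_max) - la * D - b ord_max * G.
  apply: (@le_trans _ _ (\sum_(i < m.+1) \sum_(j < n.+1) ((if (i < m)%N then p i j * (- gam i - K) else 0)
     - la * (p i j * del i j) - (if j == ord_max then p i j * G else 0)))); last first.
    by apply: ler_sum => i _; apply: ler_sum => j _; exact: lnc.
  under [X in _ <= X]eq_bigr do rewrite !sumrB.
  rewrite !sumrB.
  have -> : \sum_i \sum_j (if j == ord_max then p i j * G else 0) = b ord_max * G.
    rewrite exchange_big (bigD1 ord_max)//= eqxx -mulr_suml pb big1 ?addr0//.
    by move=> i /negbTE ->; rewrite big1.
  have -> : \sum_(i < m.+1) \sum_(j < n.+1) (if (i < m)%N then p i j * (- gam i - K) else 0) =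
     - (\sum_(i < m.+1 | (i < m)%N) a i * gam i) - K * (1 - a ord_max).
    have -> : 1 - a ord_max = \sum_(i < m.+1 | (i < m)%N) a i.
      rewrite -a1 (bigD1 ord_max)//= addrAC subrr add0r; apply: eq_bigl => i.
      by rewrite -val_eqE/= ltn_neqAle -ltnS ltn_ord andbT.
    rewrite mulr_sumr -sumrN -sumrB [RHS]big_mkcond; apply: eq_bigr => i _.
    case: ifP => _; last by rewrite big1.
    by rewrite -mulr_suml pa; ring.
  rewrite lerD2r lerD2l lerN2.
  under [X in X <= _]eq_bigr do rewrite -mulr_sumr.
  by rewrite -mulr_sumr ler_wpM2l.
under [X in _ <= X]eq_bigr do rewrite sumrB big_split/=.
rewrite sumrB big_split/= Sp; lra.
Qed.

End MutualInfoSums.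

(** * Measures with a density, countable partitions and joint laws *)

Section Density.
Import HBNNSimple.
Context disp (X : measurableType disp) (R : realType).
Variables (mu : {measure set X -> \bar R}) (g : X -> R).

(** The two proofs are carried as parameters so that a measure structure can be attached to the
    term. *)
Definition density of measurable_fun setT g & (forall x, 0 <= g x) :=
  fun A : set X => (\int[mu]_(x in A) (g x)%:E)%E.

Section DensityMeasure.
Variables (mg : measurable_fun setT g) (g0 : forall x, 0 <= g x).

Let density0 : density mg g0 set0 = 0%E.
Proof. exact: integral_set0. Qed.

Let density_ge0 A : (0 <= density mg g0 A)%E.
Proof. by apply: integral_ge0 => x _; rewrite lee_fin. Qed.

Let density_sigma_additive : semi_sigma_additive (density mg g0).
Proof.
move=> F mF tF mUF; rewrite /density ge0_integral_bigcup//.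
- by apply: is_cvg_nneseries => n _ _; exact: density_ge0.
- by apply/measurable_EFinP; exact: measurable_funTS.
- by move=> x _; rewrite lee_fin.
Qed.

HB.instance Definition _ := isMeasure.Build _ _ _ (density mg g0)
  density0 density_ge0 density_sigma_additive.

(** Linearity settles simple functions, and monotone convergence on both sides the rest. *)
Lemma integral_density (h : X -> \bar R) : measurable_fun setT h ->
  (forall x, 0 <= h x)%E ->
  (\int[density mg g0]_x h x = \int[mu]_x (h x * (g x)%:E))%E.
Proof.
move=> mh h0.
have mgE D : measurable_fun D (EFin \o g) by apply/measurable_EFinP; exact: measurable_funTS.
pose h_ := nnsfun_approx measurableT mh.
transitivity (limn (fun n => \int[density mg g0]_x (h_ n x)%:E))%E.
  rewrite -monotone_convergence//.
  - apply: eq_integral => y _; apply/esym/cvg_lim => //.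
    by apply: cvg_nnsfun_approx=> // *.
  - by move=> n; exact/measurable_EFinP/measurable_funP.
  - by move=> n y _; rewrite lee_fin.
  - by move=> y _ m n mn; rewrite lee_fin; exact/lefP/nd_nnsfun_approx.
rewrite [X in limn X](_ : _ = (fun n => \int[mu]_x ((h_ n x)%:E * (g x)%:E))%E).
  rewrite -monotone_convergence//; last 3 first.
  - by move=> n; apply: emeasurable_funM => //; exact/measurable_EFinP/measurable_funP.
  - by move=> n y _; rewrite mule_ge0// lee_fin.
  - move=> y _ m n mn; rewrite lee_wpmul2r ?lee_fin//; exact/lefP/nd_nnsfun_approx.
  apply: eq_integral => y _; apply/cvg_lim => //.
  by apply: cvgeZr => //; apply: cvg_nnsfun_approx=> // *.
apply/funext => n.
rewrite integralT_nnsfun sintegralE.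
transitivity (\int[mu]_x (\sum_(k \in range (h_ n)) (k * \1_(h_ n @^-1` [set k]) x)%:E * (g x)%:E))%E.
  rewrite ge0_integral_fsum//; last 2 first.
  - move=> k; apply: emeasurable_funM => //.
    by apply/measurable_EFinP; exact: measurable_funM.
  - by move=> k x _; apply: mule_ge0; rewrite ?EFinM ?nnfun_muleindic_ge0 ?lee_fin.
  apply: eq_fsbigr => k; rewrite inE/= => -[x0 _ hk].
  have k0 : 0 <= k by rewrite -hk.
  under [RHS]eq_integral do rewrite EFinM -muleA.
  rewrite ge0_integralZl//; last 2 first.
  - by apply: emeasurable_funM => //; apply/measurable_EFinP; exact: measurable_indic.
  - by move=> x _; rewrite mule_ge0 ?lee_fin.
  congr (_ * _)%E; rewrite /density integral_mkcond; apply: eq_integral => x _.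
  by rewrite patchE indicE; case: ifP => _; rewrite ?mul1e ?mul0e.
apply: eq_integral => x _; rewrite [in RHS]fimfunE -fsumEFin// ge0_mule_fsuml//.
by move=> k; rewrite EFinM nnfun_muleindic_ge0.
Qed.

End DensityMeasure.
End Density.

Section Partition.
Variables (R : realType) (d : nat).
Local Notation T := (d.-tuple R).

Lemma integral_partition (mu : {measure set T -> \bar R}) n (A : 'I_n -> set T)
    (h : T -> \bar R) : is_partition A -> measurable_fun setT h ->
  (forall x, 0 <= h x)%E ->
  (\int[mu]_x h x = \sum_i \int[mu]_(x in A i) h x)%E.
Proof.
move=> [mA tA cA] mh h0.
have -> : (\int[mu]_x h x = \int[mu]_(x in \big[setU/set0]_(i <- index_enum 'I_n) A i) h x)%E.
  congr (integral _ _ _); apply/esym/seteqP; split => // x _.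
  by have [i Ai] := cA x; rewrite -bigcup_seq; exists i => //=; rewrite mem_index_enum.
rewrite ge0_integral_bigsetU//.
- exact: index_enum_uniq.
- apply/trivIsetP => i j _ _ ij; exact: tA.
- exact: measurable_funTS.
Qed.

Lemma measure_partition (mu : {measure set T -> \bar R}) n (A : 'I_n -> set T) :
  is_partition A -> (\sum_i mu (A i) = mu setT)%E.
Proof.
move=> pA; rewrite -[mu setT]mul1e -integral_cst// (integral_partition mu pA)//.
by apply: eq_bigr => i _; rewrite integral_cst ?mul1e//; case: pA.
Qed.

End Partition.

Section Labels.
Variables (R : realType) (d : nat).
Local Notation T := (d.-tuple R).

(** The first [m] cells and one remainder cell, the shape that [mi_sum_lower] works on. *)
Definition label_part (l : T -> nat) m : 'I_m.+1 -> set T :=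
  fun i => [set x | minn (l x) m = i].

(* A countable measurable partition is encoded by the index [l x] of the cell of [x]. *)
Definition measurable_label (l : T -> nat) :=
  forall n, measurable [set x | l x = n].

Lemma measurable_label_preimage l (P : set nat) : measurable_label l ->
  measurable (l @^-1` P).
Proof.
move=> ml; rewrite (_ : _ @^-1` _ = \bigcup_(n in P) [set x | l x = n]).
  exact: bigcup_measurable.
apply/seteqP; split=> [x Px|x [n Pn /= ln]]; first by exists (l x).
by rewrite /preimage/= ln.
Qed.

Lemma label_partition l m : measurable_label l -> is_partition (@label_part l m).
Proof.
move=> ml; split.
- by move=> i; exact: (measurable_label_preimage [set n | minn n m = i] ml).
- move=> i j /eqP ij; apply/seteqP; split => // x [h1 h2]; apply: ij.
  move: h1 h2; rewrite /label_part /= => h1 h2.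
  by apply: val_inj; rewrite /= -h1 -h2.
- move=> x; have h : (minn (l x) m < m.+1)%N by rewrite ltnS geq_minr.
  by exists (Ordinal h).
Qed.

Lemma label_part_lt l m (i : 'I_m.+1) : (i < m)%N ->
  label_part l i = [set x | l x = i].
Proof.
move=> im; apply/seteqP; split => x; rewrite /label_part /= => h.
  by lia.
by rewrite h; apply/minn_idPl; exact: ltnW.
Qed.

Lemma label_part_max l m :
  label_part l (@ord_max m) = [set x | (m <= l x)%N].
Proof.
apply/seteqP; split => x; rewrite /label_part /= => h; last exact/minn_idPr.
by apply/minn_idPr.
Qed.

(** Cubes of side [eta / C] have [N]-diameter at most [eta] by [norm_le_coord]; their integer
    corners are coded by [pickle]. *)
Lemma grid_label (N : T -> R) (hN : is_norm N) (eta : R) : 0 < eta ->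
  exists2 l, measurable_label l &
    forall x y, l x = l y -> N (tsub x y) <= eta.
Proof.
move=> eta0; have [C C0 hC] := norm_le_coord hN.
pose q := C / eta; have q0 : 0 < q by rewrite divr_gt0.
pose cell (x : T) : d.-tuple int := [tuple Num.floor (tnth (tscale q x) i) | i < d].
exists (fun x => pickle (cell x)).
  move=> n; have [[c hc]|h] := pselect (exists c : d.-tuple int, pickle c = n); last first.
    rewrite (_ : [set x | _] = set0)//; apply/seteqP; split => // x /= xn.
    by apply: h; exists (cell x).
  rewrite (_ : [set x | _] = (tscale q) @^-1` (floor_cell c)).
    rewrite -[X in measurable X]setTI.
    apply: (@measurable_tscale R d _ T q (fun x => x)) => //.
    exact: measurable_floor_cell.
  rewrite -hc; apply/seteqP; split => x /= h.
    have {}h := pcan_inj (@pickleK _) h.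
    by move=> i /=; rewrite -h /cell tnth_mktuple.
  by congr pickle; apply: eq_from_tnth => i; rewrite tnth_mktuple; have := h i.
move=> x y xy; have {}xy := pcan_inj (@pickleK _) xy.
have -> : eta = C * q^-1 by rewrite /q invf_div; field; rewrite !gt_eqF.
apply: hC => [|i]; first by rewrite invr_ge0 ltW.
rewrite tnth_mktuple -(ler_pM2l q0) mulfV ?gt_eqF// -[X in X * _](gtr0_norm q0).
rewrite -normrM mulrBr.
have := congr1 (fun t => tnth t i) xy; rewrite !tnth_mktuple => h.
have /andP[a1 a2] := floor_itv (q * tnth x i).
have /andP[b1 b2] := floor_itv (q * tnth y i).
rewrite ler_norml; move: a1 a2 b1 b2; rewrite h !intrD /= => a1 a2 b1 b2.
by apply/andP; split; lra.
Qed.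

End Labels.

Section Joint.
Variables (R : realType) (d : nat).
Local Notation T := (d.-tuple R).
Variables (lam : {measure set T -> \bar R}) (f : T -> R).
Hypotheses (mf : measurable_fun setT f) (f0 : forall x, 0 <= f x).
Hypothesis f1 : (\int[lam]_x (f x)%:E = 1)%E.
Variable k : R.-pker T ~> T.

Local Notation J := (joint lam f k).
Local Notation P := (PX lam f).

Let mfk B : measurable B -> measurable_fun setT (fun x => (f x)%:E * k x B)%E.
Proof.
move=> mB; apply: emeasurable_funM; first exact/measurable_EFinP.
exact: measurable_kernel.
Qed.

Let fk0 B x : (0 <= (f x)%:E * k x B)%E.
Proof. by rewrite mule_ge0 ?lee_fin. Qed.

Lemma joint_ge0 A B : (0 <= J A B)%E.
Proof. by apply: integral_ge0 => x _. Qed.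

Lemma PX_ge0 A : (0 <= P A)%E.
Proof. by apply: integral_ge0 => x _; rewrite lee_fin. Qed.

Lemma PX_le1 A : measurable A -> (P A <= 1)%E.
Proof.
move=> mA; rewrite -f1; apply: ge0_subset_integral => //.
  exact/measurable_EFinP.
by move=> x _; rewrite lee_fin.
Qed.

Lemma PX_fin A : measurable A -> P A \is a fin_num.
Proof.
by move=> mA; rewrite ge0_fin_numE ?PX_ge0// (le_lt_trans (PX_le1 mA))// ltry.
Qed.

Lemma joint_sum_r A n (B : 'I_n -> set T) : measurable A -> is_partition B ->
  (\sum_j J A (B j) = P A)%E.
Proof.
move=> mA pB; have [mB _ _] := pB.
rewrite /joint -ge0_integral_sum//; last first.
  by move=> i; apply: measurable_funTS; exact: mfk.
apply: eq_integral => x _; rewrite -ge0_sume_distrr//.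
by rewrite (measure_partition (k x) pB) prob_kernel mule1.
Qed.

Lemma joint_sum_l n (A : 'I_n -> set T) B : is_partition A -> measurable B ->
  (\sum_i J (A i) B = J setT B)%E.
Proof. by move=> pA mB; rewrite /joint -integral_partition//; exact: mfk. Qed.

Lemma PX_sum n (A : 'I_n -> set T) : is_partition A -> (\sum_i P (A i) = 1)%E.
Proof.
by move=> pA; rewrite -f1 [RHS](integral_partition lam pA)//; exact/measurable_EFinP.
Qed.

Lemma joint_le A B : measurable A -> measurable B -> (J A B <= P A)%E.
Proof.
move=> mA mB; apply: ge0_le_integral => //.
- by apply: measurable_funTS; exact: mfk.
- by apply: measurable_funTS; exact/measurable_EFinP.
- move=> x _; rewrite -[leRHS]mule1 lee_wpmul2l ?lee_fin//.
  by rewrite -(prob_kernel (s := k) x) le_measure ?inE.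
Qed.

Lemma joint_fin A B : measurable A -> measurable B -> J A B \is a fin_num.
Proof.
move=> mA mB; rewrite ge0_fin_numE ?joint_ge0//.
by rewrite (le_lt_trans (joint_le mA mB))// (le_lt_trans (PX_le1 mA))// ltry.
Qed.

(** The output marginal, made a measure so that continuity from above gives small output tails. *)
Definition output_law of measurable_fun setT f & (forall x, 0 <= f x) :=
  J setT.

Let output0 : output_law mf f0 set0 = 0%E.
Proof.
by rewrite /output_law /joint integral0_eq// => x _; rewrite measure0 mule0.
Qed.

Let output_ge0 A : (0 <= output_law mf f0 A)%E.
Proof. exact: joint_ge0. Qed.

Let output_sigma_additive : semi_sigma_additive (output_law mf f0).
Proof.
move=> F mF tF mUF.
have -> : output_law mf f0 (\bigcup_n F n) = (\sum_(n <oo) output_law mf f0 (F n))%E.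
  rewrite /output_law /joint -integral_nneseries//; last by move=> n; apply: mfk.
  apply: eq_integral => x _; rewrite nneseriesZl => [|i _]//.
  by congr (_ * _)%E; rewrite measure_semi_bigcup.
by apply: is_cvg_nneseries => n _ _; exact: joint_ge0.
Qed.

HB.instance Definition _ := isMeasure.Build _ _ _ (output_law mf f0)
  output0 output_ge0 output_sigma_additive.

Definition output_measure : {measure set T -> \bar R} := output_law mf f0.

Lemma output_measureE B : output_measure B = J setT B.
Proof. by []. Qed.

End Joint.

(** Every point has a finite label, so the tails decrease to the empty set; finiteness of [mu] gives
    continuity from above. Every truncation in the proof relies on this. *)
Lemma measure_label_tail (R : realType) d (mu : {measure set (d.-tuple R) -> \bar R})
    (l : d.-tuple R -> nat) (e : R) :
  measurable_label l -> (mu setT < +oo)%E -> 0 < e ->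
  exists n0, forall n, (n0 <= n)%N -> (mu [set x | (n <= l x)%N] < e%:E)%E.
Proof.
move=> ml mufin e0.
have mF n : measurable [set x | (n <= l x)%N].
  exact: (measurable_label_preimage [set j | (n <= j)%N] ml).
have := @nonincreasing_cvg_mu _ _ _ mu (fun n => [set x | (n <= l x)%N]).
have -> : \bigcap_n [set x | (n <= l x)%N] = set0.
  by apply/seteqP; split => // x /(_ (l x).+1 I) /=; rewrite ltnn.
rewrite measure0 => /(_ _ mF measurable0) h.
have {}h : mu [set x | (n <= l x)%N] @[n --> \oo] --> 0%E.
  apply: h; first by rewrite (_ : [set x | _] = setT)//; apply/seteqP; split.
  apply/nonincreasing_seqP => n; apply/subsetPset => x /=; exact: ltnW.
have /fine_cvgP[[n1 _ hn1] hf] := h.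
have [n2 _ hn2] : \forall n \near \oo, fine (mu [set x | (n <= l x)%N]) < e.
  exact: (cvgr_lt _ hf).
exists (maxn n1 n2) => n; rewrite geq_max => /andP[n1n n2n].
by rewrite -(fineK (hn1 _ n1n)) lte_fin; exact: hn2.
Qed.

(** * The lower bound attached to a labelled partition *)

Section LowerBound.
Variables (R : realType) (d : nat) (hd : (0 < d)%N).
Local Notation T := (d.-tuple R).
Variables (N : T -> R) (hN : is_norm N) (r : R) (hr : 0 < r).
Variable lam : {measure set T -> \bar R}.
Hypothesis hlam : is_lebesgue lam.
Variable f : T -> R.
Hypotheses (mf : measurable_fun setT f) (f0 : forall x, 0 <= f x).
Hypothesis f1 : (\int[lam]_x (f x)%:E = 1)%E.
Variable k : R.-pker T ~> T.

Local Notation J := (joint lam f k).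
Local Notation P := (PX lam f).
Local Notation Z := (norm_const N r lam).
Let p : R := d%:R / r.

Lemma measurable_norm_tsub_pow :
  measurable_fun setT (fun z : T * T => ((N (tsub z.1 z.2)) `^ r)%:E).
Proof.
apply/measurable_EFinP; apply: (measurableT_comp (measurable_norm_pow hN r)).
by apply: measurable_tsub; [exact: measurable_fst|exact: measurable_snd].
Qed.

Lemma measurable_norm_tsub_powr x :
  measurable_fun setT (fun y : T => ((N (tsub x y)) `^ r)%:E).
Proof.
apply/measurable_EFinP; apply: (measurableT_comp (measurable_norm_pow hN r)).
exact: measurable_tsub.
Qed.

(** Passes from the distortion integral to the finite constraint of [mi_sum_lower], the cost being
    bounded below by a constant on each rectangle. *)
Lemma distortion_cells m n (A : 'I_m -> set T) (B : 'I_n -> set T)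
    (del : 'I_m -> 'I_n -> R) : is_partition A -> is_partition B ->
  (forall i j, 0 <= del i j) ->
  (forall i j x y, A i x -> B j y -> del i j <= N (tsub x y) `^ r) ->
  (\sum_i \sum_j (del i j)%:E * J (A i) (B j) <= distortion lam f N r k)%E.
Proof.
move=> pA pB del0 hdel; have [mA _ _] := pA; have [mB _ _] := pB.
pose g x := (\int[k x]_y ((N (tsub x y)) `^ r)%:E)%E.
have g0 x : (0 <= g x)%E by apply: integral_ge0 => y _; rewrite lee_fin powR_ge0.
have mg : measurable_fun setT g.
  apply: (measurable_fun_integral_finite_kernel (fun z : T * T => ((N (tsub z.1 z.2)) `^ r)%:E) k).
    by move=> z; rewrite lee_fin powR_ge0.
  exact: measurable_norm_tsub_pow.
have mfg : measurable_fun setT (fun x => (f x)%:E * g x)%E.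
  by apply: emeasurable_funM => //; exact/measurable_EFinP.
rewrite /distortion -/g (integral_partition lam pA mfg); last first.
  by move=> x; rewrite mule_ge0 ?lee_fin.
apply: lee_sum => i _.
have mfk j : measurable_fun (A i) (fun x => (f x)%:E * k x (B j))%E.
  apply: measurable_funTS; apply: emeasurable_funM; first exact/measurable_EFinP.
  exact: measurable_kernel.
have -> : (\sum_j (del i j)%:E * J (A i) (B j) =
    \int[lam]_(x in A i) \sum_j ((del i j)%:E * ((f x)%:E * k x (B j))))%E.
  rewrite ge0_integral_sum//; last 2 first.
  - by move=> j; exact: measurable_funeM.
  - by move=> j x _; rewrite !mule_ge0 ?lee_fin.
  by apply: eq_bigr => j _; rewrite ge0_integralZl// ?lee_fin// => x _; rewrite mule_ge0 ?lee_fin.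
apply: ge0_le_integral => //.
- by move=> x _; apply: sume_ge0 => j _; rewrite !mule_ge0 ?lee_fin.
- by apply: emeasurable_sum => j _; exact: measurable_funeM.
- exact: measurable_funTS.
move=> x Ax; under eq_bigr do rewrite muleCA.
rewrite -ge0_sume_distrr; last by move=> j _; rewrite mule_ge0 ?lee_fin.
rewrite lee_wpmul2l ?lee_fin// /g (integral_partition _ pB); last 2 first.
- exact: measurable_norm_tsub_powr.
- by move=> y; rewrite lee_fin powR_ge0.
apply: lee_sum => j _; rewrite -integral_cst//.
apply: ge0_le_integral => //.
- by move=> y _; rewrite /= lee_fin.
- by apply: measurable_funTS; exact: measurable_norm_tsub_powr.
- by move=> y By; rewrite /= lee_fin; exact: hdel Ax By.
Qed.

(** Common source of both lower bounds: [gam i] bounds the logarithm of the mean density of cell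
    [i], and [th], [e] absorb the diameters of the cells. The factor of [1 - fine (P ...)] is the
    logarithm of [expR (la * e)] times the integral of [exp_norm] with parameter [la * (1 - th)]. *)
Lemma label_lower_bound (l : T -> nat) (gam : nat -> R) (la th e eta D : R) :
  measurable_label l -> (forall x y, l x = l y -> N (tsub x y) <= eta) ->
  (forall i, (P [set x | l x = i] <= (expR (gam i))%:E * lam [set x | l x = i])%E) ->
  0 < la -> 0 < th < 1 -> 0 < eta ->
  (forall s t, 0 <= s -> 0 <= t -> s <= t + 2 * eta ->
    (1 - th) * s `^ r <= t `^ r + e) ->
  (distortion lam f N r k <= D%:E)%E ->
  forall m, ((- (\sum_(i < m) fine (P [set x | l x = i]) * gam i)
     - (la * e + ln Z - p * ln (la * (1 - th))) * (1 - fine (P [set x | (m <= l x)%N]))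
     - la * D - fine (P [set x | (m <= l x)%N]))%:E <= mutual_info lam f k)%E.
Proof.
move=> ml hl hgam la0 /andP[th0 th1] eta0 happ hD m.
set K := la * e + _ - _.
have lath : 0 < la * (1 - th) by rewrite mulr_gt0// subr_gt0.
have eK : expR K = expR (la * e) * (Z * (la * (1 - th)) `^ (- p)).
  rewrite /K expRD expRD lnK ?posrE ?norm_const_gt0// -mulrA; congr (_ * (_ * _)).
  by rewrite /powR gt_eqF//; congr expR; ring.
have [l' ml' hl'] := grid_label hN eta0.
apply/lee_addgt0Pr => ep ep0.
pose G := \sum_(i < m) `|gam i + K|.
have G0 : 0 <= G by apply: sumr_ge0.
(* [G] depends on [m], so the output is truncated only now; the slack [ep] pays for it. *)
have [n hn] : exists n, (J setT [set y | (n <= l' y)%N] < (ep / (G + 1))%:E)%E.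
  have [|||n0 hn0] := @measure_label_tail R d (output_measure lam mf f0 k) l' (ep / (G + 1)).
  - exact: ml'.
  - by rewrite output_measureE -ge0_fin_numE ?joint_ge0// joint_fin.
  - by rewrite divr_gt0// ltr_pwDr.
  - by exists n0; exact: hn0.
pose A : 'I_m.+1 -> set T := @label_part R d l m.
pose B : 'I_n.+1 -> set T := @label_part R d l' n.
have pA : is_partition A by exact: label_partition.
have pB : is_partition B by exact: label_partition.
have [mA tA _] := pA; have [mB _ _] := pB.
pose pp i j := fine (J (A i) (B j)).
pose a i := fine (P (A i)).
pose b j := fine (J setT (B j)).
pose S i j : set R := [set N (tsub z.1 z.2) `^ r | z in [set z : T * T | A i z.1 /\ B j z.2]].
(* The best constant below the cost on the rectangle; for an empty rectangle the infimum is 0 by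
   convention, which is still admissible. *)
pose del i j := inf (S i j).
have lbS i j : lbound (S i j) 0 by move=> _ [z _ <-]; exact: powR_ge0.
have hasS i j : has_lbound (S i j) by exists 0.
have del0 i j : 0 <= del i j.
  have [S0|/set0P/negP/negPn/eqP S0] := pselect (S i j !=set0); first exact: lb_le_inf.
  by rewrite /del S0 inf0.
have hdel i j x y : A i x -> B j y -> del i j <= N (tsub x y) `^ r.
  by move=> Ax By; apply: ge_inf => //; exists (x, y).
have pfin i j : J (A i) (B j) \is a fin_num by exact: joint_fin.
have bfin j : J setT (B j) \is a fin_num by exact: joint_fin.
have afin i : P (A i) \is a fin_num by exact: PX_fin.
have pa i : \sum_j pp i j = a i.
  apply: EFin_inj; rewrite -sumEFin; under eq_bigr do rewrite fineK//.
  by rewrite fineK// joint_sum_r.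
have pb j : \sum_i pp i j = b j.
  apply: EFin_inj; rewrite -sumEFin; under eq_bigr do rewrite fineK//.
  by rewrite fineK// joint_sum_l.
have a1 : \sum_i a i = 1.
  apply: EFin_inj; rewrite -sumEFin; under eq_bigr do rewrite fineK//.
  by rewrite PX_sum.
have pD : \sum_i \sum_j pp i j * del i j <= D.
  rewrite -lee_fin; apply: le_trans hD; apply: le_trans (distortion_cells pA pB del0 hdel).
  rewrite -sumEFin; apply: lee_sum => i _; rewrite -sumEFin; apply: lee_sum => j _.
  by rewrite EFinM fineK// muleC.
have hK (j : 'I_n.+1) : (j < n)%N -> b j != 0 ->
    \sum_(i < m.+1 | (i < m)%N) a i * expR (- gam i - la * del i j) <= expR K.
  move=> jn bj0.
  have [y0 By0] : exists y0, B j y0.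
    apply: contrapT => /forallNP By; move: bj0; apply/negP; rewrite negbK /b.
    have -> : B j = set0 by apply/seteqP; split => // y /By.
    by rewrite -(output_measureE lam mf f0 k) measure0.
  (* Column [j] is compared with an integral: [a i * expR (- gam i)] is at most [lam (A i)], and [h]
     dominates [expR (- la * del i j)] on [A i]. Its total integral is [expR K] whatever [y0] is. *)
  pose h x := ((expR (la * e))%:E * (exp_norm N r (la * (1 - th)) (tsub x y0))%:E)%E.
  have mh0 : measurable_fun setT (fun x => (exp_norm N r (la * (1 - th)) (tsub x y0))%:E).
    apply/measurable_EFinP; apply: (measurableT_comp (measurable_exp_norm hN r _)).
    exact: measurable_tsub.
  have mh : measurable_fun setT h by exact: measurable_funeM.
  have h0 x : (0 <= h x)%E by rewrite mule_ge0 ?lee_fin ?expR_ge0.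
  have -> : expR K = fine (\int[lam]_x h x)%E.
    rewrite ge0_integralZl//; last by move=> x _; rewrite lee_fin expR_ge0.
    by rewrite integral_exp_norm_shift// -EFinM /= eK.
  have hfin : (\int[lam]_x h x)%E \is a fin_num.
    rewrite ge0_integralZl//; last by move=> x _; rewrite lee_fin expR_ge0.
    by rewrite integral_exp_norm_shift// -EFinM.
  rewrite -lee_fin fineK// (integral_partition lam pA mh h0) -sumEFin.
  rewrite [leLHS]big_mkcond; apply: lee_sum => i _.
  case: ifPn => im; last by apply: integral_ge0.
  have Aim : A i = [set x | l x = i] by exact: label_part_lt.
  apply: (@le_trans _ _ ((expR (- la * del i j))%:E * lam (A i))%E).
    rewrite EFinM fineK//.
    have := hgam i; rewrite -Aim => hg.
    have := lee_wpmul2r (_ : 0 <= (expR (- gam i - la * del i j))%:E)%E hg.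
    rewrite lee_fin expR_ge0 => /(_ isT) /le_trans; apply.
    rewrite muleAC -EFinM -expRD le_eqVlt; apply/orP; left; apply/eqP.
    by congr (_%:E * _)%E; congr expR; ring.
  rewrite -integral_cst//; apply: ge0_le_integral => //.
  - by move=> x _; rewrite /= lee_fin expR_ge0.
  - exact: measurable_funTS.
  - move=> x Ax; rewrite /= /h -EFinM lee_fin -expRD ler_expR.
    (* Moving both endpoints within their cells changes the distance by at most [2 * eta], the error
       that [happ] tolerates. *)
    suff : (1 - th) * N (tsub x y0) `^ r - e <= del i j.
      move=> hd'; have : la * ((1 - th) * N (tsub x y0) `^ r - e) <= la * del i j.
        by rewrite ler_pM2l.
      lra.
    apply: lb_le_inf; first by exists (N (tsub x y0) `^ r), (x, y0).
    move=> _ [[x' y'] /= [Ax' By'] <-]; rewrite lerBlDr; apply: happ; rewrite ?norm_ge0//.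
    apply: le_trans (norm_sub_triangle hN x' _ _) _.
    have h1 : N (tsub x x') <= eta by apply: hl; move: Ax Ax'; rewrite Aim /= => -> ->.
    have h2 : N (tsub y' y0) <= eta.
      by apply: hl'; move: By' By0; rewrite /B label_part_lt//= => -> ->.
    have := norm_sub_triangle hN y' x' y0; lra.
have := mi_sum_lower (fun i j => fine_ge0 (joint_ge0 lam f0 k (A i) (B j))) pa pb a1 (ltW la0) del0 pD hK.
rewrite -/G => hmain.
apply: (@le_trans _ _ (\sum_i \sum_j mi_term (pp i j) (a i) (b j) + ep)%:E); last first.
  rewrite EFinD leeD2r//; apply: ereal_sup_ubound.
  by exists m.+1, n.+1, A, B.
have bG : b ord_max * G <= ep.
  have : b ord_max < ep / (G + 1).
    by rewrite -lte_fin /b fineK// /B label_part_max.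
  rewrite ltr_pdivlMr ?ltr_pwDr// => h; have : 0 <= b ord_max by exact/fine_ge0/joint_ge0.
  lra.
move: hmain; rewrite (big_ord_narrow (leqnSn m)) /=.
have -> : a ord_max = fine (P [set x | (m <= l x)%N]) by rewrite /a /A label_part_max.
under eq_bigr do rewrite /a /A label_part_lt//=.
rewrite lee_fin; move: bG; set x1 := \sum_(i < m) _; set x2 := \sum_i _.
lra.
Qed.

End LowerBound.

(** * The entropy of the integer part and the case of infinite entropy *)

Section FloorEntropy.
Variables (R : realType) (d : nat).
Local Notation T := (d.-tuple R).
Variables (lam : {measure set T -> \bar R}) (f : T -> R).
Hypotheses (mf : measurable_fun setT f) (f0 : forall x, 0 <= f x).
Hypothesis f1 : (\int[lam]_x (f x)%:E = 1)%E.
Local Notation P := (PX lam f).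

Definition floor_tuple (x : T) : d.-tuple int :=
  [tuple Num.floor (tnth x i) | i < d].

Definition floor_label (x : T) : nat := pickle (floor_tuple x).

Lemma floor_cellE (c : d.-tuple int) :
  floor_cell c = [set x : T | floor_label x = pickle c].
Proof.
apply/seteqP; split => x; rewrite /floor_cell /floor_label /= => h.
  by congr pickle; apply: eq_from_tnth => i; rewrite tnth_mktuple.
have {}h := pcan_inj (@pickleK _) h.
by move=> i; rewrite -h tnth_mktuple.
Qed.

Lemma measurable_floor_label : measurable_label floor_label.
Proof.
move=> n; have [[c hc]|h] := pselect (exists c : d.-tuple int, pickle c = n).
  by rewrite -hc -floor_cellE; exact: measurable_floor_cell.
rewrite (_ : [set x | _] = set0)//; apply/seteqP; split => // x /= xn.
by apply: h; exists (floor_tuple x).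
Qed.

Lemma floor_label_dist x y i : floor_label x = floor_label y ->
  `|tnth x i - tnth y i| <= 1.
Proof.
move=> xy; have {}xy := pcan_inj (@pickleK _) xy.
have := congr1 (fun t => tnth t i) xy; rewrite !tnth_mktuple => h.
have /andP[a1 a2] := floor_itv (tnth x i).
have /andP[b1 b2] := floor_itv (tnth y i).
rewrite ler_norml; move: a1 a2 b1 b2; rewrite h !intrD /= => a1 a2 b1 b2.
by apply/andP; split; lra.
Qed.

Definition label_prob (l : T -> nat) i : R := fine (P [set x | l x = i]).

Lemma label_prob_ge0 l i : 0 <= label_prob l i.
Proof. exact/fine_ge0/PX_ge0. Qed.

Lemma label_prob_le1 l i : measurable_label l -> label_prob l i <= 1.
Proof.
by move=> ml; rewrite -lee_fin fineK ?(PX_fin mf f0 f1) ?(PX_le1 mf f0 f1).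
Qed.

Lemma entropy_term_ge0 l i : measurable_label l ->
  0 <= - (label_prob l i * ln (label_prob l i)).
Proof.
move=> ml; rewrite oppr_ge0 mulr_ge0_le0 ?label_prob_ge0//.
by rewrite ln_le0// label_prob_le1.
Qed.

Lemma label_prob_sum l m : measurable_label l ->
  \sum_(i < m) label_prob l i = 1 - fine (P [set x | (m <= l x)%N]).
Proof.
move=> ml; have mm : measurable [set x | (m <= l x)%N].
  exact: (measurable_label_preimage [set j | (m <= j)%N] ml).
apply/eqP; rewrite eq_sym subr_eq; apply/eqP/EFin_inj.
rewrite -(PX_sum mf f0 f1 (label_partition m ml)) big_ord_recr/= EFinD.
rewrite label_part_max (fineK (PX_fin mf f0 f1 mm)) -sumEFin; congr (_ + _)%E.
apply: eq_bigr => i _; rewrite label_part_lt//= fineK//.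
exact: PX_fin.
Qed.

Local Notation p := (label_prob floor_label).

(** The sum over integer vectors is reindexed by their codes; numbers that code no vector label
    empty cells and contribute 0. *)
Lemma entropy_floorE :
  entropy_floor lam f = (\sum_(i <oo) (- (p i * ln (p i)))%:E)%E.
Proof.
rewrite nneseries_esumT; last first.
  by move=> i; rewrite lee_fin entropy_term_ge0//; exact: measurable_floor_label.
rewrite /entropy_floor.
pose b i := (- (p i * ln (p i)))%:E.
transitivity (\esum_(c in [set: d.-tuple int]) b (pickle c))%E.
  by apply: eq_esum => c _; rewrite /floor_prob floor_cellE.
have <- : (\esum_(i in range (pickle : d.-tuple int -> nat)) b i =
    \esum_(c in [set: d.-tuple int]) b (pickle c))%E.
  apply: reindex_esum; split; [by move=> c _; exists c| |by move=> i].
  by move=> u v _ _; exact: (pcan_inj (@pickleK _)).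
rewrite esum_mkcond; apply: eq_esum => i _; case: ifPn => //.
rewrite notin_setE => h; rewrite /b /label_prob.
rewrite (_ : [set x | _] = set0); last first.
  by apply/seteqP; split => // x /= xi; apply: h; exists (floor_tuple x).
by rewrite /PX integral_set0 mul0r oppr0.
Qed.

End FloorEntropy.

Section InfiniteEntropy.
Variables (R : realType) (d : nat) (hd : (0 < d)%N).
Local Notation T := (d.-tuple R).
Variables (N : T -> R) (hN : is_norm N) (r : R) (hr : 0 < r).
Variable lam : {measure set T -> \bar R}.
Hypothesis hlam : is_lebesgue lam.
Variable f : T -> R.
Hypotheses (mf : measurable_fun setT f) (f0 : forall x, 0 <= f x).
Hypothesis f1 : (\int[lam]_x (f x)%:E = 1)%E.
Local Notation p := (label_prob lam f (@floor_label R d)).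

(** Integer cells have a fixed diameter, so the errors in [label_lower_bound] are constants rather
    than small. They do not depend on [m], while the partial sums of the entropy diverge. *)
Lemma mutual_info_infinite (k : R.-pker T ~> T) (D : R) :
  entropy_floor lam f = +oo%E -> (distortion lam f N r k <= D%:E)%E ->
  mutual_info lam f k = +oo%E.
Proof.
move=> Hoo hD.
have th : 0 < (2^-1 : R) < 1 by rewrite invr_gt0 invf_lt1// ltr1n ltr0n.
have [c c0 hc] := powR_approx hr th.
have [C C0 hC] := norm_le_coord hN.
(* Solves [c * e ^ (1 / r) = 2 * C], so that [powR_approx] accepts cells of diameter [C]. *)
pose e := (2 * C / c) `^ r.
have e0 : 0 < e by rewrite powR_gt0// divr_gt0// mulr_gt0.
have ce : c * e `^ r^-1 = 2 * C.
  rewrite /e -powRrM mulfV ?gt_eqF// powRr1 ?divr_ge0 ?mulr_ge0 ?ltW//.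
  by field; rewrite gt_eqF.
(* The second summand compensates the volume bound [(1 / 2) ^ d] of [floor_cell_ge]. *)
pose gam i := ln (p i) + d%:R * ln 2.
have key := @label_lower_bound R d hd N hN r hr lam hlam f mf f0 f1 k
   (@floor_label R d) gam 1 2^-1 e C D (@measurable_floor_label R d).
have {key} := key _ _ ltr01 th C0 _ hD.
have hd1 : forall x y : T, floor_label x = floor_label y -> N (tsub x y) <= C.
  move=> x y xy; rewrite -[leRHS]mulr1; apply: hC => // i.
  by rewrite tnth_mktuple; exact: floor_label_dist.
have hd2 i : (PX lam f [set x | floor_label x = i] <=
    (expR (gam i))%:E * lam [set x | floor_label x = i])%E.
  have [pi0|pi0] := eqVneq (p i) 0.
    rewrite -(@fineK _ (PX lam f _)) ?(PX_fin mf f0 f1)//; last first.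
      exact: measurable_floor_label.
    by rewrite -/(p i) pi0 mule_ge0 ?lee_fin ?expR_ge0.
  have pp : 0 < p i by rewrite lt_neqAle eq_sym pi0 label_prob_ge0.
  have [[v hv]|h] := pselect (exists v : d.-tuple int, pickle v = i); last first.
    move: pi0; rewrite /label_prob (_ : [set x | _] = set0).
      by rewrite /PX integral_set0 eqxx.
    by apply/seteqP; split => // x /= xi; apply: h; exists (floor_tuple x).
  rewrite -(@fineK _ (PX lam f _)) ?(PX_fin mf f0 f1)//; last first.
    exact: measurable_floor_label.
  rewrite -/(p i) (_ : [set x | _] = floor_cell v); last by rewrite floor_cellE hv.
  apply: (@le_trans _ _ ((expR (gam i))%:E * ((1 / 2) ^+ d)%:E)%E); last first.
    by rewrite lee_wpmul2l ?lee_fin ?expR_ge0// floor_cell_ge.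
  rewrite -EFinM lee_fin /gam expRD lnK ?posrE// expRM_natl lnK ?posrE//.
  by rewrite -mulrA -exprMn div1r mulfV ?expr1n ?mulr1// pnatr_eq0.
move=> /(_ hd1 hd2) key.
have {}key := key (fun s t s0 t0 (h : s <= t + 2 * C) => hc e s t e0 s0 t0 (eq_ind _ (fun c => s <= t + c) h _ (esym ce))).
set K := 1 * e + _ - _ in key.
apply/eqyP => A A0.
have b0 i : 0 <= - (p i * ln (p i)).
  by apply: entropy_term_ge0 => //; exact: measurable_floor_label.
have bcvg : (\sum_(0 <= i < n) (- (p i * ln (p i)))%:E @[n --> \oo] --> +oo)%E.
  rewrite -Hoo (entropy_floorE mf f0 f1); apply: is_cvg_nneseries => i _ _.
  by rewrite lee_fin.
have [m _ /(_ m (leqnn m)) hm] := cvgey_gt bcvg (A + d%:R * ln 2 + `|K| + D + 1).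
have ln2 : 0 <= ln 2 :> R by rewrite ln_ge0// ler1n.
move: (key m); apply: le_trans; rewrite lee_fin.
have Pm := label_prob_sum mf f0 f1 m (@measurable_floor_label R d).
set Q := fine _ in Pm *.
have Q0 : 0 <= Q by exact/fine_ge0/PX_ge0.
have Q1 : Q <= 1.
  rewrite /Q -lee_fin fineK.
    by apply: PX_le1 => //; exact: (measurable_label_preimage [set j | (m <= j)%N] (@measurable_floor_label R d)).
  by apply: PX_fin => //; exact: (measurable_label_preimage [set j | (m <= j)%N] (@measurable_floor_label R d)).
have -> : \sum_(i < m) p i * gam i =
    - (\sum_(i < m) - (p i * ln (p i))) + d%:R * ln 2 * (1 - Q).
  rewrite -Pm mulr_sumr -sumrN -big_split/=; apply: eq_bigr => i _.
  by rewrite /gam; ring.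
move: hm; rewrite big_mkord sumEFin lte_fin; set S := \sum_(i < m) _ => hm.
have h1 : K * (1 - Q) <= `|K|.
  apply: le_trans (ler_norm _) _; rewrite normrM ler_piMr// ger0_norm; lra.
have h2 : d%:R * ln 2 * (1 - Q) <= d%:R * ln 2.
  by rewrite ler_piMr ?mulr_ge0//; lra.
lra.
Qed.

Lemma RD_infinite (D : R) : entropy_floor lam f = +oo%E ->
  RD lam f N r D = +oo%E.
Proof.
move=> Hoo; apply/eqP; rewrite eq_le leey/=; apply: le_ereal_inf_tmp => z [k [hk ->]].
by rewrite (mutual_info_infinite Hoo hk).
Qed.

End InfiniteEntropy.

(** * The Shannon lower bound *)

Section ShannonLowerBound.
Variables (R : realType) (d : nat) (hd : (0 < d)%N).
Local Notation T := (d.-tuple R).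
Variables (N : T -> R) (hN : is_norm N) (r : R) (hr : 0 < r).
Variable lam : {measure set T -> \bar R}.
Hypothesis hlam : is_lebesgue lam.
Variable f : T -> R.
Hypotheses (mf : measurable_fun setT f) (f0 : forall x, 0 <= f x).
Hypothesis f1 : (\int[lam]_x (f x)%:E = 1)%E.
Hypothesis fint : lam.-integrable setT (fun x => (f x * ln (f x))%:E).

Local Notation Z := (norm_const N r lam).
Let p : R := d%:R / r.
Let p0 : 0 < p. Proof. by rewrite divr_gt0// ltr0n. Qed.

Lemma RSLBE (D : R) : 0 < D ->
  RSLB lam f N r D = diff_entropy lam f - p - ln Z + p * ln (p / D).
Proof.
move=> D0; rewrite /RSLB -/(norm_const N r lam) -/p.
have Z0 : 0 < Z by exact: norm_const_gt0.
have -> : r / d%:R = p^-1 by rewrite /p invf_div.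
rewrite lnM ?posrE ?mulr_gt0 ?invr_gt0 ?powR_gt0 ?expR_gt0// lnM ?posrE ?invr_gt0 ?powR_gt0//.
rewrite lnV ?posrE// expRK ln_powR div1r lnV ?posrE// ln_div ?posrE//.
by field; rewrite gt_eqF.
Qed.

Let F x := f x * ln (f x).

Let mF : measurable_fun setT F.
Proof. by have /integrableP[/measurable_EFinP] := fint. Qed.

Let mabsF : measurable_fun setT (fun x => `|F x|).
Proof. exact: measurableT_comp. Qed.

Let absF0 x : 0 <= `|F x|. Proof. exact: normr_ge0. Qed.

(** Integrability of [f * ln f] recast as finiteness of a measure, so that [measure_label_tail]
    controls the entropy lost by truncation. *)
Definition entropy_variation : {measure set T -> \bar R} := density lam mabsF absF0.

Lemma entropy_variation_lty : (entropy_variation setT < +oo)%E.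
Proof. by have /integrableP[_] := fint. Qed.

Let fintf : lam.-integrable setT (EFin \o f).
Proof.
apply/integrableP; split; first exact/measurable_EFinP.
under eq_integral do rewrite /= ger0_norm//.
by rewrite f1 ltry.
Qed.

Lemma entropy_tail (A B : set T) : measurable A -> measurable B -> A `&` B = set0 ->
  A `|` B = setT ->
  Rintegral lam A F <= - diff_entropy lam f + fine (entropy_variation B).
Proof.
move=> mA mB AB0 ABT.
have FA : lam.-integrable A (EFin \o F) by exact: (integrableS measurableT).
have FB : lam.-integrable B (EFin \o F) by exact: (integrableS measurableT).
rewrite /diff_entropy opprK -ABT Rintegral_setU//; last 2 first.
- by rewrite ABT.
- exact/disj_set2P.
have := le_normr_Rintegral mB FB.
rewrite -/F ler_norml => /andP[h _].
have -> : fine (entropy_variation B) = Rintegral lam B (fun x => `|F x|) by [].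
lra.
Qed.

(* The flag [z] isolates the zero set of [f], where [ln (f x) = 0] is a junk value. *)
Lemma level_label (eta e : R) : 0 < eta -> 0 < e ->
  exists l gam (z : nat -> bool), [/\ measurable_label l,
    forall x y, l x = l y -> N (tsub x y) <= eta,
    forall x, ln (f x) <= gam (l x) <= ln (f x) + e &
    forall x, z (l x) = (f x == 0)].
Proof.
move=> eta0 e0; have [l0 ml0 hl0] := grid_label hN eta0.
pose level x : int := Num.floor (ln (f x) / e).
(* The upper end of the level interval, hence the [+ 1]: [gam] must lie above [ln f]. It is decoded
   from the label, and 0 is a dummy for numbers that are no code. *)
pose gam i : R := if @unpickle (nat * int * bool)%type i is Some c then e * (c.1.2%:~R + 1) else 0.
pose z i := if @unpickle (nat * int * bool)%type i is Some c then c.2 else false.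
pose l x := pickle (l0 x, level x, f x == 0).
have gamE x : gam (l x) = e * ((level x)%:~R + 1) by rewrite /gam /l pickleK.
have lev x : (level x)%:~R * e <= ln (f x) < ((level x)%:~R + 1) * e.
  have /andP[h1 h2] := floor_itv (ln (f x) / e).
  move: h1 h2; rewrite ler_pdivlMr// ltr_pdivrMr// intrD /= => h1 h2.
  by apply/andP.
exists l, gam, z; split.
- move=> n; have [[c hc]|h] := pselect (exists c : nat * int * bool, pickle c = n); last first.
    rewrite (_ : [set x | _] = set0)//; apply/seteqP; split => // x /= xn.
    by apply: h; exists (l0 x, level x, f x == 0).
  rewrite (_ : [set x | _] = [set x | l0 x = c.1.1] `&`
     ((fun x => ln (f x)) @^-1` `[c.1.2%:~R * e, (c.1.2%:~R + 1) * e[%classic `&`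
     f @^-1` [set t | (t == 0) = c.2])).
    apply: measurableI; first exact: ml0.
    apply: measurableI; rewrite -[X in measurable X]setTI.
      by apply: (measurableT_comp (@measurable_ln R) mf).
    apply: mf => //; case: c.2.
      by rewrite (_ : [set t | _] = [set 0]); [exact: measurable_set1|apply/seteqP; split=> t /= /eqP].
    rewrite (_ : [set t | _] = ~` [set 0]); first by apply: measurableC; exact: measurable_set1.
    by apply/seteqP; split=> t /=; [move/eqP|move/eqP/negbTE].
  rewrite -hc; apply/seteqP; split => x /=.
    move=> /(pcan_inj (@pickleK _)) <- /=; split => //; split => //.
    by rewrite in_itv/=; exact: lev.
  case=> h1 [+ h4]; rewrite in_itv/= => /andP[h2 h3].
  rewrite /l h1 h4; congr pickle; rewrite [RHS]surjective_pairing; congr pair.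
  rewrite [RHS]surjective_pairing; congr pair.
  apply: floor_def; rewrite ler_pdivlMr// ltr_pdivrMr// intrD /=.
  by apply/andP.
- by move=> x y /(pcan_inj (@pickleK _)) [/hl0].
- move=> x; rewrite gamE mulrDr mulr1 lerD2r mulrC; have /andP[-> /ltW] := lev x.
  by rewrite mulrDl mul1r mulrC => ->.
- by move=> x; rewrite /z /l pickleK.
Qed.

Lemma le_expR_ln x (t : R) : ln (f x) <= t -> f x <= expR t.
Proof.
have [->|fx0] := eqVneq (f x) 0; first by rewrite expR_ge0.
have fp : 0 < f x by rewrite lt_neqAle eq_sym fx0 f0.
by rewrite -[in f x <= _](lnK fp) ler_expR.
Qed.

Let fin_intF (A : set T) (g : T -> R) : measurable A -> lam.-integrable setT (EFin \o g) ->
  lam.-integrable A (EFin \o g).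
Proof. by move=> mA; exact: integrableS. Qed.

(** On each cell [gam] exceeds [ln f] by at most [e], and the part of the entropy integral outside
    the first [m] cells is bounded by [entropy_variation]. *)
Lemma label_entropy_le l gam (e : R) m : measurable_label l ->
  (forall x, gam (l x) <= ln (f x) + e) ->
  \sum_(i < m) label_prob lam f l i * gam i <=
  e * (1 - fine (PX lam f [set x | (m <= l x)%N]))
    - diff_entropy lam f + fine (entropy_variation [set x | (m <= l x)%N]).
Proof.
move=> ml hg; set B := [set x | (m <= l x)%N].
have mB : measurable B by exact: (measurable_label_preimage [set j | (m <= j)%N] ml).
pose A := [set x | (l x < m)%N].
have mA : measurable A by exact: (measurable_label_preimage [set j | (j < m)%N] ml).
have hAB := @entropy_tail A B mA mB.
rewrite -addrA; have : \sum_(i < m) label_prob lam f l i * gam i <=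
   e * (1 - fine (PX lam f B)) + Rintegral lam A F; last first.
  move=> /le_trans; apply; rewrite lerD2l; apply: hAB.
    by apply/seteqP; split => // x []; rewrite /A /B/= ltnNge => /negP.
  by apply/seteqP; split => // x _; rewrite /A /B /=; case: ltnP => h; [left|right].
rewrite -(label_prob_sum mf f0 f1 m ml).
have mi (i : nat) : measurable [set x | l x = i] by exact: ml.
have tl : trivIset [set: nat] (fun i => [set x | l x = i]).
  by apply/trivIsetP => i j _ _ /eqP ij; apply/seteqP; split => // x [/= -> /ij].
have -> : Rintegral lam A F = \sum_(i < m) Rintegral lam [set x | l x = i] F.
  have AE : A = \big[setU/set0]_(i <- index_iota 0 m) [set x | l x = i].
    rewrite big_mkord -(bigcup_mkord m (fun i => [set x | l x = i])).
    apply/seteqP; split => [x xm|x [i im li]]; first by exists (l x).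
    by rewrite /A /= (_ : l x = i).
  apply: EFin_inj; rewrite -sumEFin /Rintegral fineK; last first.
    by apply: integrable_fin_num => //; exact: fin_intF.
  rewrite AE integral_bigsetU_EFin//; last 3 first.
  - exact: iota_uniq.
  - exact: (sub_trivIset (@subsetT _ _)).
  - by apply/measurable_EFinP; exact: measurable_funTS.
  rewrite big_mkord; apply: eq_bigr => i _; rewrite fineK//.
  by apply: integrable_fin_num => //; exact: fin_intF.
rewrite mulr_sumr -big_split/=; apply: ler_sum => i _.
have -> : label_prob lam f l i = Rintegral lam [set x | l x = i] f by [].
rewrite mulrC -RintegralZl//; last exact: fin_intF.
rewrite -RintegralZl//; last exact: fin_intF.
have intf c : lam.-integrable [set x | l x = i] (EFin \o (fun x => c * f x)).
  by apply: fin_intF => //; exact: (integrableZl measurableT c fintf).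
rewrite -RintegralD//; last exact: fin_intF.
apply: le_Rintegral => //.
- exact: (integrableD (mi i) (intf e) (fin_intF (mi i) fint)).
- move=> x /= li; rewrite mulrC; have := hg x; rewrite li /F => h.
  have : f x * gam i <= f x * (ln (f x) + e) by rewrite ler_wpM2l.
  lra.
Qed.

Theorem shannon_lower_bound (k : R.-pker T ~> T) (D : R) : 0 < D ->
  (distortion lam f N r k <= D%:E)%E ->
  ((RSLB lam f N r D)%:E <= mutual_info lam f k)%E.
Proof.
move=> D0 hD; apply/lee_addgt0Pr => ep ep0.
(* The slack [ep] is shared out: [th] is chosen so that [p * ln (1 - th) = - ep / 3], [e] so that
   [(la + 1) * e = ep / 3], and the two tails, of [PX] weighted by [|K| + 1] and of
   [entropy_variation], get [ep / 6] each. *)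
pose la := p / D; have la0 : 0 < la by rewrite divr_gt0.
pose th := 1 - expR (- (ep / 3 / p)).
have thE : 1 - th = expR (- (ep / 3 / p)) by rewrite /th; ring.
have ep3 : 0 < ep / 3 by rewrite divr_gt0.
have th01 : 0 < th < 1.
  by rewrite /th subr_gt0 expR_lt1 oppr_lt0 divr_gt0//= gtrBl expR_gt0.
have [c c0 hc] := powR_approx hr th01.
pose e := ep / 3 / (la + 1).
have la1 : 0 < la + 1 by rewrite addr_gt0.
have e0 : 0 < e by rewrite divr_gt0.
pose eta := c * e `^ r^-1 / 2.
have eta0 : 0 < eta by rewrite divr_gt0// mulr_gt0// powR_gt0.
have [l [gam [_ [ml hl hlg _]]]] := level_label eta0 e0.
have hf x : f x <= expR (gam (l x)) by apply: le_expR_ln; have /andP[] := hlg x.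
have hgam x : gam (l x) <= ln (f x) + e by have /andP[] := hlg x.
have hP i : (PX lam f [set x | l x = i] <= (expR (gam i))%:E * lam [set x | l x = i])%E.
  rewrite -integral_cst; last exact: ml.
  apply: ge0_le_integral => //.
  - by move=> x _; rewrite lee_fin.
  - by apply/measurable_EFinP; exact: measurable_funTS.
  - by move=> x /= <-; rewrite lee_fin.
have happ s t : 0 <= s -> 0 <= t -> s <= t + 2 * eta -> (1 - th) * s `^ r <= t `^ r + e.
  move=> s0 t0 st; apply: hc => //; rewrite (_ : c * _ = 2 * eta)//.
  by rewrite /eta; field.
have key := label_lower_bound hd hN hr hlam mf f0 f1 ml hl hP la0 th01 eta0 happ hD.
rewrite -/p in key; set K := la * e + ln Z - _ in key.
have KE : K = la * e + ln Z - p * ln la + ep / 3.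
  rewrite /K lnM ?posrE ?subr_gt0//; last by case/andP: th01.
  rewrite thE expRK mulrDr mulrN; have -> : p * (ep / 3 / p) = ep / 3.
    by rewrite mulrC divfK// gt_eqF.
  ring.
pose q := ep / 6 / (`|K| + 1); have q0 : 0 < q by rewrite !divr_gt0// ltr_pwDr.
have [n1 hn1] : exists n1, forall n, (n1 <= n)%N -> (PX lam f [set x | (n <= l x)%N] < q%:E)%E.
  have PfT : (density lam mf f0 setT < +oo)%E by rewrite [X in (X < _)%E]f1 ltry.
  exact: (measure_label_tail ml PfT q0).
have ep6 : 0 < ep / 6 by rewrite divr_gt0.
have [n2 hn2] := measure_label_tail ml entropy_variation_lty ep6.
pose m := maxn n1 n2.
have mm : measurable [set x | (m <= l x)%N].
  exact: (measurable_label_preimage [set j | (m <= j)%N] ml).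
have := hn1 m (leq_maxl _ _); rewrite -(fineK (PX_fin mf f0 f1 mm)) lte_fin => hq.
have vfin : entropy_variation [set x | (m <= l x)%N] \is a fin_num.
  rewrite ge0_fin_numE//; apply: le_lt_trans entropy_variation_lty.
  by rewrite le_measure ?inE.
have := hn2 m (leq_maxr _ _); rewrite -(fineK vfin) lte_fin => hv.
have := @label_entropy_le l gam e m ml hgam.
rewrite /label_prob => hlab.
apply: le_trans (leeD2r _ (key m)); rewrite -EFinD lee_fin RSLBE//.
move: hlab hq hv; set Q := fine (PX _ _ _); set v := fine _; set S := \sum_(i < m) _.
move=> hlab hq hv.
have Q0 : 0 <= Q by exact/fine_ge0/PX_ge0.
have QK : Q * (`|K| + 1) <= ep / 6.
  by rewrite -ler_pdivlMr ?ltr_pwDr//; exact: ltW.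
have KQ : K * (1 - Q) <= K + Q * `|K|.
  have : - K * Q <= `|K| * Q by rewrite ler_wpM2r// -normrN ler_norm.
  lra.
have eQ : e * (1 - Q) <= e by rewrite ler_piMr// ?(ltW e0)//; lra.
have lae : la * e + e = ep / 3 by rewrite /e; field; rewrite gt_eqF.
have laD : la * D = p by rewrite /la divfK// gt_eqF.
rewrite laD; move: QK KQ; rewrite mulrDr mulr1 KE.
set X := `|_|; set Y := Q * X; rewrite -/la; lra.
Qed.

Lemma RD_ge_RSLB (D : R) : 0 < D -> ((RSLB lam f N r D)%:E <= RD lam f N r D)%E.
Proof.
by move=> D0; apply: le_ereal_inf_tmp => z [k [hk ->]]; exact: shannon_lower_bound.
Qed.

End ShannonLowerBound.

(** * Outer regularity *)

Section Regularity.
Variables (R : realType) (d : nat).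
Local Notation T := (d.-tuple R).

Lemma sup_open_bigcup I (D : set I) (U : I -> set T) :
  (forall i, D i -> sup_open (U i)) -> sup_open (\bigcup_(i in D) U i).
Proof.
move=> oU x [i Di Ux]; have [e e0 he] := oU i Di x Ux.
by exists e => // y hy; exists i => //; exact: he.
Qed.

Lemma sup_openI (U V : set T) : sup_open U -> sup_open V -> sup_open (U `&` V).
Proof.
move=> oU oV x [Ux Vx]; have [e e0 he] := oU x Ux; have [e' e'0 he'] := oV x Vx.
exists (Num.min e e') => [|y hy]; first by rewrite lt_min e0.
by split; [apply: he|apply: he'] => i; have := hy i; rewrite lt_min => /andP[].
Qed.

Lemma sup_open_setT : sup_open [set: T].
Proof. by move=> x _; exists 1. Qed.

Lemma sup_open_bigcap_ord n (U : 'I_n -> set T) :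
  (forall i, sup_open (U i)) -> sup_open [set x | forall i, U i x].
Proof.
elim: n U => [|n IH] U oU.
  by rewrite (_ : [set x | _] = setT); [exact: sup_open_setT|apply/seteqP; split => // x _ []].
rewrite (_ : [set x | _] = U ord0 `&` [set x | forall i, U (lift ord0 i) x]).
  by apply: sup_openI => //; apply: IH.
apply/seteqP; split => [x h|x [h0 h] i]; first by split => [|i]; exact: h.
by have [j ->|->] := unliftP ord0 i.
Qed.

Lemma sup_open_coord_gt i (a : R) : sup_open [set x : T | a < tnth x i].
Proof.
move=> x /= ax; exists (tnth x i - a); first by rewrite subr_gt0.
by move=> y /(_ i); rewrite ltr_norml => /andP[h _]; lra.
Qed.

Lemma sup_open_coord_lt i (a : R) : sup_open [set x : T | tnth x i < a].
Proof.
move=> x /= ax; exists (a - tnth x i); first by rewrite subr_gt0.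
by move=> y /(_ i); rewrite ltr_norml => /andP[_ h]; lra.
Qed.

Variable mu : {measure set T -> \bar R}.
Hypothesis mufin : (mu setT < +oo)%E.

(** Approximation from inside by a closed set is required together with the outer one, which makes
    the class stable under complement. *)
Definition regular (A : set T) := forall e : R, 0 < e -> exists U F,
  [/\ sup_open U, sup_open (~` F), A `<=` U, F `<=` A & (mu (U `\` F) < e%:E)%E].

Let mu_lty A : measurable A -> (mu A < +oo)%E.
Proof. by move=> mA; rewrite (le_lt_trans _ mufin)// le_measure ?inE. Qed.

Lemma mu_nonincreasing_lt (F : (set T)^nat) (e : R) : (forall n, measurable (F n)) ->
  nonincreasing_seq F -> (mu (\bigcap_n F n) < e%:E)%E ->
  exists n, (mu (F n) < e%:E)%E.
Proof.
move=> mF ndF mue.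
have mI : measurable (\bigcap_n F n) by exact: bigcapT_measurable.
have h := nonincreasing_cvg_mu (mu_lty (mF 0%N)) mF mI ndF.
have Ifin : mu (\bigcap_n F n) \is a fin_num by rewrite ge0_fin_numE// mu_lty.
move: h mue; rewrite -(fineK Ifin) lte_fin => /fine_cvgP[_ hf] mue.
have [n _ /(_ n (leqnn n)) hn] : \forall n \near \oo, fine (mu (F n)) < e.
  exact: (cvgr_lt _ hf).
by exists n; rewrite -(@fineK _ (mu (F n))) ?lte_fin// ge0_fin_numE// mu_lty.
Qed.

Lemma regularC A : regular A -> regular (~` A).
Proof.
move=> rA e e0; have [U [F [oU oF AU FA h]]] := rA e e0.
exists (~` F), (~` U); split; rewrite ?setCK//; [exact: subsetC|exact: subsetC|].
by rewrite setDE setCK setIC -setDE.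
Qed.

(** A countable union of closed sets need not be closed, so only finitely many [F n] are kept. Half
    of [e] is spread geometrically over the pieces, and continuity from above makes the truncation
    fit into the other half. *)
Lemma regular_bigcup (A : (set T)^nat) : (forall n, regular (A n)) ->
  regular (\bigcup_n A n).
Proof.
move=> rA e e0.
have h n : {UF : set T * set T | [/\ sup_open UF.1, sup_open (~` UF.2),
     A n `<=` UF.1, UF.2 `<=` A n & (mu (UF.1 `\` UF.2) < (e / 2 / (2 ^ n.+1)%:R)%:E)%E]}.
  apply: cid; have [|U [F hUF]] := rA n (e / 2 / (2 ^ n.+1)%:R).
    by rewrite !divr_gt0// ltr0n expn_gt0.
  by exists (U, F).
pose U n := (sval (h n)).1; pose F n := (sval (h n)).2.
have oU n : sup_open (U n) by have [] := svalP (h n).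
have oF n : sup_open (~` F n) by have [] := svalP (h n).
have AU n : A n `<=` U n by have [] := svalP (h n).
have FA n : F n `<=` A n by have [] := svalP (h n).
have muUF n : (mu (U n `\` F n) < (e / 2 / (2 ^ n.+1)%:R)%:E)%E by have [] := svalP (h n).
pose UU := \bigcup_n U n; pose FF m := \bigcup_(n in [set n | (n < m)%N]) F n.
have oUU : sup_open UU by exact: sup_open_bigcup.
have oFF m : sup_open (~` FF m).
  rewrite (_ : ~` FF m = [set x | forall i : 'I_m, (~` F i) x]).
    exact: (@sup_open_bigcap_ord m (fun i => ~` F i)).
  apply/seteqP; split => [x /= hx i Fx|x hx [n /= nm Fx]]; first by apply: hx; exists i => /=.
  exact: (hx (Ordinal nm)).
have mU n : measurable (U n) by exact: sup_open_measurable.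
have mF n : measurable (F n) by rewrite -[X in measurable X]setCK; apply: measurableC; exact: sup_open_measurable.
have mFF m : measurable (FF m).
  by rewrite -[X in measurable X]setCK; apply: measurableC; exact: sup_open_measurable.
have [m hm] : exists m, (mu (UU `\` FF m) < e%:E)%E.
  apply: (@mu_nonincreasing_lt (fun m => UU `\` FF m)).
  - by move=> m; apply: measurableD => //; exact: sup_open_measurable.
  - apply/nonincreasing_seqP => m; apply/subsetPset; apply: setDS => x [n /= nm Fx].
    by exists n => //=; exact: ltnW.
  - apply: (@le_lt_trans _ _ (e / 2)%:E); last first.
      by rewrite lte_fin ltr_pdivrMr// ltr_pMr// ltr1n.
    apply: (@le_trans _ _ (\sum_(n <oo) mu (U n `\` F n))%E).
      apply: measure_sigma_subadditive => //.
      + by move=> n; exact: measurableD.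
      + apply: bigcapT_measurable => m; apply: measurableD => //; exact: sup_open_measurable.
      + move=> x hx; have [[n _ Ux] _] := hx 0%N I.
        exists n => //; split => // Fx.
        by have [_] := hx n.+1 I; apply; exists n => /=.
    apply: le_trans (@epsilon_trick0 R (e / 2) xpredT _).
      by apply: lee_nneseries => // n _; exact: ltW (muUF n).
    by rewrite divr_ge0// ltW.
exists UU, (FF m); split => //.
- by move=> x [n _ /AU Ux]; exists n.
- by move=> x [n _ /FA Ax]; exists n.
Qed.

(** [U n] pushes the closed faces outwards and [F n] the open faces inwards by [w n]; the
    differences shrink to the empty set. *)
Lemma regular_box a b : regular (box a b).
Proof.
move=> e e0.
pose w (n : nat) : R := n.+1%:R^-1.
have w0 n : 0 < w n by rewrite invr_gt0 ltr0n.
pose U n : set T := [set x | forall i, tnth a i < tnth x i /\ tnth x i < tnth b i + w n].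
pose F n : set T := [set x | forall i, tnth a i + w n <= tnth x i <= tnth b i].
have oU n : sup_open (U n).
  apply: (@sup_open_bigcap_ord d (fun i => [set x | tnth a i < tnth x i /\ tnth x i < tnth b i + w n])) => i.
  by apply: sup_openI; [exact: sup_open_coord_gt|exact: sup_open_coord_lt].
have oF n : sup_open (~` F n).
  rewrite (_ : ~` F n = \bigcup_(i in [set: 'I_d])
     ([set x | tnth x i < tnth a i + w n] `|` [set x | tnth b i < tnth x i])).
    apply: sup_open_bigcup => i _ x [h|h].
      by have [e' e'0 he'] := sup_open_coord_lt h; exists e' => // y /he'; left.
    by have [e' e'0 he'] := sup_open_coord_gt h; exists e' => // y /he'; right.
  apply/seteqP; split => [x /= /existsNP[i /negP]|x [i _ h] /(_ i) /andP[h1 h2]].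
    rewrite negb_and -!ltNge => /orP[h|h]; exists i => //; [by left|by right].
  by case: h => /=; rewrite ltNge ?h1 ?h2.
have mU n : measurable (U n) by exact: sup_open_measurable.
have mF n : measurable (F n) by rewrite -[X in measurable X]setCK; apply: measurableC; exact: sup_open_measurable.
have wd n : w n.+1 <= w n.
  by rewrite /w lef_pV2 ?posrE ?ltr0n// ler_nat.
have wlt (t : R) : 0 < t -> exists n, w n < t.
  move=> t0; exists (Num.truncn t^-1).
  by rewrite /w invf_plt ?posrE// truncnS_gt.
have [n hn] : exists n, (mu (U n `\` F n) < e%:E)%E.
  apply: (@mu_nonincreasing_lt (fun m => U m `\` F m)).
  - by move=> m; exact: measurableD.
  - apply/nonincreasing_seqP => m; apply/subsetPset => x [Ux Fx]; split.
      by move=> i; have [h1 h2] := Ux i; split => //; apply: lt_le_trans h2 _; rewrite lerD2l.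
    move=> Fx'; apply: Fx => i; have /andP[h1 ->] := Fx' i; rewrite andbT.
    by apply: le_trans h1; rewrite lerD2l.
  - rewrite (_ : \bigcap_n _ = set0) ?measure0 ?lte_fin//.
    apply/seteqP; split => // x hx.
    have xb i : tnth x i <= tnth b i.
      rewrite leNgt; apply/negP => bx.
      have [|n hn] := wlt (tnth x i - tnth b i); first by rewrite subr_gt0.
      have [/(_ i)[_ h] _] := hx n I; lra.
    have hn i : {n | w n < tnth x i - tnth a i}.
      apply: cid; apply: wlt; rewrite subr_gt0.
      by have [/(_ i)[h _] _] := hx 0%N I.
    (* Each coordinate clears its open face from some index on; the maximum serves all of them. *)
    pose m := \max_(i < d) sval (hn i).
    have [_] := hx m I; apply => i; rewrite xb andbT.
    have h : w m <= w (sval (hn i)).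
      rewrite /w lef_pV2 ?posrE ?ltr0n// ler_nat ltnS.
      exact: (@leq_bigmax _ (fun i => sval (hn i))).
    have := svalP (hn i); move: h; set a1 := w _; set a2 := w _; lra.
exists (U n), (F n); split => //.
- by move=> x h i; have /andP[h1 h2] := h i; split => //; rewrite (le_lt_trans h2)// ltrDl.
- move=> x h i; have /andP[h1 ->] := h i; rewrite andbT.
  by apply: lt_le_trans h1; rewrite ltrDl.
Qed.

Lemma measurable_regular A : measurable A -> regular A.
Proof.
rewrite measurable_boxesE; apply: smallest_sub.
  split.
  - move=> e e0; exists set0, set0; split; rewrite ?setC0 ?setD0 ?measure0 ?lte_fin//.
    exact: sup_open_setT.
  - by move=> B rB; rewrite setTD; exact: regularC.
  - by move=> B rB; exact: regular_bigcup.
by move=> _ [[a b] _ <-]; exact: regular_box.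
Qed.

End Regularity.

(** Regularity was proved for finite measures; restricting [lam] to the open set [Q] of finite
    measure reduces to that case. *)
Lemma lebesgue_outer_regular (R : realType) d
    (lam : {measure set (d.-tuple R) -> \bar R}) (A Q : set (d.-tuple R)) (e : R) :
  measurable A -> sup_open Q -> A `<=` Q -> (lam Q < +oo)%E -> 0 < e ->
  exists U, [/\ sup_open U, A `<=` U & (lam U <= lam A + e%:E)%E].
Proof.
move=> mA oQ AQ Qfin e0; have mQ := sup_open_measurable oQ.
have mufin : (mrestr lam mQ setT < +oo)%E by rewrite /mrestr setTI.
have [U [F [oU oF AU FA h]]] := measurable_regular mufin mA e0.
have mU := sup_open_measurable oU.
have mF : measurable F.
  by rewrite -[X in measurable X]setCK; apply: measurableC; exact: sup_open_measurable.
exists (U `&` Q); split; [exact: sup_openI|by move=> x Ax; split; [exact: AU|exact: AQ]|].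
apply: (@le_trans _ _ (lam (A `|` ((U `\` F) `&` Q)))).
  apply: le_measure; rewrite ?inE; [exact: measurableI| |].
    by apply: measurableU => //; apply: measurableI => //; exact: measurableD.
  move=> x [Ux Qx]; have [Ax|Ax] := pselect (A x); [by left|right].
  by split => //; split => // /FA.
apply: le_trans (measureU2 _ _ _) _ => //.
  by apply: measurableI => //; exact: measurableD.
by apply: leeD2l; exact: ltW.
Qed.

(** * The additive noise channel *)

Section ProbabilityDensity.
Context disp (X : measurableType disp) (R : realType).
Variables (mu : {measure set X -> \bar R}) (g : X -> R).

Definition prob_density (mg : measurable_fun setT g) (g0 : forall x, 0 <= g x)
  of (\int[mu]_x (g x)%:E = 1)%E := density mu mg g0.

Variables (mg : measurable_fun setT g) (g0 : forall x, 0 <= g x).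
Hypothesis g1 : (\int[mu]_x (g x)%:E = 1)%E.

HB.instance Definition _ := Measure.on (prob_density mg g0 g1).

Let prob_density_setT : prob_density mg g0 g1 setT = 1%E.
Proof. exact: g1. Qed.

HB.instance Definition _ :=
  Measure_isProbability.Build _ _ _ (prob_density mg g0 g1) prob_density_setT.

Lemma integral_prob_density (h : X -> \bar R) : measurable_fun setT h ->
  (forall x, 0 <= h x)%E ->
  (\int[prob_density mg g0 g1]_x h x = \int[mu]_x (h x * (g x)%:E))%E.
Proof. exact: integral_density. Qed.

End ProbabilityDensity.

Section NoiseKernel.
Variables (R : realType) (d : nat).
Local Notation T := (d.-tuple R).

Definition noise_kernel (W : probability T R) (s : R) : T -> {measure set T -> \bar R} :=
  fun x => push_measure W (measurable_affine x s).

Variables (W : probability T R) (s : R).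

(** Input in [A] and output in [B], read in the coordinates (input, noise). In these the law is a
    product not depending on [s], so that limits in [s] concern sets and integrands only. *)
Definition noise_event (A B : set T) : set (T * T) :=
  [set w | A w.1 /\ B (affine w.1 s w.2)].

Lemma measurable_noise_event A B : measurable A -> measurable B ->
  measurable (noise_event A B).
Proof.
move=> mA mB.
rewrite (_ : noise_event A B = (fst @^-1` A) `&`
  ((fun w : T * T => affine w.1 s w.2) @^-1` B))//.
apply: measurableI; rewrite -[X in measurable X]setTI.
  exact: measurable_fst.
exact: measurable_affine2.
Qed.

Lemma xsection_noise_event A B x : A x ->
  xsection (noise_event A B) x = affine x s @^-1` B.
Proof.
move=> Ax; apply/seteqP; split => z; rewrite /xsection/= inE.
  by case.
by move=> h; split.
Qed.

Let measurable_noise_kernel U : measurable U ->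
  measurable_fun [set: T] (noise_kernel W s ^~ U).
Proof.
move=> mU; have := measurable_fun_xsection W (measurable_noise_event measurableT mU).
congr (measurable_fun _ _); apply/funext => x /=.
by rewrite xsection_noise_event.
Qed.

HB.instance Definition _ := isKernel.Build _ _ _ _ _ (noise_kernel W s)
  measurable_noise_kernel.

Let noise_kernelT x : noise_kernel W s x [set: T] = 1%E.
Proof. by rewrite /noise_kernel /push_measure /= /pushforward preimage_setT probability_setT. Qed.

HB.instance Definition _ := Kernel_isProbability.Build _ _ _ _ _ (noise_kernel W s)
  noise_kernelT.

Definition noise_channel : R.-pker T ~> T := noise_kernel W s.

End NoiseKernel.

Section MutualInfoUpper.
Variables (R : realType) (d : nat).
Local Notation T := (d.-tuple R).
Variables (lam : {measure set T -> \bar R}) (f : T -> R).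
Hypotheses (mf : measurable_fun setT f) (f0 : forall x, 0 <= f x).
Hypothesis f1 : (\int[lam]_x (f x)%:E = 1)%E.
Variables (W : probability T R) (s : R).

Let PXm : probability T R := prob_density mf f0 f1.
Let Pr := (PXm \x W)%E.
Let E := @noise_event R d s.

Let mE A B : measurable A -> measurable B -> measurable (E A B).
Proof. exact: measurable_noise_event. Qed.

Lemma joint_noise A B : measurable A -> measurable B ->
  joint lam f (noise_channel W s) A B = Pr (E A B).
Proof.
move=> mA mB; rewrite /Pr /product_measure1 /=.
rewrite [RHS]integral_prob_density//; last exact: (measurable_fun_xsection W (mE mA mB)).
rewrite [LHS]integral_mkcond; apply: eq_integral => x _.
rewrite patchE; case: ifPn; rewrite ?inE ?notin_setE => Ax.
  by rewrite /= xsection_noise_event// muleC.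
rewrite (_ : xsection _ x = set0) ?measure0 ?mul0e//.
by apply/seteqP; split => // z; rewrite /xsection/= inE => -[].
Qed.

(* Gibbs' inequality with [L] in place of the log-density of the joint law with respect
   to the product of [PX] and [Q]; only domination on rectangles is needed. *)
Lemma channel_mi_le (L : T * T -> R) (Q : set T -> \bar R) :
  Pr.-integrable setT (EFin \o L) ->
  (forall B, 0 <= Q B)%E ->
  (forall n (B : 'I_n -> set T), is_partition B -> (\sum_j Q (B j) <= 1)%E) ->
  (forall A B, measurable A -> measurable B ->
    (\int[Pr]_(w in E A B) (expR (- L w))%:E <= PX lam f A * Q B)%E) ->
  (mutual_info lam f (noise_channel W s) <= (Rintegral Pr setT L)%:E)%E.
Proof.
move=> Lint Q0 Q1 hQ; apply: ge_ereal_sup => _ [m [n [A [B [pA pB ->]]]]].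
have [mA tA cA] := pA; have [mB tB cB] := pB.
have mEij i j : measurable (E (A i) (B j)) by exact: mE.
pose k := noise_channel W s.
pose a i := fine (PX lam f (A i)).
pose b j := fine (joint lam f k setT (B j)).
pose p i j := fine (joint lam f k (A i) (B j)).
have Qfin j : Q (B j) \is a fin_num.
  rewrite ge0_fin_numE//; apply: (@le_lt_trans _ _ 1%E); last exact: ltry.
  by apply: le_trans (Q1 n B pB); rewrite (bigD1 j)//= leeDl// sume_ge0.
have pfin i j : joint lam f k (A i) (B j) \is a fin_num by exact: joint_fin.
have bfin j : joint lam f k setT (B j) \is a fin_num by exact: joint_fin.
have afin i : PX lam f (A i) \is a fin_num by exact: PX_fin.
have p0 i j : 0 <= p i j by exact/fine_ge0/joint_ge0.
have PE i j : Pr (E (A i) (B j)) = (p i j)%:E by rewrite fineK// -joint_noise.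
have pa i : \sum_j p i j = a i.
  apply: EFin_inj; rewrite -sumEFin; under eq_bigr do rewrite fineK//.
  by rewrite fineK// joint_sum_r.
have pb j : \sum_i p i j = b j.
  apply: EFin_inj; rewrite -sumEFin; under eq_bigr do rewrite fineK//.
  by rewrite fineK// joint_sum_l.
have a1 : \sum_i a i = 1.
  apply: EFin_inj; rewrite -sumEFin; under eq_bigr do rewrite fineK//.
  by rewrite (PX_sum mf f0 f1).
have LE i j : Pr.-integrable (E (A i) (B j)) (EFin \o L).
  exact: (integrableS measurableT).
pose I i j := Rintegral Pr (E (A i) (B j)) L.
have term i j : mi_term (p i j) (a i) (b j) <=
    I i j + ((if b j == 0 then 0 else p i j * (fine (Q (B j)) / b j)) - p i j).
  rewrite /mi_term; case: eqP => [pij|/eqP pij].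
    have -> : I i j = 0.
      rewrite /I /Rintegral null_set_integral//; last by rewrite -[LHS]/(Pr _) PE pij.
      by have /integrableP[+ _] := Lint; exact: measurable_funTS.
    by rewrite pij subr0 mul0r; case: ifP => _; rewrite addr0.
  have pp : 0 < p i j by rewrite lt_neqAle eq_sym pij p0.
  have ap : 0 < a i.
    by apply: lt_le_trans pp _; rewrite -pa (bigD1 j)//= lerDl; apply: sumr_ge0.
  have bp : 0 < b j.
    by apply: lt_le_trans pp _; rewrite -pb (bigD1 i)//= lerDl; apply: sumr_ge0.
  (* [1 + t <= expR t] at [t = ln c - L], integrated over the rectangle, gives
     [p * ln c - I <= c * a * Q - p]. *)
  rewrite gt_eqF//; set c := p i j / (a i * b j).
  have c0 : 0 < c by rewrite divr_gt0// mulr_gt0.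
  have mexp : measurable_fun setT (fun w => expR (- L w)).
    have /integrableP[/measurable_EFinP mL _] := Lint.
    apply: measurableT_comp => //; exact: measurableT_comp.
  have hexp := hQ _ _ (mA i) (mB j).
  have expint : Pr.-integrable (E (A i) (B j)) (EFin \o (fun w => expR (- L w))).
    apply/integrableP; split; first by apply/measurable_EFinP; exact: measurable_funTS.
    under eq_integral do rewrite /= ger0_norm ?expR_ge0//.
    by rewrite (le_lt_trans hexp)// -(fineK (afin i)) -(fineK (Qfin j)) -EFinM ltry.
  have expE : Rintegral Pr (E (A i) (B j)) (fun w => expR (- L w)) <= a i * fine (Q (B j)).
    rewrite -lee_fin EFinM !fineK//.
    by have := integrable_fin_num (mEij i j) expint.
  have cstint (v : R) : Pr.-integrable (E (A i) (B j)) (EFin \o cst v).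
    apply/integrableP; split; first exact/measurable_EFinP.
    rewrite [X in (X < _)%E](_ : _ = (\int[Pr]_(x in E (A i) (B j)) cst (`|v|%:E) x)%E)//.
    by rewrite integral_cst// [X in (_ * X)%E](PE i j) -EFinM ltry.
  have cstE v : Rintegral Pr (E (A i) (B j)) (cst v) = v * p i j.
    rewrite Rintegral_cst//; congr (_ * fine _).
    by rewrite joint_noise.
  have : Rintegral Pr (E (A i) (B j)) (fun w => ln c - L w) <=
     Rintegral Pr (E (A i) (B j)) (fun w => c * expR (- L w) - 1).
    apply: le_Rintegral => //.
    - exact: (integrableB (mEij i j) (cstint (ln c)) (LE i j)).
    - exact: (integrableB (mEij i j) (integrableZl (mEij i j) c expint) (cstint 1)).
    - move=> w _; have := expR_ge1Dx (ln c - L w).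
      by rewrite expRD lnK ?posrE//; lra.
  rewrite RintegralB//; last exact: cstint.
  rewrite (RintegralB (mEij i j) _ (cstint 1))//; last exact: (integrableZl (mEij i j) c expint).
  rewrite RintegralZl// !cstE -/(I i j) => h.
  have : c * Rintegral Pr (E (A i) (B j)) (fun w => expR (- L w)) <= c * (a i * fine (Q (B j))).
    by rewrite ler_pM2l.
  rewrite (_ : c * (a i * _) = p i j * (fine (Q (B j)) / b j)); last first.
    by rewrite /c; field; rewrite !gt_eqF.
  lra.
have SI : \sum_i \sum_j I i j = Rintegral Pr setT L.
  pose D (ij : 'I_m * 'I_n) := E (A ij.1) (B ij.2).
  have DT : \big[setU/set0]_(ij <- index_enum ('I_m * 'I_n)%type) D ij = setT.
    apply/seteqP; split => // -[x z] _; have [i Ai] := cA x.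
    have [j Bj] := cB (affine x s z).
    by rewrite -bigcup_seq; exists (i, j) => //=; rewrite mem_index_enum.
  have mL : measurable_fun setT (EFin \o L) by have /integrableP[] := Lint.
  apply: EFin_inj; rewrite /Rintegral (fineK (integrable_fin_num measurableT Lint)).
  rewrite -[X in (\int[_]_(_ in X) _)%E]DT integral_bigsetU_EFin//; last 4 first.
  - by move=> ij; exact: mEij.
  - exact: index_enum_uniq.
  - apply/trivIsetP => -[i j] [i' j'] _ _ ij; apply/seteqP; split => // -[x z] [[/= Ax Bz] [/= Ax' Bz']].
    have [ii|ii] := eqVneq i i'; last first.
      by have := tA _ _ ii => /seteqP[/(_ x) + _]; apply.
    have jj : j != j' by apply: contra_neq ij => ->; rewrite ii.
    by have := tB _ _ jj => /seteqP[/(_ (affine x s z)) + _]; apply.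
  - exact: measurable_funTS.
  rewrite -sumEFin; under eq_bigr do rewrite -sumEFin.
  rewrite pair_big/=; apply: eq_bigr => -[i j] _ /=; rewrite fineK//.
  exact: integrable_fin_num.
rewrite lee_fin; apply: (@le_trans _ _ (\sum_i \sum_j (I i j +
   ((if b j == 0 then 0 else p i j * (fine (Q (B j)) / b j)) - p i j)))).
  by apply: ler_sum => i _; apply: ler_sum => j _; exact: term.
under eq_bigr do rewrite big_split/= sumrB.
(* What is left besides the integral of [L] is at most the total of [Q] minus 1: in each column with
   [b j != 0] the [p i j] add up to [b j], and the other columns contribute 0. *)
rewrite big_split/= sumrB SI gerDl subr_le0.
have -> : \sum_i \sum_j p i j = 1 by rewrite -a1; apply: eq_bigr.
rewrite exchange_big/=; apply: (@le_trans _ _ (\sum_j fine (Q (B j)))).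
  apply: ler_sum => j _; case: eqP => [_|/eqP bj]; first by rewrite big1// fine_ge0.
  by rewrite -mulr_suml pb mulrC divfK.
by rewrite -lee_fin -sumEFin; under eq_bigr do rewrite fineK//; exact: Q1.
Qed.

End MutualInfoUpper.

Section Noise.
Variables (R : realType) (d : nat) (hd : (0 < d)%N).
Local Notation T := (d.-tuple R).
Variables (N : T -> R) (hN : is_norm N) (r : R) (hr : 0 < r).
Variable lam : {measure set T -> \bar R}.
Hypothesis hlam : is_lebesgue lam.
Variable f : T -> R.
Hypotheses (mf : measurable_fun setT f) (f0 : forall x, 0 <= f x).
Hypothesis f1 : (\int[lam]_x (f x)%:E = 1)%E.

Local Notation Z := (norm_const N r lam).
Let p : R := d%:R / r.
Let p0 : 0 < p. Proof. by rewrite divr_gt0// ltr0n. Qed.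
Let Z0 : 0 < Z. Proof. exact: norm_const_gt0. Qed.

Definition noise_density (z : T) : R := exp_norm N r 1 z / Z.

Lemma measurable_noise_density : measurable_fun setT noise_density.
Proof. by apply: measurable_funM => //; exact: measurable_exp_norm. Qed.

Lemma noise_density_ge0 z : 0 <= noise_density z.
Proof. by rewrite divr_ge0// ltW// exp_norm_gt0. Qed.

Lemma integral_noise_densityM (h : T -> \bar R) : measurable_fun setT h ->
  (forall z, 0 <= h z)%E ->
  (\int[lam]_z (h z * (noise_density z)%:E) =
   (Z^-1)%:E * \int[lam]_z (h z * (exp_norm N r 1 z)%:E))%E.
Proof.
move=> mh h0.
have mhe : measurable_fun setT (fun z => h z * (exp_norm N r 1 z)%:E)%E.
  apply: emeasurable_funM => //; apply/measurable_EFinP; exact: measurable_exp_norm.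
rewrite -ge0_integralZl//; last 2 first.
- by move=> z _; rewrite mule_ge0// lee_fin ltW// exp_norm_gt0.
- by rewrite lee_fin invr_ge0 ltW.
by apply: eq_integral => z _; rewrite /noise_density EFinM muleA muleC.
Qed.

Lemma integral_noise_density : (\int[lam]_z (noise_density z)%:E = 1)%E.
Proof.
transitivity (\int[lam]_z (1 * (noise_density z)%:E))%E.
  by apply: eq_integral => z _; rewrite mul1e.
rewrite integral_noise_densityM//.
under eq_integral do rewrite mul1e.
by rewrite integral_exp_norm1// -EFinM mulVf// gt_eqF.
Qed.

Definition noise : probability T R :=
  prob_density measurable_noise_density noise_density_ge0 integral_noise_density.

Lemma integral_noise (h : T -> \bar R) : measurable_fun setT h ->
  (forall z, 0 <= h z)%E ->
  (\int[noise]_z h z = \int[lam]_z (h z * (noise_density z)%:E))%E.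
Proof. exact: integral_prob_density. Qed.

Let mNr : measurable_fun setT (fun z => (N z `^ r)%:E).
Proof. by apply/measurable_EFinP; exact: measurable_norm_pow. Qed.

Lemma noise_moment : (\int[noise]_z (N z `^ r)%:E = p%:E)%E.
Proof.
have Nr0 z : (0 <= (N z `^ r)%:E)%E by rewrite lee_fin powR_ge0.
rewrite integral_noise// integral_noise_densityM//.
rewrite (eq_integral (fun z => (N z `^ r * exp_norm N r 1 z)%:E)) => [|z _]; last by rewrite EFinM.
by rewrite exp_norm_moment// -EFinM -/p mulrC mulfK// gt_eqF.
Qed.

Lemma distortion_noise (s : R) : 0 < s ->
  distortion lam f N r (noise_channel noise s) = (s `^ r * p)%:E.
Proof.
move=> s0; rewrite /distortion.
transitivity (\int[lam]_x ((s `^ r * p)%:E * (f x)%:E))%E; last first.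
  rewrite ge0_integralZl//; last 3 first.
  - exact/measurable_EFinP.
  - by move=> x _; rewrite lee_fin.
  - by rewrite lee_fin mulr_ge0 ?powR_ge0// ltW.
  by rewrite f1 mule1.
apply: eq_integral => x _; rewrite muleC; congr (_ * _)%E.
rewrite /noise_channel/= /noise_kernel.
rewrite (ge0_integral_pushforward (measurable_affine x s)); last 3 first.
- by [].
- exact: measurable_norm_tsub_powr.
- by move=> y _; rewrite lee_fin powR_ge0.
rewrite preimage_setT EFinM -noise_moment -ge0_integralZl//; last 2 first.
- by move=> z _; rewrite lee_fin powR_ge0.
- by rewrite lee_fin powR_ge0.
apply: eq_integral => z _ /=; rewrite -EFinM; congr (_%:E).
rewrite (_ : tsub x (affine x s z) = tscale (- s) z); last first.
  by apply: eq_from_tnth => i; rewrite !tnth_mktuple; ring.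
by rewrite norm_scale// normrN gtr0_norm// powRM ?norm_ge0// ltW.
Qed.

Let PXm : probability T R := prob_density mf f0 f1.

(* The density of the output of [noise_channel noise 1]. *)
Definition output_density (y : T) : \bar R :=
  (\int[PXm]_x (noise_density (tsub y x))%:E)%E.

Let F (w : T * T) : \bar R := (noise_density (tsub w.2 w.1))%:E.

Let mF : measurable_fun setT F.
Proof.
apply/measurable_EFinP; apply: (measurableT_comp measurable_noise_density).
by apply: measurable_tsub; [exact: measurable_snd|exact: measurable_fst].
Qed.

Let F0 w : (0 <= F w)%E. Proof. by rewrite lee_fin noise_density_ge0. Qed.

Lemma measurable_output_density : measurable_fun setT output_density.
Proof. exact: (measurable_fun_fubini_tonelli_G (m1 := PXm) F mF F0). Qed.

Lemma output_density_ge0 y : (0 <= output_density y)%E.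
Proof. by apply: integral_ge0 => x _; rewrite lee_fin noise_density_ge0. Qed.

Lemma integral_output_density : (\int[lam]_y output_density y = 1)%E.
Proof.
have fub := fubini_tonelli (m1 := PXm)
  (m2 := as_sigma_finite (lebesgue_sigma_finite hlam)) F mF F0.
transitivity (\int[PXm]_x \int[lam]_y F (x, y))%E; first exact: esym fub.
transitivity (\int[PXm]_x (cst 1%E x))%E.
  apply: eq_integral => x _; rewrite -integral_noise_density.
  apply: (integral_shift hlam x (g := fun y => (noise_density y)%:E)).
    by apply/measurable_EFinP; exact: measurable_noise_density.
  by move=> y; rewrite lee_fin noise_density_ge0.
by rewrite integral_cst// mul1e; exact: (@probability_setT _ _ _ PXm).
Qed.

End Noise.

(** * Integrals over input and noise, and the output density *)

Section ProductIntegrals.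
Context d1 d2 (X : measurableType d1) (Y : measurableType d2) (R : realType).
Variables (P : probability X R) (Q : probability Y R).

Lemma ge0_integral_prod_fst (h : X -> \bar R) : measurable_fun setT h ->
  (forall x, 0 <= h x)%E ->
  (\int[P \x Q]_w h w.1 = \int[P]_x h x)%E.
Proof.
move=> mh h0; rewrite (fubini_tonelli1 (m2 := Q) (fun w => h w.1))//.
  apply: eq_integral => x _.
  rewrite /fubini_F/= -[LHS]/(\int[Q]_y cst (h x) y)%E integral_cst//.
  by rewrite [X in (_ * X)%E]probability_setT mule1.
exact: measurableT_comp.
Qed.

Lemma ge0_integral_prod_snd (h : Y -> \bar R) : measurable_fun setT h ->
  (forall y, 0 <= h y)%E ->
  (\int[P \x Q]_w h w.2 = \int[Q]_y h y)%E.
Proof.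
move=> mh h0; rewrite (fubini_tonelli1 (m2 := Q) (fun w => h w.2))//.
  rewrite -[LHS]/(\int[P]_x cst (\int[Q]_y h y) x)%E integral_cst//.
  by rewrite [X in (_ * X)%E]probability_setT mule1.
exact: measurableT_comp.
Qed.

Lemma integrable_prod_fst (h : X -> R) :
  P.-integrable setT (EFin \o h) -> (P \x Q)%E.-integrable setT (EFin \o (fun w : X * Y => h w.1)).
Proof.
move=> /integrableP[mh hfin]; apply/integrableP; split.
  exact: measurableT_comp mh measurable_fst.
apply: le_lt_trans hfin.
rewrite (ge0_integral_prod_fst (h := fun x => `|(EFin \o h) x|%E))//.
exact: measurableT_comp.
Qed.

Lemma integrable_prod_snd (h : Y -> R) :
  Q.-integrable setT (EFin \o h) -> (P \x Q)%E.-integrable setT (EFin \o (fun w : X * Y => h w.2)).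
Proof.
move=> /integrableP[mh hfin]; apply/integrableP; split.
  exact: measurableT_comp mh measurable_snd.
apply: le_lt_trans hfin.
rewrite (ge0_integral_prod_snd (h := fun x => `|(EFin \o h) x|%E))//.
exact: measurableT_comp.
Qed.

Lemma Rintegral_prod_fst (h : X -> R) : measurable_fun setT h ->
  Rintegral (P \x Q)%E setT (fun w : X * Y => h w.1) = Rintegral P setT h.
Proof.
move=> mh; have meh : measurable_fun setT (EFin \o h) by exact/measurable_EFinP.
rewrite /Rintegral integralE [in RHS]integralE; congr (fine (_ - _)).
- rewrite -(ge0_integral_prod_fst (measurable_funepos meh))//.
  by apply: eq_integral => w _; rewrite !funeposE.
- rewrite -(ge0_integral_prod_fst (measurable_funeneg meh))//.
  by apply: eq_integral => w _; rewrite !funenegE.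
Qed.

End ProductIntegrals.

Section FloorProb.
Variables (R : realType) (d : nat) (hd : (0 < d)%N).
Local Notation T := (d.-tuple R).
Variables (N : T -> R) (hN : is_norm N) (r : R) (hr : 0 < r).
Variable lam : {measure set T -> \bar R}.
Hypothesis hlam : is_lebesgue lam.
Variable f : T -> R.
Hypotheses (mf : measurable_fun setT f) (f0 : forall x, 0 <= f x).
Hypothesis f1 : (\int[lam]_x (f x)%:E = 1)%E.

Let PXm : probability T R := prob_density mf f0 f1.
Let mlab := @measurable_floor_label R d.

Lemma measurable_label_fun (l : T -> nat) (v : nat -> R) : measurable_label l ->
  measurable_fun setT (fun x => v (l x)).
Proof.
by move=> ml _ Y mY; rewrite setTI; exact: (measurable_label_preimage (v @^-1` Y) ml).
Qed.

Definition floor_cell_prob (x : T) : R := label_prob lam f (@floor_label R d) (floor_label x).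

Local Notation q := floor_cell_prob.

Lemma floor_cell_prob_ge0 x : 0 <= q x. Proof. exact: label_prob_ge0. Qed.

Lemma neg_ln_floor_cell_prob_ge0 x : 0 <= - ln (q x).
Proof. by rewrite oppr_ge0 ln_le0// label_prob_le1. Qed.

Lemma measurable_neg_ln_floor_cell_prob : measurable_fun setT (fun x => - ln (q x)).
Proof. exact: (measurable_label_fun (fun i => - ln (label_prob lam f _ i)) mlab). Qed.

Lemma integral_neg_ln_floor_cell_prob :
  (\int[PXm]_x (- ln (q x))%:E = entropy_floor lam f)%E.
Proof.
have -> : [set: T] = \bigcup_i [set x | floor_label x = i].
  by apply/seteqP; split => // x _; exists (floor_label x).
rewrite ge0_integral_bigcup//=.
- rewrite (entropy_floorE mf f0 f1); apply: eq_eseriesr => i _.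
  rewrite (eq_integral (cst (- ln (label_prob lam f (@floor_label R d) i))%:E)); last first.
    by move=> x; rewrite inE /= /floor_cell_prob => ->.
  rewrite integral_cst; last exact: (mlab i).
  rewrite -[X in (_ * X)%E]/(PX lam f [set x | floor_label x = i]) -(fineK (PX_fin mf f0 f1 (mlab i))).
  by rewrite -EFinM -/(label_prob _ _ _ _) mulNr mulrC.
- by apply/measurable_EFinP; apply: measurable_funTS; exact: measurable_neg_ln_floor_cell_prob.
- by move=> x _; rewrite lee_fin neg_ln_floor_cell_prob_ge0.
- by apply/trivIsetP => i j _ _ /eqP ij; apply/seteqP; split => // x [/= -> /ij].
Qed.

(** Away from a null set [ln (f x)] and [ln (q x)] are genuine logarithms, which the comparison with
    the mixture density requires. *)
Lemma ae_density_floor_cell_prob_gt0 : {ae PXm, forall x, 0 < f x /\ 0 < q x}.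
Proof.
pose A := f @^-1` [set 0].
pose B := (@floor_label R d) @^-1` [set i | label_prob lam f (@floor_label R d) i = 0].
have mA : measurable A by rewrite -[A]setTI; apply: mf => //; exact: measurable_set1.
have mB : measurable B by exact: measurable_label_preimage.
exists (A `|` B); split.
- exact: measurableU.
- have hA : PXm A = 0%E by apply: integral0_eq => x; rewrite /A /= => ->.
  have hB : PXm B = 0%E.
    have -> : B = \bigcup_(i in [set i | label_prob lam f (@floor_label R d) i = 0]) [set x | floor_label x = i].
      by apply/seteqP; split=> [x Px|x [n Pn ln]]; [exists (floor_label x)|rewrite /B /= (_ : floor_label x = n)].
    rewrite measure_bigcup; last 2 first.
    - by move=> i _; exact: (mlab i).
    - by apply/trivIsetP => i j _ _ /eqP ij; apply/seteqP; split => // x [/= -> /ij].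
    rewrite eseries0// => i _; rewrite inE /= /label_prob => h.
    by rewrite -[LHS]/(PX lam f [set x | floor_label x = i]) -(fineK (PX_fin mf f0 f1 (mlab i))) h.
  apply/eqP; rewrite eq_le measure_ge0 andbT.
  apply: le_trans (measureU2 PXm mA mB) _.
  by rewrite [X in (X + _)%E]hA [X in (_ + X)%E]hB adde0.
- move=> x /= h; apply: contrapT => /not_orP[h1 h2]; apply: h; split.
    by rewrite lt_neqAle f0 andbT eq_sym; apply/eqP => fx; apply: h1.
  by rewrite lt_neqAle floor_cell_prob_ge0 andbT eq_sym; apply/eqP => fx; apply: h2.
Qed.

(** Only inputs [x'] in the integer cell of [x] are kept in the integral defining the density. For
    them the noise needed to reach [x + s z] has norm at most [C + N z], uniformly in [s <= 1]. *)
Lemma output_density_lower : exists K : R, forall x z s, 0 < s <= 1 ->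
  ((expR (- K - 2 `^ r * N z `^ r) * q x)%:E <=
   output_density N r mf f0 f1 (affine x s z))%E.
Proof.
have [C C0 hC] := norm_le_coord hN.
exists (2 `^ r * C `^ r + ln (norm_const N r lam)) => x z s /andP[s0 s1].
have Z0 : 0 < norm_const N r lam by exact: norm_const_gt0.
pose A := [set x' : T | floor_label x' = floor_label x].
have mA : measurable A by exact: mlab.
set c := expR _.
apply: (@le_trans _ _ (\int[PXm]_(x' in A) (cst c%:E x'))%E).
  rewrite integral_cst// -[X in (_ * X)%E]/(PX lam f A) EFinM.
  by rewrite /floor_cell_prob /label_prob -/A fineK// (PX_fin mf f0 f1 mA).
have mG : measurable_fun setT (fun x' => (noise_density N r lam (tsub (affine x s z) x'))%:E).
  apply/measurable_EFinP; apply: (measurableT_comp (measurable_noise_density hN r lam)).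
  exact: measurable_tsub.
apply: (@le_trans _ _ (\int[PXm]_(x' in A) (noise_density N r lam (tsub (affine x s z) x'))%:E)%E); last first.
  apply: ge0_subset_integral => // x' _.
  by rewrite lee_fin noise_density_ge0.
apply: ge0_le_integral => //.
- by move=> x' _; rewrite /= lee_fin expR_ge0.
- exact: measurable_funTS.
- move=> x' Ax'; rewrite /= lee_fin /noise_density /exp_norm /c.
  rewrite -[X in _ <= _ / X](lnK (_ : norm_const N r lam \is Num.pos)) ?posrE//.
  rewrite -expRN -expRD ler_expR mul1r.
  suff : N (tsub (affine x s z) x') `^ r <= 2 `^ r * C `^ r + 2 `^ r * N z `^ r by lra.
  have h1 : N (tsub (affine x s z) x') <= C + N z.
    apply: le_trans (norm_sub_triangle hN x _ _) _; rewrite addrC; apply: lerD.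
      rewrite -[leRHS]mulr1; apply: hC => // i; rewrite tnth_mktuple.
      by apply: floor_label_dist; rewrite Ax'.
    rewrite (_ : tsub _ x = tscale s z); last first.
      by apply: eq_from_tnth => i; rewrite !tnth_mktuple; ring.
    by rewrite norm_scale// gtr0_norm// ler_piMl// norm_ge0.
  (* Passing through the maximum gives [(u + v) ^ r <= 2 ^ r * (u ^ r + v ^ r)] for every positive
     [r], convex or not. *)
  apply: (@le_trans _ _ ((2 * Num.max C (N z)) `^ r)).
    apply: ge0_ler_powR; rewrite ?nnegrE ?norm_ge0 ?(ltW hr)//.
      by rewrite mulr_ge0// le_max (ltW C0).
    apply: le_trans h1 _; rewrite mulrDl mul1r; apply: lerD; rewrite le_max lexx ?orbT//.
  rewrite powRM//; last by rewrite le_max (ltW C0).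
  rewrite -mulrDr ler_wpM2l ?powR_ge0//.
  by case: (leP C (N z)) => _; rewrite ?lerDl ?lerDr powR_ge0.
Qed.

End FloorProb.

Section NoiseMutualInfo.
Variables (R : realType) (d : nat) (hd : (0 < d)%N).
Local Notation T := (d.-tuple R).
Variables (N : T -> R) (hN : is_norm N) (r : R) (hr : 0 < r).
Variable lam : {measure set T -> \bar R}.
Hypothesis hlam : is_lebesgue lam.
Variable f : T -> R.
Hypotheses (mf : measurable_fun setT f) (f0 : forall x, 0 <= f x).
Hypothesis f1 : (\int[lam]_x (f x)%:E = 1)%E.

Let PXm : probability T R := prob_density mf f0 f1.
Local Notation W := (noise hd hN hr hlam).
Local Notation Z := (norm_const N r lam).
Let p : R := d%:R / r.
Let Pr := (PXm \x W)%E.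

Lemma integrable_noise_norm :
  Pr.-integrable setT (EFin \o (fun w : T * T => N w.2 `^ r)).
Proof.
apply: (@integrable_prod_snd _ _ _ _ _ PXm W (fun z => N z `^ r)).
apply/integrableP; split; first by apply/measurable_EFinP; exact: measurable_norm_pow.
rewrite (eq_integral (fun z => (N z `^ r)%:E)) => [|z _].
  by rewrite noise_moment ltry.
by rewrite /= ger0_norm// powR_ge0.
Qed.

Lemma Rintegral_noise_norm : Rintegral Pr setT (fun w : T * T => N w.2 `^ r) = p.
Proof.
rewrite /Rintegral (ge0_integral_prod_snd PXm W (h := fun z => (N z `^ r)%:E)).
- by rewrite noise_moment.
- by apply/measurable_EFinP; exact: measurable_norm_pow.
- by move=> z; rewrite lee_fin powR_ge0.
Qed.

Let PrT : Pr setT = 1%E.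
Proof.
have := ge0_integral_prod_fst PXm W (h := cst 1%E) (measurable_cst _) (fun=> lee01).
rewrite -[X in X = _ -> _]/(\int[Pr]_w cst 1 w)%E -[X in _ = X -> _]/(\int[PXm]_w cst 1 w)%E.
by rewrite !integral_cst// !mul1e => h; exact: (etrans h (probability_setT PXm)).
Qed.

Let cstint c : Pr.-integrable setT (EFin \o cst c).
Proof.
apply/integrableP; split; first exact/measurable_EFinP.
rewrite [X in (X < _)%E](_ : _ = (\int[Pr]_x cst (`|c|%:E) x)%E)//.
by rewrite integral_cst// [X in (_ * X)%E]PrT mule1 ltry.
Qed.

(** [H] lies above [- ln q] at the output and [c - N z ^ r] is the logarithm of the conditional
    density of the output, so [L] is above the logarithm of their ratio, as [channel_mi_le]
    demands. *)
Lemma noise_mi_le (q : T -> \bar R) (H : T * T -> R) (s : R) : 0 < s ->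
  measurable_fun setT q -> (forall y, 0 <= q y)%E -> (\int[lam]_y q y <= 1)%E ->
  Pr.-integrable setT (EFin \o H) ->
  {ae PXm, forall x, forall z, ((expR (- H (x, z)))%:E <= q (affine x s z))%E} ->
  (mutual_info lam f (noise_channel W s) <=
   (Rintegral Pr setT H - p - ln Z - d%:R * ln s)%:E)%E.
Proof.
move=> s0 mq q0 q1 Hint Hq.
have Z0 : 0 < Z by exact: norm_const_gt0.
pose c := - ln Z - d%:R * ln s.
pose L (w : T * T) := H w + (c - N w.2 `^ r).
have NNint := integrable_noise_norm.
have cNint : Pr.-integrable setT (EFin \o (fun w : T * T => c - N w.2 `^ r)).
  exact: (integrableB measurableT (cstint c) NNint).
have Lint : Pr.-integrable setT (EFin \o L) by exact: (integrableD measurableT Hint cNint).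
have LE : Rintegral Pr setT L = Rintegral Pr setT H - p - ln Z - d%:R * ln s.
  rewrite RintegralD// (RintegralB measurableT (cstint c))// Rintegral_noise_norm.
  by rewrite Rintegral_cst// [X in fine X]PrT /= /c; ring.
rewrite -LE.
pose Q B := (\int[lam]_(y in B) q y)%E.
apply: (channel_mi_le (Q := Q) Lint).
- by move=> B; apply: integral_ge0.
- move=> n B pB; apply: le_trans q1.
  by rewrite -(integral_partition lam pB).
move=> A B mA mB.
have mE := measurable_noise_event s mA mB.
have mL : measurable_fun setT L by have /integrableP[/measurable_EFinP] := Lint.
have meL : measurable_fun setT (fun w => (expR (- L w))%:E).
  apply/measurable_EFinP; apply: measurableT_comp => //; exact: measurableT_comp.
have me0 w : (0 <= (expR (- L w))%:E)%E by rewrite lee_fin expR_ge0.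
rewrite integral_mkcond fubini_tonelli1; last 2 first.
- exact/(measurable_restrictT _ mE)/measurable_funTS.
- by move=> w; apply: erestrict_ge0.
apply: (@le_trans _ _ (\int[PXm]_(x in A) (cst (Q B) x))%E); last first.
  by rewrite integral_cst// [leLHS]muleC; exact: lexx.
rewrite [leRHS]integral_mkcond.
have mLE : measurable_fun setT ((fun w => (expR (- L w))%:E) \_ (noise_event s A B)).
  exact/(measurable_restrictT _ mE)/measurable_funTS.
have LE0 w : (0 <= ((fun w => (expR (- L w))%:E) \_ (noise_event s A B)) w)%E.
  by apply: erestrict_ge0.
apply: ae_ge0_le_integral => //.
- by move=> x _; apply: integral_ge0.
- exact: (measurable_fun_fubini_tonelli_F (m2 := W) _ mLE LE0).
- by move=> x _; apply: erestrict_ge0 => // y _; apply: integral_ge0.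
- by apply/(measurable_restrictT _ mA)/measurable_funTS; exact: measurable_cst.
apply: filterS Hq => x Hx _.
rewrite /fubini_F [leRHS]patchE; case: ifPn => xA; last first.
  rewrite integral0_eq// => z _; rewrite patchE ifF//; apply/negP.
  by rewrite inE => -[Ax _]; rewrite notin_setE in xA.
have Ax : A x by rewrite inE in xA.
(* The substitution [y = x + s z] turns both sides into integrals in [z]; the Jacobian [s ^+ d]
   cancels against [- d * ln s] in [c]. *)
rewrite /cst /Q [leRHS]integral_mkcond [leRHS](integral_affine hlam x s0); last 2 first.
- exact/(measurable_restrictT _ mB)/measurable_funTS.
- by move=> y; apply: erestrict_ge0.
rewrite integral_noise; last 2 first.
- exact: measurable_funTS (measurableT_comp mLE (measurable_pair1 x)).
- by move=> z; exact: LE0.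
have mqB : measurable_fun setT (q \_ B).
  exact/(measurable_restrictT _ mB)/measurable_funTS.
have qB0 y : (0 <= (q \_ B) y)%E by apply: erestrict_ge0.
have mqBx : measurable_fun setT (fun z => (q \_ B) (affine x s z)).
  exact: measurableT_comp mqB (measurable_affine x s).
rewrite -ge0_integralZl//; last by rewrite lee_fin exprn_ge0// ltW.
apply: ge0_le_integral => //.
- move=> z _; apply: mule_ge0; first exact: LE0.
  by rewrite lee_fin noise_density_ge0.
- apply: emeasurable_funM.
    exact: measurable_funTS (measurableT_comp mLE (measurable_pair1 x)).
  by apply/measurable_EFinP; exact: measurable_noise_density.
- by apply: measurable_funeM.
move=> z _; rewrite patchE; case: ifPn => [|_]; last first.
  by rewrite mul0e mule_ge0// lee_fin exprn_ge0// ltW.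
rewrite inE => -[_ Bz]; rewrite patchE ifT; last by rewrite inE.
rewrite (_ : (_ * _)%E = ((s ^+ d)%:E * (expR (- H (x, z)))%:E)%E).
  by apply: lee_pmul => //; rewrite lee_fin ?expR_ge0// exprn_ge0// ltW.
rewrite -!EFinM; congr (_%:E); rewrite /noise_density /exp_norm.
rewrite -[X in _ * (_ / X)](lnK (_ : Z \is Num.pos)) ?posrE// -expRN.
have -> : s ^+ d = expR (d%:R * ln s) by rewrite -[s in LHS]lnK ?posrE// -expRM_natl.
by rewrite -!expRD /L /c /=; congr expR; ring.
Qed.
End NoiseMutualInfo.

(** * Achievability *)

Section SwitchConvergence.
Context disp (X : measurableType disp) (R : realType).
Variables (mu : {measure set X -> \bar R}) (a G B : X -> R).
Hypotheses (ma : measurable_fun setT a) (mG : measurable_fun setT G).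
Hypotheses (aB : forall w, `|a w| <= B w) (GB : forall w, `|G w| <= B w).
Hypothesis Bint : mu.-integrable setT (EFin \o B).

Definition switch (C : set X) (w : X) : R := if w \in C then a w else G w.

Lemma measurable_switch C : measurable C -> measurable_fun setT (switch C).
Proof.
move=> mC; apply: measurable_fun_ifT => //.
apply: (measurable_fun_bool true); rewrite setTI.
rewrite (_ : _ @^-1` _ = C)//.
by apply/seteqP; split => w /=; [move/set_mem|move/mem_set].
Qed.

Lemma integrable_switch C : measurable C -> mu.-integrable setT (EFin \o switch C).
Proof.
move=> mC; apply: le_integrable Bint => //.
  by apply/measurable_EFinP; exact: measurable_switch.
move=> w _; rewrite /= lee_fin; apply: le_trans (ler_norm _).
by rewrite /switch; case: ifP.
Qed.

(** At each point the integrand is eventually constant in [s], since only membership in [C s]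
    varies; [B] dominates both branches. *)
Lemma cvg_Rintegral_switch (C : R -> set X) (C0 : set X) :
  (forall s, measurable (C s)) -> measurable C0 ->
  (forall w, \forall s \near 0^'+, (w \in C s) = (w \in C0)) ->
  Rintegral mu setT (switch (C s)) @[s --> 0^'+] --> Rintegral mu setT (switch C0).
Proof.
move=> mC mC0 hC; apply/cvg_at_rightP => u [u0 ucvg].
apply: fine_cvg; rewrite fineK; last first.
  by apply: integrable_fin_num => //; exact: integrable_switch.
apply: (@dominated_cvg _ _ _ mu setT measurableT (fun n => EFin \o switch (C (u n)))
  (EFin \o switch C0) (EFin \o B)) => //.
- by move=> n; apply/measurable_EFinP; exact: measurable_switch.
- move=> w _; apply: cvg_near_cst.
  have h : \forall n \near \oo, 0 < u n -> (w \in C (u n)) = (w \in C0) := ucvg _ (hC w).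
  by apply: filterS h => n /(_ (u0 n)) E; rewrite /= /switch E.
- move=> n w _; rewrite lee_fin /switch; by case: ifP.
Qed.

End SwitchConvergence.

Section LnDensity.
Variables (R : realType) (d : nat).
Local Notation T := (d.-tuple R).
Variables (lam : {measure set T -> \bar R}) (f : T -> R).
Hypotheses (mf : measurable_fun setT f) (f0 : forall x, 0 <= f x).
Hypothesis f1 : (\int[lam]_x (f x)%:E = 1)%E.
Hypothesis fint : lam.-integrable setT (fun x => (f x * ln (f x))%:E).

Let PXm : probability T R := prob_density mf f0 f1.

Lemma measurable_ln_density : measurable_fun setT (fun x => ln (f x)).
Proof. exact: measurableT_comp. Qed.

(** Homogeneity moves the density inside [u]. Applied to the absolute value and to the positive and
    negative parts, it carries integrability and the integral of [ln f] over from [lam]. *)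
Let part (u : R -> R) : measurable_fun setT u -> (forall t, 0 <= u t) ->
  (forall t a, 0 <= a -> u (a * t) = a * u t) ->
  (\int[PXm]_x (u (ln (f x)))%:E = \int[lam]_x (u (f x * ln (f x)))%:E)%E.
Proof.
move=> mu u0 uM; rewrite integral_prob_density; last first.
- by move=> x; rewrite lee_fin.
- by apply/measurable_EFinP; apply: measurableT_comp => //; exact: measurable_ln_density.
- by apply: eq_integral => x _; rewrite -EFinM uM// mulrC.
Qed.

Lemma integrable_ln_density : PXm.-integrable setT (EFin \o (fun x => ln (f x))).
Proof.
apply/integrableP; split; first by apply/measurable_EFinP; exact: measurable_ln_density.
have /integrableP[_] := fint; congr (_ < _)%E.
apply/esym/(@part (fun t => `|t|)) => //.
by move=> t a a0; rewrite normrM ger0_norm.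
Qed.

Lemma Rintegral_ln_density : Rintegral PXm setT (fun x => ln (f x)) = - diff_entropy lam f.
Proof.
rewrite /diff_entropy opprK /Rintegral integralE [in RHS]integralE.
congr (fine (_ - _)).
- transitivity (\int[PXm]_x (Num.max (ln (f x)) 0)%:E)%E.
    by apply: eq_integral => x _; rewrite funeposE EFin_max.
  rewrite (part (u := fun t => Num.max t 0)).
  + by apply: eq_integral => x _; rewrite funeposE EFin_max.
  + exact: measurable_maxr.
  + by move=> t; rewrite le_max lexx orbT.
  + by move=> t a a0; rewrite maxr_pMr// mulr0.
- transitivity (\int[PXm]_x (Num.max (- ln (f x)) 0)%:E)%E.
    by apply: eq_integral => x _; rewrite funenegE -EFinN EFin_max.
  rewrite (part (u := fun t => Num.max (- t) 0)).
  + by apply: eq_integral => x _; rewrite funenegE -EFinN EFin_max.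
  + apply: measurable_maxr => //; exact: measurableT_comp.
  + by move=> t; rewrite le_max lexx orbT.
  + by move=> t a a0; rewrite maxr_pMr// mulr0 mulrN.
Qed.

End LnDensity.

Section Mixture.
Variables (R : realType) (d : nat).
Local Notation T := (d.-tuple R).
Variables (N : T -> R) (hN : is_norm N).
Variable lam : {measure set T -> \bar R}.
Hypothesis hlam : is_lebesgue lam.

Lemma label_open_cover (l : T -> nat) (del : nat -> R) : measurable_label l ->
  (forall x y, l x = l y -> N (tsub x y) <= 1) -> (forall i, 0 < del i) ->
  exists U : nat -> set T, forall i, [/\ sup_open (U i), [set x | l x = i] `<=` U i &
    (lam (U i) <= lam [set x | l x = i] + (del i)%:E)%E].
Proof.
move=> ml hl del0.
suff h i : exists U, [/\ sup_open U, [set x | l x = i] `<=` U &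
    (lam U <= lam [set x | l x = i] + (del i)%:E)%E].
  by have [U hU] := choice h; exists U.
have [[c lc]|h] := pselect (exists c, l c = i); last first.
  exists set0; split=> //; first by move=> x lx; apply: h; exists x.
  by rewrite measure0 adde_ge0// lee_fin ltW.
have oQ : sup_open [set x | N (tsub x c) < 2] := @sup_open_norm_lt _ _ _ hN c 2.
apply: (lebesgue_outer_regular (ml i) oQ) => //.
  move=> x lx; rewrite /= (@le_lt_trans _ _ 1) ?ltr1n//.
  by apply: hl; rewrite lx lc.
have mQ := sup_open_measurable oQ.
have := lebesgue_affine hlam c ltr01 mQ; rewrite expr1n mul1e => <-.
apply: (@le_lt_trans _ _ (lam [set x | N x <= 2])).
  apply: le_measure; rewrite ?inE.
  - by rewrite -[X in measurable X]setTI; exact: measurable_affine.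
  - exact: measurable_norm_le.
  - move=> z /=; rewrite (_ : tsub _ c = z); first exact: ltW.
    by apply: eq_from_tnth => j; rewrite !tnth_mktuple; ring.
rewrite norm_ball_scale//.
have := unit_ball_lty hN hlam.
by rewrite -ge0_fin_numE// => /fineK <-; rewrite -EFinM ltry.
Qed.

Variable f : T -> R.
Hypotheses (mf : measurable_fun setT f) (f0 : forall x, 0 <= f x).
Hypothesis f1 : (\int[lam]_x (f x)%:E = 1)%E.

(** The [U i] may overlap, and the values are then added. This preserves the pointwise lower bound
    [v i] on [U i], and the total mass is still a plain sum. *)
Definition step_density (U : nat -> set T) (v : nat -> R) (m : nat) (y : T) : \bar R :=
  (\sum_(i < m) (v i)%:E * (\1_(U i) y)%:E)%E.

Lemma integral_step_density U v m : (forall i, measurable (U i)) -> (forall i, 0 <= v i) ->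
  (\int[lam]_y step_density U v m y = \sum_(i < m) (v i)%:E * lam (U i))%E.
Proof.
move=> mU v0; rewrite ge0_integral_sum//.
- apply: eq_bigr => i _; rewrite ge0_integralZl//.
  + by rewrite integral_indic// setIT.
  + exact/measurable_EFinP.
  + by rewrite lee_fin.
- by move=> i; apply: measurable_funeM; exact/measurable_EFinP.
- by move=> i y _; rewrite mule_ge0// lee_fin.
Qed.

Lemma step_density_le1 (l : T -> nat) v m : measurable_label l -> (forall i, 0 <= v i) ->
  (forall x, v (l x) <= f x) ->
  (\sum_(i < m) (v i)%:E * lam [set x | l x = i] <= 1)%E.
Proof.
move=> ml v0 vf; rewrite -(integral_step_density m (U := fun i => [set x | l x = i]))// -f1.
apply: ge0_le_integral => //.
- by move=> x _; apply: sume_ge0 => i _; rewrite mule_ge0// lee_fin.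
- apply: emeasurable_sum => i; apply: measurable_funeM; exact/measurable_EFinP.
- exact/measurable_EFinP.
- move=> x _; have [lm|lm] := ltnP (l x) m.
    rewrite /step_density (bigD1 (Ordinal lm))//= big1.
      by rewrite indicE mem_set// mule1 adde0 lee_fin.
    move=> i /eqP il; rewrite indicE memNset ?mule0// => /= li.
    by apply: il; apply: val_inj.
  rewrite /step_density big1 ?lee_fin// => i _; rewrite indicE memNset ?mule0// => /= li.
  by move: lm; rewrite li leqNgt ltn_ord.
Qed.

Lemma step_density_ge (U : nat -> set T) (v : nat -> R) m y (i : 'I_m) : (forall i, 0 <= v i) -> U i y ->
  ((v i)%:E <= step_density U v m y)%E.
Proof.
move=> v0 Uy; rewrite /step_density (bigD1 i)//= indicE mem_set// mule1 leeDl//.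
by apply: sume_ge0 => j _; rewrite mule_ge0// lee_fin.
Qed.

Lemma step_density_cover (l : T -> nat) (v : nat -> R) m (eps : R) : measurable_label l ->
  (forall x y, l x = l y -> N (tsub x y) <= 1) -> (forall i, 0 <= v i) ->
  (forall x, v (l x) <= f x) -> 0 < eps ->
  exists U : nat -> set T, [/\ forall i, sup_open (U i),
    forall i, [set x | l x = i] `<=` U i &
    (\int[lam]_y step_density U v m y <= (1 + eps)%:E)%E].
Proof.
move=> ml hl v0 vf eps0.
(* Makes [v i * del i <= eps / (m + 1)], so the [m] enlargements add at most [eps]; the added ones
   avoid zero denominators. *)
pose del i := eps / m.+1%:R / (v i + 1).
have v1 i : 0 < v i + 1 by rewrite ltr_wpDl.
have del0 i : 0 < del i by rewrite !divr_gt0.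
have [U hU] := label_open_cover ml hl del0.
exists U; split; [by move=> i; have [] := hU i|by move=> i; have [] := hU i|].
rewrite integral_step_density//; last by move=> i; apply: sup_open_measurable; have [] := hU i.
apply: (@le_trans _ _ (\sum_(i < m) ((v i)%:E * lam [set x | l x = i] + (eps / m.+1%:R)%:E))%E).
  apply: lee_sum => i _; have [_ _ hi] := hU i.
  apply: le_trans (lee_wpmul2l _ hi) _; first by rewrite lee_fin.
  rewrite ge0_muleDr//; last by rewrite lee_fin ltW.
  rewrite leeD2l// -EFinM lee_fin /del mulrCA ler_piMr ?divr_ge0 ?(ltW eps0)//.
  by rewrite ler_pdivrMr// mul1r lerDl.
rewrite big_split/= EFinD; apply: leeD; first exact: step_density_le1.
rewrite sumEFin lee_fin sumr_const card_ord -[leLHS]mulr_natr -mulrA ler_piMr ?(ltW eps0)//.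
by rewrite mulrC ler_pdivrMr// mul1r ler_nat.
Qed.

End Mixture.

Section Achievability.
Variables (R : realType) (d : nat) (hd : (0 < d)%N).
Local Notation T := (d.-tuple R).
Variables (N : T -> R) (hN : is_norm N) (r : R) (hr : 0 < r).
Variable lam : {measure set T -> \bar R}.
Hypothesis hlam : is_lebesgue lam.
Variable f : T -> R.
Hypotheses (mf : measurable_fun setT f) (f0 : forall x, 0 <= f x).
Hypothesis f1 : (\int[lam]_x (f x)%:E = 1)%E.
Hypothesis fint : lam.-integrable setT (fun x => (f x * ln (f x))%:E).
Hypothesis Hfin : (entropy_floor lam f < +oo)%E.

Let PXm : probability T R := prob_density mf f0 f1.
Local Notation W := (noise hd hN hr hlam).
Local Notation Z := (norm_const N r lam).
Let p : R := d%:R / r.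
Let Pr := (PXm \x W)%E.
Local Notation q0 := (floor_cell_prob lam f).

Definition label_event (l : T -> nat) (U : nat -> set T) (m : nat) (s : R) : set (T * T) :=
  \bigcup_(i in `I_m) noise_event s [set x | l x = i] (U i).

Lemma measurable_label_event l U m s : measurable_label l ->
  (forall i, measurable (U i)) -> measurable (label_event l U m s).
Proof.
move=> ml mU; apply: bigcup_measurable => i _.
by apply: measurable_noise_event => //; exact: ml.
Qed.

(** If the input has label below [m], it is an interior point of its [U i], so [x + s z] stays there
    once [s] is small; if not, the event fails for every [s]. *)
Lemma label_event_near l U m w :
  (forall i, sup_open (U i)) -> (forall i, [set x | l x = i] `<=` U i) ->
  \forall s \near 0^'+, (w \in label_event l U m s) = (w \in [set w' : T * T | (l w'.1 < m)%N]).
Proof.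
move=> oU AU; have [lm|lm] := ltnP (l w.1) m; last first.
  near=> s; rewrite [RHS]memNset; last by apply/negP; rewrite -leqNgt.
  apply/negbTE; rewrite notin_setE => -[i /= im [/= li _]].
  by move: lm; rewrite li leqNgt im.
have [e ee hU] := oU _ _ (AU _ w.1 erefl).
pose M := \sum_i `|tnth w.2 i| + 1.
have M0 : 0 < M by rewrite ltr_wpDl// sumr_ge0.
near=> s; rewrite [RHS]mem_set//; apply/mem_set; exists (l w.1) => //; split => //.
apply: hU => i; rewrite !tnth_mktuple.
have s0 : 0 < s by [].
rewrite addrAC subrr add0r normrM gtr0_norm//.
have : s < e / M by near: s; apply: nbhs_right_lt; rewrite divr_gt0.
rewrite ltr_pdivlMr//; apply: le_lt_trans; rewrite ler_wpM2l ?(ltW s0)//.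
by rewrite /M (bigD1 i)//= -addrA lerDl addr_ge0// sumr_ge0.
Unshelve. all: by end_near.
Qed.

Let c2 : R := 2 `^ r.

(** The first three terms bound minus the logarithm of the output density; the last pays for
    replacing [- ln f] by that bound where the step function is absent. *)
Definition tail_bound (K : R) (w : T * T) : R :=
  K + c2 * N w.2 `^ r - ln (q0 w.1) + `|ln (f w.1)|.

Let int_fst (h : T -> R) : PXm.-integrable setT (EFin \o h) ->
  Pr.-integrable setT (EFin \o (fun w : T * T => h w.1)).
Proof. exact: integrable_prod_fst. Qed.

Let int_lnf : Pr.-integrable setT (EFin \o (fun w : T * T => ln (f w.1))).
Proof. by apply: (int_fst (h := fun x => ln (f x))); exact: integrable_ln_density. Qed.

Let int_q0 : Pr.-integrable setT (EFin \o (fun w : T * T => - ln (q0 w.1))).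
Proof.
apply: (int_fst (h := fun x => - ln (q0 x))); apply/integrableP; split.
  by apply/measurable_EFinP; exact: measurable_neg_ln_floor_cell_prob.
rewrite (eq_integral (fun x => (- ln (q0 x))%:E)) => [|x _].
  by rewrite integral_neg_ln_floor_cell_prob.
by rewrite /= ger0_norm// neg_ln_floor_cell_prob_ge0.
Qed.

Let int_cst c : Pr.-integrable setT (EFin \o (fun _ : T * T => c)).
Proof.
apply: (int_fst (h := fun=> c)).
exact: (finite_measure_integrable_cst PXm c).
Qed.

Lemma integrable_tail_bound K : Pr.-integrable setT (EFin \o tail_bound K).
Proof.
apply: (integrableD measurableT (f := EFin \o _) (g := EFin \o _)).
  apply: (integrableD measurableT (f := EFin \o _) (g := EFin \o _)) => //.
  apply: (integrableD measurableT (f := EFin \o _) (g := EFin \o _)) => //.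
  exact: (integrableZl measurableT c2 (integrable_noise_norm hd hN hr hlam mf f0 f1)).
exact: (integrable_abse int_lnf).
Qed.

Lemma tail_bound_ge0 K w : 0 <= K -> 0 <= tail_bound K w.
Proof.
move=> K0; rewrite !addr_ge0//; last exact: neg_ln_floor_cell_prob_ge0.
by rewrite mulr_ge0 ?powR_ge0.
Qed.

(** The measure of density [tail_bound] is pushed to the input coordinate, where
    [measure_label_tail] applies. *)
Lemma tail_bound_small (l : T -> nat) (K e : R) : measurable_label l -> 0 <= K -> 0 < e ->
  exists m, (\int[Pr]_(w in [set w | (m <= l w.1)%N]) (tail_bound K w)%:E < e%:E)%E.
Proof.
move=> ml K0 e0; have Tint := integrable_tail_bound K.
have mT : measurable_fun setT (tail_bound K) by have /integrableP[/measurable_EFinP] := Tint.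
have T0 w : 0 <= tail_bound K w by exact: tail_bound_ge0.
pose mu := push_measure (density Pr mT T0) (@measurable_fst _ _ T T).
have mufin : (mu setT < +oo)%E.
  have /integrableP[_] := Tint; congr (_ < _)%E.
  rewrite /mu /push_measure /= /pushforward preimage_setT /density.
  by apply: eq_integral => w _; rewrite /= ger0_norm.
by have [m hm] := measure_label_tail ml mufin e0; exists m; exact: (hm m (leqnn m)).
Qed.

Lemma noise_channel_achieves (e0 : R) : 0 < e0 ->
  \forall s \near 0^'+, (mutual_info lam f (noise_channel W s) <=
    (diff_entropy lam f - p - ln Z - d%:R * ln s + e0)%:E)%E.
Proof.
(* One [e] for the weight [ka], one for the width of the levels, one for the labels from [m] on, and
   one for the limit in [s]. *)
move=> e00; pose e := e0 / 4; have e_gt0 : 0 < e by rewrite divr_gt0.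
pose ka := expR (- e); have ka0 : 0 < ka by exact: expR_gt0.
have ka1 : ka < 1 by rewrite expR_lt1 oppr_lt0.
(* so that [ka * (1 + eps) + eps = 1] *)
pose eps := (1 - ka) / (1 + ka).
have eps0 : 0 < eps by rewrite divr_gt0 ?subr_gt0 ?addr_gt0.
have [K hK] := output_density_lower hd hN hr hlam mf f0 f1.
have [l [gam [z [ml hl hg hz]]]] := level_label hN mf ltr01 e_gt0.
(* [K - ln eps] bounds minus the logarithm of [eps * g]; its absolute value keeps the majorant
   nonnegative. *)
pose K1 := `|K - ln eps|.
have K10 : 0 <= K1 by exact: normr_ge0.
have [m hm] := tail_bound_small ml K10 e_gt0.
(* Lowering [gam] by the level width puts [v] below [f]. On the zero set the convention [ln 0 = 0]
   would make the exponential positive, hence the flag. *)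
pose v i := if z i then 0 else expR (gam i - e).
have v0 i : 0 <= v i by rewrite /v; case: ifP; rewrite ?expR_ge0.
have vf x : v (l x) <= f x.
  rewrite /v hz; case: eqP => [->//|/eqP fx].
  have fx0 : 0 < f x by rewrite lt_neqAle eq_sym fx f0.
  rewrite -[leRHS]lnK ?posrE// ler_expR lerBlDr.
  by have /andP[] := hg x.
have [U [oU AU hU]] := step_density_cover hN hlam mf f0 f1 m ml hl v0 vf eps0.
have mU i : measurable (U i) by exact: sup_open_measurable.
pose g := output_density N r mf f0 f1.
have g0 y : (0 <= g y)%E by exact: output_density_ge0.
have mg : measurable_fun setT g by exact: measurable_output_density.
pose q y := (ka%:E * step_density U v m y + eps%:E * g y)%E.
have st0 y : (0 <= step_density U v m y)%E.
  by apply: sume_ge0 => i _; rewrite mule_ge0// lee_fin.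
have mst : measurable_fun setT (step_density U v m).
  by apply: emeasurable_sum => i; apply: measurable_funeM; exact/measurable_EFinP.
have mq : measurable_fun setT q by apply: emeasurable_funD; exact: measurable_funeM.
have q_ge0 y : (0 <= q y)%E by rewrite adde_ge0// mule_ge0// lee_fin ltW.
have q1 : (\int[lam]_y q y <= 1)%E.
  rewrite ge0_integralD//; last 4 first.
  - by move=> y _; rewrite mule_ge0// lee_fin ltW.
  - exact: measurable_funeM.
  - by move=> y _; rewrite mule_ge0// lee_fin ltW.
  - exact: measurable_funeM.
  rewrite !ge0_integralZl//; last 2 first.
  - by rewrite lee_fin ltW.
  - by rewrite lee_fin ltW.
  rewrite integral_output_density// mule1.
  apply: (@le_trans _ _ (ka%:E * (1 + eps)%:E + eps%:E)%E).
    by rewrite leeD2r// lee_wpmul2l// lee_fin ltW.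
  rewrite -EFinM -EFinD lee_fin le_eqVlt; apply/orP; left; apply/eqP.
  by rewrite /eps; field; rewrite gt_eqF// addr_gt0.
(* For labels of inputs with positive density this is [- ln (ka * v i)]; [G] plays the same part for
   [eps] times the lower bound on the output density, and [B] dominates both. *)
pose a (w : T * T) := 2 * e - gam (l w.1).
pose G (w : T * T) := K - ln eps + c2 * N w.2 `^ r - ln (q0 w.1).
pose B (w : T * T) := tail_bound K1 w + 2 * e.
pose C s := label_event l U m s.
pose C0 := [set w : T * T | (l w.1 < m)%N].
have mC s : measurable (C s) by exact: measurable_label_event.
have mC0 : measurable C0.
  rewrite -[C0]setTI; apply: (measurable_fst _ [set x | (l x < m)%N]) => //.
  exact: (measurable_label_preimage [set i | (i < m)%N] ml).
have mfst (h : T -> R) : measurable_fun setT h -> measurable_fun setT (fun w : T * T => h w.1).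
  by move=> mh; exact: (measurableT_comp mh measurable_fst).
have ma : measurable_fun setT a.
  exact: (mfst _ (measurable_label_fun (fun i => 2 * e - gam i) ml)).
have mG : measurable_fun setT G.
  apply: measurable_funD; last by apply: (mfst (fun x => - ln (q0 x))); exact: measurable_neg_ln_floor_cell_prob.
  apply: measurable_funD => //; apply: measurable_funM => //.
  exact: (measurableT_comp (measurable_norm_pow hN r) measurable_snd).
have lnq x : 0 <= - ln (q0 x) by exact: neg_ln_floor_cell_prob_ge0.
have NN0 (w : T * T) : 0 <= c2 * N w.2 `^ r by rewrite mulr_ge0 ?powR_ge0.
have aB w : `|a w| <= B w.
  have /andP[h1 h2] := hg w.1; rewrite /B /tail_bound /a.
  have := NN0 w; have := lnq w.1; move: h1 h2 K10 (ler_norm (ln (f w.1))) (ler_norm (- ln (f w.1))).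
  rewrite normrN => h1 h2 h3 h4 h5 h6 h7; rewrite ler_norml; apply/andP; split; lra.
have GB w : `|G w| <= B w.
  rewrite /B /tail_bound /G.
  have := NN0 w; have := lnq w.1; move: (ler_norm (K - ln eps)) (ler_norm (- (K - ln eps))).
  rewrite normrN -/K1 => h3 h4 h5 h6; have := normr_ge0 (ln (f w.1)).
  by move=> h7; rewrite ler_norml; apply/andP; split; lra.
have Bint : Pr.-integrable setT (EFin \o B).
  exact: (integrableD measurableT (integrable_tail_bound K1) (int_cst (2 * e))).
have Sint D : measurable D -> Pr.-integrable setT (EFin \o switch a G D).
  by move=> mD; exact: (integrable_switch ma mG aB GB Bint mD).
have cvgS := cvg_Rintegral_switch ma mG aB GB Bint mC mC0
  (fun w => label_event_near m w oU AU).
(* The integrand is at most [2 * e - ln f], plus [tail_bound K1] where the label is at least [m];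
   the integral of the latter is below [e] by the choice of [m]. *)
have limit : Rintegral Pr setT (switch a G C0) <= diff_entropy lam f + 3 * e.
  pose D := [set w : T * T | (m <= l w.1)%N].
  have mD : measurable D.
    rewrite -[D]setTI; apply: (measurable_fst _ [set x | (m <= l x)%N]) => //.
    exact: (measurable_label_preimage [set i | (m <= i)%N] ml).
  have Tint := integrable_tail_bound K1.
  have TD : Rintegral Pr D (tail_bound K1) < e.
    have := hm; rewrite -[X in (X < _)%E -> _]fineK ?lte_fin//.
    by apply: integrable_fin_num => //; exact: (integrableS measurableT).
  have TDint : Pr.-integrable setT (EFin \o (tail_bound K1 \_ D)).
    rewrite -restrict_EFin; apply/(integrable_mkcond _ mD).
    exact: (integrableS measurableT).
  have lnint : Pr.-integrable setT (EFin \o (fun w : T * T => 2 * e - ln (f w.1))).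
    exact: (integrableB measurableT (int_cst (2 * e)) int_lnf).
  apply: (@le_trans _ _ (Rintegral Pr setT
    (fun w => (2 * e - ln (f w.1)) + (tail_bound K1 \_ D) w))).
    apply: le_Rintegral => //; first exact: Sint.
      exact: (integrableD measurableT lnint TDint).
    move=> w _; rewrite /switch; case: ifPn => wC0.
      rewrite patchE memNset; last by move: wC0 => /set_mem; rewrite /C0/= ltnNge => /negP.
      rewrite addr0 /a; have /andP[+ _] := hg w.1; lra.
    have wD : w \in D by apply/mem_set; move: wC0; rewrite notin_setE /C0/= => /negP; rewrite -leqNgt.
    rewrite patchE wD /G /tail_bound.
    have := ler_norm (K - ln eps); have := ler_norm (ln (f w.1)); rewrite -/K1; lra.
  rewrite RintegralD// (RintegralB measurableT (int_cst (2 * e)))//.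
  rewrite -Rintegral_mkcond (Rintegral_prod_fst PXm W (h := fun x => ln (f x))); last first.
    exact: measurable_ln_density.
  rewrite (Rintegral_ln_density mf f0 f1) (Rintegral_prod_fst PXm W (h := fun=> 2 * e))//.
  rewrite Rintegral_cst// [X in fine X](probability_setT PXm) /=; lra.
have near1 : \forall s \near 0^'+, Rintegral Pr setT (switch a G (C s)) < diff_entropy lam f + 4 * e.
  apply: (cvgr_lt _ cvgS); apply: le_lt_trans limit _; lra.
have dom s x y : 0 < s -> s <= 1 -> 0 < f x -> 0 < q0 x ->
    ((expR (- switch a G (C s) (x, y)))%:E <= q (affine x s y))%E.
  move=> s0 s1 fx0 qx0; rewrite /switch; case: ifPn.
    move=> /set_mem[i im [/= li Uy]].
    apply: (@le_trans _ _ (ka%:E * (v i)%:E)%E).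
      by rewrite -EFinM lee_fin /v -li hz gt_eqF// /ka -expRD ler_expR /a /=; lra.
    apply: (@le_trans _ _ (ka%:E * step_density U v m (affine x s y))%E).
      rewrite lee_wpmul2l ?lee_fin ?(ltW ka0)//.
      exact: (step_density_ge (i := Ordinal im)).
    by rewrite leeDl// mule_ge0// lee_fin ltW.
  move=> _; apply: (@le_trans _ _ (eps%:E * g (affine x s y))%E); last first.
    by rewrite leeDr// mule_ge0// lee_fin ltW.
  apply: (@le_trans _ _ (eps%:E * (expR (- K - c2 * N y `^ r) * q0 x)%:E)%E); last first.
    by rewrite lee_wpmul2l ?lee_fin ?(ltW eps0)//; apply: hK; rewrite s0.
  rewrite -EFinM lee_fin -[X in X * _](lnK (_ : eps \is Num.pos)) ?posrE//.
  rewrite -[X in _ * (_ * X)](lnK (_ : q0 x \is Num.pos)) ?posrE//.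
  by rewrite -!expRD ler_expR /G /=; lra.
have fin Y L : Y < diff_entropy lam f + 4 * e ->
    Y - p - ln Z - L <= diff_entropy lam f - p - ln Z - L + e0.
  by rewrite /e; lra.
near=> s.
have s0 : 0 < s by [].
have s1 : s <= 1 by near: s; apply: nbhs_right_le.
apply: le_trans (noise_mi_le (q := q) s0 mq q_ge0 q1 (Sint _ (mC s)) _) _; last first.
  by rewrite lee_fin; apply: fin; near: s.
by apply: filterS (ae_density_floor_cell_prob_gt0 mf f0 f1) => x [fx0 qx0] y; exact: dom.
Unshelve. all: by end_near.
Qed.

End Achievability.

(** * The limit of small distortion *)

Section Convergence.
Variables (R : realType) (d : nat) (hd : (0 < d)%N).
Local Notation T := (d.-tuple R).
Variables (N : T -> R) (hN : is_norm N) (r : R) (hr : 0 < r).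
Variable lam : {measure set T -> \bar R}.
Hypothesis hlam : is_lebesgue lam.
Variable f : T -> R.
Hypotheses (mf : measurable_fun setT f) (f0 : forall x, 0 <= f x).
Hypothesis f1 : (\int[lam]_x (f x)%:E = 1)%E.
Hypothesis fint : lam.-integrable setT (fun x => (f x * ln (f x))%:E).
Hypothesis Hfin : (entropy_floor lam f < +oo)%E.

Lemma RD_sub_RSLB_le (e : R) : 0 < e ->
  \forall D \near 0^'+, (0 <= RD lam f N r D - (RSLB lam f N r D)%:E <= e%:E)%E.
Proof.
move=> e0; pose p : R := d%:R / r.
have p0 : 0 < p by rewrite divr_gt0// ltr0n.
have [t /= t0 ht] := noise_channel_achieves hd hN hr hlam mf f0 f1 fint Hfin e0.
near=> D.
have D0 : 0 < D by [].
(* The noise level whose distortion [s ^ r * p] is exactly [D]; then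
   [- d * ln s = p * ln (p / D)]. *)
pose s := (D / p) `^ r^-1.
have Dp : 0 < D / p by rewrite divr_gt0.
have s0 : 0 < s by rewrite powR_gt0.
have sr : s `^ r = D / p by rewrite -powRrM mulVf ?gt_eqF// powRr1// ltW.
have st : s < t.
  rewrite ltNge; apply/negP => ts.
  have : t `^ r <= D / p by rewrite -sr ge0_ler_powR ?nnegrE ?(ltW hr) ?(ltW t0) ?(ltW s0).
  rewrite ler_pdivlMr// leNgt => /negP; apply.
  by near: D; apply: nbhs_right_lt; rewrite mulr_gt0// powR_gt0.
have hs := ht s _ s0; rewrite /ball_ /= sub0r normrN gtr0_norm// in hs.
have {hs} MI := hs st.
have lns : d%:R * ln s = - (p * ln (p / D)).
  by rewrite ln_powR -[p / D]invf_div lnV ?posrE// mulrN opprK mulrA.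
have up : (RD lam f N r D <= (RSLB lam f N r D + e)%:E)%E.
  apply: le_trans (ereal_inf_lbound _) _.
    exists (noise_channel (noise hd hN hr hlam) s); split => //.
    by rewrite (distortion_noise hd hN hr hlam mf f0 f1 s0) sr divfK// gt_eqF.
  apply: le_trans MI _; rewrite lee_fin (RSLBE hd hN hr hlam)// lns -/p opprK.
  by [].
have lo := RD_ge_RSLB hd hN hr hlam mf f0 f1 fint D0.
have RDfin : RD lam f N r D \is a fin_num.
  by rewrite fin_numE; apply/andP; split; apply/eqP => h; rewrite h in lo up.
move: lo up; rewrite -(fineK RDfin) -EFinB !lee_fin => lo up.
by rewrite subr_ge0 lo lerBlDl.
Unshelve. all: by end_near.
Qed.

Lemma cvg_RD_sub_RSLB :
  (fun D => (RD lam f N r D - (RSLB lam f N r D)%:E)%E) @ 0^'+ --> 0%E.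
Proof.
apply/fine_cvgP; split.
  apply: filterS (RD_sub_RSLB_le ltr01) => D /andP[h0 h1].
  by rewrite ge0_fin_numE// (le_lt_trans h1) ?ltry.
apply/cvgrPdist_le => e e0; apply: filterS (RD_sub_RSLB_le e0) => D /andP[h0 h1].
rewrite sub0r normrN ger0_norm /=; last exact: fine_ge0.
by rewrite -lee_fin fineK// ge0_fin_numE// (le_lt_trans h1) ?ltry.
Qed.

End Convergence.

Theorem theorem2 (R : realType) (d : nat) (hd : (0 < d)%N)
  (N : d.-tuple R -> R) (hN : is_norm N) (r : R) (hr : 0 < r)
  (lam : {measure set (d.-tuple R) -> \bar R}) (hlam : is_lebesgue lam)
  (f : d.-tuple R -> R) (mf : measurable_fun setT f) (f0 : forall x, 0 <= f x)
  (f1 : (\int[lam]_x (f x)%:E = 1)%E)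
  (fint : lam.-integrable setT (fun x => (f x * ln (f x))%:E)) :
  ((entropy_floor lam f < +oo)%E ->
     (fun D => (RD lam f N r D - (RSLB lam f N r D)%:E)%E) @ 0^'+ --> 0%E)
  /\
  (entropy_floor lam f = +oo%E ->
     forall D : R, 0 < D -> RD lam f N r D = +oo%E).
Proof.
split; first exact: cvg_RD_sub_RSLB.
by move=> Hinf D _; exact: (RD_infinite hd hN hr hlam mf f0 f1 D Hinf).
Qed.
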